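(* Let $k\ge1$ and $i\ge1$ be integers. For each $\lambda\in\Lambda_{k,i}$ with $T(\lambda)\neq\emptyset$ choose one $s^\lambda\in T(\lambda)$. Then the right ideals $$G_{s^\lambda,s^\lambda}\,TL_{(k,i)}=\mathrm{span}_{\mathbb{Q}(A)}\{G_{s^\lambda,t}: \omega(t)=\omega(s^\lambda)\}$$ generated by the idempotents $G_{s^\lambda,s^\lambda}$ form a complete set of pairwise non-isomorphic irreducible (right) $TL_{(k,i)}$-modules.
   Context: Let $A$ be an indeterminate, work over the field $\mathbb{Q}(A)$, and put $\delta=-A^{2}-A^{-2}$. For $m,n\ge 0$ let $TL(m,n)$ be the vector space with basis the isotopy classes of crossingless diagrams (without closed loops) in a rectangle with $m$ marked points on the bottom and $n$ on the top. Diagrams are composed by stacking, $XY$ meaning $X$ on top of $Y$, each closed loop being removed at the cost of a factor $\delta$; $\otimes$ denotes horizontal juxtaposition; $\mathrm{id}_n$ is the identity diagram. $TL_n=TL(n,n)$ is the Temperley-Lieb algebra, generated by $1,e_1,\dots,e_{n-1}$ with $e_j^2=\delta e_j$, $e_je_{j\pm1}e_j=e_j$, $e_je_l=e_le_j$ for $|j-l|>1$. The map $X\mapsto X^*$, $TL(m,n)\to TL(n,m)$, is the $\mathbb{Q}(A)$-linear extension of reflecting diagrams in a horizontal line. The trace $\mathrm{tr}:TL_n\to\mathbb{Q}(A)$ sends a diagram to $\delta^{c}$, with $c$ the number of loops obtained by joining the $j$-th top point to the $j$-th bottom point for all $j$ by planar arcs outside the rectangle. The Jones-Wenzl idempotent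 $f_n\in TL_n$ is the unique nonzero idempotent with $e_jf_n=f_ne_j=0$ for all $1\le j\le n-1$ ($f_0$ is the empty diagram). $\Delta_n=\mathrm{tr}(f_n)=(-1)^n\frac{A^{2n+2}-A^{-2n-2}}{A^2-A^{-2}}$. Colored Temperley-Lieb algebra: let $F=f_i^{\otimes k}\in TL_{ki}$. Then $TL_{(k,i)}=\{FXF: X\in TL_{ki}\}$, an algebra with identity $F$. Admissibility: a triple $(x,y,z)$ of non-negative integers is admissible if $x+y+z$ is even and $x\le y+z$, $y\le x+z$, $z\le x+y$. For $(x,y,z)$ admissible put $p=\frac{x+y-z}{2}$, $r=\frac{x+z-y}{2}$, $q=\frac{y+z-x}{2}$; the trivalent vertex is $V_{x,y}^{z}=f_z\,E\,(f_x\otimes f_y)\in TL(x+y,z)$, where $E\in TL(x+y,z)$ joins the last $p$ of the first $x$ bottom points to the first $p$ of the last $y$ bottom points by nested arcs, and the remaining $r+q=z$ bottom points to the top points without crossings. $\theta(x,y,z)=\mathrm{tr}\big(V_{x,y}^{z}(V_{x,y}^{z})^{*}\big)$. An $i$-admissible sequence of length $k$ is a sequence $s=(s_1,\dots,s_k)$ of non-negative integers with $s_1=i$ and $(s_{j-1},s_j,i)$ admissible for $1<j\le k$; its weight is $\omega(s)=s_k$. Define $v_s\in TL(ki,s_k)$ recursively by $v_{(i)}=f_i$, $v_{(s_1,\dots,s_m)}=V_{s_{m-1},i}^{s_m}(v_{(s_1,\dots,s_{m-1})}\otimes\mathrm{id}_i)$, and put $\eta(s)=\prod_{j=1}^{k-1}\frac{\theta(s_{j+1},s_j,i)}{\Delta_{s_{j+1}}}$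 (nonzero). $\Lambda_{k,i}=\{ki-2j: j=0,\dots,\lfloor ki/2\rfloor\}$; for $\lambda\in\Lambda_{k,i}$, $T(\lambda)$ is the set of $i$-admissible sequences of length $k$ and weight $\lambda$. For $s,t\in T(\lambda)$, $G_{s,t}=\frac{1}{\eta(s)}v_s^{*}v_t\in TL_{(k,i)}$. *)

(* Defs.v *)
From HB Require Import structures.
From mathcomp Require Import all_boot all_order all_algebra.
From mathcomp Require Import fraction.
From mathcomp Require Import boolp classical_sets functions.

Set Implicit Arguments.
Unset Strict Implicit.
Unset Printing Implicit Defensive.

Import GRing.Theory.

Local Open Scope ring_scope.
Local Open Scope classical_set_scope.

Notation QA := {fraction {poly rat}}.

Definition varA : QA := tofrac ('X : {poly rat}).
Definition delta : QA := - varA ^+ 2 - varA ^- 2.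

(* Marked points of a rectangle: [inl a] is the a-th point of the bottom side,
   [inr b] the b-th point of the top side, both numbered from left to right
   starting at 0. *)
Definition pt (m n : nat) : finType := ('I_m + 'I_n)%type.

(* Rank of a marked point when the boundary of the rectangle is traversed
   anticlockwise from the bottom left corner. *)
Definition bdpos m n (p : pt m n) : nat :=
  match p with inl a => a | inr b => m + (n - b.+1) end.

(* An isotopy class of crossingless diagrams without closed loops is determined
   by which marked points it joins; [d p] is the other end of the arc at [p]. *)
Definition is_diagram m n (d : {ffun pt m n -> pt m n}) : bool :=
  [forall p, (d p != p) && (d (d p) == p)] &&
  [forall p, forall q,
     ~~ [&& bdpos p < bdpos q, bdpos q < bdpos (d p)
          & bdpos (d p) < bdpos (d q)]%N].

Record diagram (m n : nat) : Type := Diagram {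
  arc :> {ffun pt m n -> pt m n};
  arcP : is_diagram arc }.

HB.instance Definition _ m n := [isSub for @arc m n].
HB.instance Definition _ m n := [Equality of diagram m n by <:].
HB.instance Definition _ m n := [Choice of diagram m n by <:].
HB.instance Definition _ m n := [Countable of diagram m n by <:].
HB.instance Definition _ m n := [Finite of diagram m n by <:].

Definition TL (m n : nat) := {ffun diagram m n -> QA^o}.

(* The basis vector of the diagram in which [p] and [q] are joined exactly when
   [R p q] holds (0 if no diagram has this property). *)
Definition basis m n (R : rel (pt m n)) : TL m n :=
  [ffun d : diagram m n => ([forall p, forall q, (d p == q) == R p q]%:R : QA)].

Definition idTL (n : nat) : TL n n :=
  basis (fun p q => match p, q with
    | inl a, inr b | inr b, inl a => a == b :> nat
    | _, _ => false end).

(* The generator usually called e_(j+1). *)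
Definition eTL (n j : nat) : TL n n :=
  basis (fun p q => match p, q with
    | inl a, inl b | inr a, inr b =>
        ((a == j :> nat) && (b == j.+1 :> nat))
        || ((a == j.+1 :> nat) && (b == j :> nat))
    | inl a, inr b | inr b, inl a =>
        [&& a == b :> nat, a != j :> nat & a != j.+1 :> nat] end).

Section Stack.
Variables (m n p : nat) (x : diagram n p) (y : diagram m n).

(* The graph obtained by gluing x on top of y: its vertices are the bottom and
   top points of y and the top points of x, the top points of y being identified
   with the bottom points of x. *)
Definition lowpt (u : pt m n) : pt m n + 'I_p := inl u.
Definition highpt (u : pt n p) : pt m n + 'I_p :=
  match u with inl c => inl (inr c) | inr b => inr b end.
Definition outpt (u : pt m p) : pt m n + 'I_p :=
  match u with inl a => inl (inl a) | inr b => inr b end.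

Definition stack_edge : rel (pt m n + 'I_p)%type := fun u v =>
  [exists a, (u == lowpt a) && (v == lowpt (y a))]
  || [exists a, (u == highpt a) && (v == highpt (x a))].

Definition stack_join : rel (pt m p) := fun a b =>
  (a != b) && connect stack_edge (outpt a) (outpt b).

(* A closed loop is a component that contains no outer point. *)
Definition stack_loops : nat :=
  n_comp stack_edge [pred u | ~~ [exists a, connect stack_edge u (outpt a)]].

End Stack.

(* X on top of Y. *)
Definition compTL m n p (X : TL n p) (Y : TL m n) : TL m p :=
  \sum_(x : diagram n p) \sum_(y : diagram m n)
    (X x * Y y * delta ^+ stack_loops x y : QA) *: basis (stack_join x y).

Notation "X *c Y" := (compTL X Y) (at level 40, left associativity).

Definition leftpt m n m' n' (u : pt m n) : pt (m + m') (n + n') :=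
  match u with inl a => inl (lshift m' a) | inr b => inr (lshift n' b) end.
Definition rightpt m n m' n' (u : pt m' n') : pt (m + m') (n + n') :=
  match u with inl a => inl (rshift m a) | inr b => inr (rshift n b) end.

Definition juxt_join m n m' n' (x : diagram m n) (y : diagram m' n') :
    rel (pt (m + m') (n + n')) := fun u v =>
  [exists a, (u == leftpt m' n' a) && (v == leftpt m' n' (x a))]
  || [exists a, (u == rightpt m n a) && (v == rightpt m n (y a))].

Definition tensTL m n m' n' (X : TL m n) (Y : TL m' n') :
    TL (m + m') (n + n') :=
  \sum_(x : diagram m n) \sum_(y : diagram m' n')
    (X x * Y y : QA) *: basis (juxt_join x y).

Notation "X *t Y" := (tensTL X Y) (at level 35, right associativity).

Definition swappt m n (u : pt m n) : pt n m :=
  match u with inl a => inr a | inr b => inl b end.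

Definition flipTL m n (X : TL m n) : TL n m :=
  \sum_(x : diagram m n)
    (X x : QA) *: basis (fun u v => x (swappt u) == swappt v).

Definition closure_edge n (x : diagram n n) : rel (pt n n) := fun u v =>
  (v == x u) || (v == swappt u).

Definition trTL n (X : TL n n) : QA :=
  \sum_(x : diagram n n) X x * delta ^+ n_comp (closure_edge x) predT.

Definition is_JW n (f : TL n n) : Prop :=
  [/\ f <> 0, f *c f = f &
      forall j, (j.+1 < n)%N -> eTL n j *c f = 0 /\ f *c eTL n j = 0].

(* Over Q(A) exactly one element satisfies [is_JW], so the default value 0 is
   never taken. *)
Definition JW n : TL n n := xget 0 [set f | is_JW f].

Definition Delta n : QA := trTL (JW n).

Definition admissible (x y z : nat) : bool :=
  [&& ~~ odd (x + y + z), x <= y + z, y <= x + z & z <= x + y]%N.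

(* Bottom points a and a' with r <= a, a' < x + p are joined when they are
   symmetric about the gap between the first x and the last y bottom points. *)
Definition vertexE (x y z : nat) : TL (x + y) z :=
  let p := ((x + y - z)./2)%N in
  let r := ((x + z - y)./2)%N in
  basis (fun u v => match u, v with
    | inl a, inl a' =>
        [&& r <= a, a < x + p & (a + a').+1 == x.*2]%N
    | inl a, inr b | inr b, inl a =>
        ((a < r) && (b == a :> nat)) || ((x + p <= a) && (a == b + p.*2 :> nat))
    | inr _, inr _ => false end)%N.

Definition vertex (x y z : nat) : TL (x + y) z :=
  JW z *c vertexE x y z *c (JW x *t JW y).

Definition theta (x y z : nat) : QA :=
  trTL (vertex x y z *c flipTL (vertex x y z)).

(* The number k * i (lemma [widthE]), set up so that [width 1 i] is convertible
   to [i] and [width k.+1 i] to [width k i + i]. *)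
Fixpoint width (k i : nat) : nat :=
  if k is k'.+1 then (width k' i + i)%N else 0%N.

Lemma widthE k i : width k i = (k * i)%N.
Proof. by elim: k => //= k ->; rewrite mulSn addnC. Qed.

Fixpoint JWpow (k i : nat) : TL (width k i) (width k i) :=
  if k is k'.+1 then JWpow k' i *t JW i else idTL 0.

Definition colTL (k i : nat) : set (TL (width k i) (width k i)) :=
  [set JWpow k i *c X *c JWpow k i | X in setT].
Arguments colTL : clear implicits.

(* [aseq i k z] is the type of the i-admissible sequences of length k and
   weight z, built by appending one entry at a time; lemmas [aseq_valP] and
   [aseq_val_inj] identify it with the corresponding set of lists. *)
Inductive aseq (i : nat) : nat -> nat -> Type :=
| aseq_one : aseq i 1 i
| aseq_rcons k x z : aseq i k x -> admissible x z i -> aseq i k.+1 z.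

Fixpoint aseq_val i k z (s : aseq i k z) : seq nat :=
  match s with
  | aseq_one => [:: i]
  | aseq_rcons _ _ z s' _ => rcons (aseq_val s') z
  end.

Definition admissible_seq (i k z : nat) (l : seq nat) : Prop :=
  [/\ size l = k, (0 < k)%N, nth 0%N l 0 = i, nth 0%N l k.-1 = z &
      forall j, (j.+1 < k)%N -> admissible (nth 0%N l j) (nth 0%N l j.+1) i].

Lemma aseq_val_adm i k z (s : aseq i k z) : admissible_seq i k z (aseq_val s).
Proof.
elim: s => [|{}k x {}z s [sz k0 h0 hl adm] xzi] /=; first by split.
split=> //; rewrite ?size_rcons ?sz //=.
- by rewrite nth_rcons sz k0.
- by rewrite nth_rcons sz ltnn eqxx.
move=> j; rewrite ltnS !nth_rcons sz => jk; rewrite jk.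
have [jk1|kj] := ltnP j.+1 k; first exact: adm.
have jE : j.+1 = k by apply/eqP; rewrite eqn_leq jk.
by rewrite jE eqxx -[j]/(j.+1.-1) jE hl.
Qed.

Lemma aseq_valP i k z l :
  (exists s : aseq i k z, aseq_val s = l) <-> admissible_seq i k z l.
Proof.
split=> [[s <-]|]; first exact: aseq_val_adm.
elim/last_ind: l k z => [|l y IH] k z [] /=; first by move=> <-.
rewrite size_rcons => <- _ h0 hz adm.
move: hz; rewrite /= nth_rcons ltnn eqxx => <-.
case: (posnP (size l)) => [/size0nil l_nil|l0].
  by move: h0; rewrite l_nil /= => ->; exists (aseq_one i).
have lK : (size l).-1.+1 = size l by rewrite prednK.
have [|s sl] := IH (size l) (nth 0%N l (size l).-1).
  split=> //; first by move: h0; rewrite nth_rcons l0.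
  by move=> j jl; move: (adm j); rewrite !nth_rcons (ltnW jl) jl; apply; apply: ltnW.
have := adm (size l).-1; rewrite !nth_rcons lK ltnn eqxx !leqnn.
by move=> /(_ isT) a; exists (aseq_rcons s a); rewrite /= sl.
Qed.

Lemma aseq_val_inj i k z : injective (@aseq_val i k z).
Proof.
pose T (u : nat * nat) := aseq i u.1 u.2.
have sz k' z' (s : aseq i k' z') : size (aseq_val s) = k'.
  by have [] := aseq_val_adm s.
have kpos z' (s : aseq i 0 z') : False by have [_] := aseq_val_adm s.
have inj k1 z1 (s : aseq i k1 z1) : forall k2 z2 (t : aseq i k2 z2),
    aseq_val s = aseq_val t ->
    @Tagged _ (k1, z1) T s = @Tagged _ (k2, z2) T t.
  elim: s => [|{}k1 x {}z1 s IH a] k2 z2 [|k' x' z' t b] //= st.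
  - have := congr1 size st; rewrite size_rcons sz /= => -[k0].
    by case: (kpos x'); rewrite k0.
  - have := congr1 size st; rewrite size_rcons sz /= => -[k0].
    by case: (kpos x); rewrite -k0.
  have [st' zz] := rcons_inj st; subst z'.
  have E := IH _ _ _ st'.
  have kk := congr1 (fun u => (tag u).1) E; rewrite /= in kk.
  have xx := congr1 (fun u => (tag u).2) E; rewrite /= in xx.
  subst k' x'; rewrite (eq_from_Tagged E); congr Tagged.
  by rewrite /T (bool_irrelevance a b).
by move=> s t /inj E; exact: (@eq_from_Tagged _ T (k, z) s t E).
Qed.

Fixpoint vTL i k z (s : aseq i k z) : TL (width k i) z :=
  match s with
  | aseq_one => JW i
  | aseq_rcons k' x z s' _ => vertex x i z *c (vTL s' *t idTL i)
  end.

Fixpoint eta i k z (s : aseq i k z) : QA :=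
  match s with
  | aseq_one => 1
  | aseq_rcons k' x z s' _ => eta s' * (theta z x i / Delta z)
  end.

Definition GTL i k lam (s t : aseq i k lam) : TL (width k i) (width k i) :=
  (eta s)^-1 *: (flipTL (vTL s) *c vTL t).

Definition Lambda (k i : nat) : seq nat :=
  [seq (k * i - j.*2)%N | j <- iota 0 ((k * i)./2).+1].

Definition is_subspace (W : lmodType QA) (P : set W) : Prop :=
  P 0 /\ forall a u v, P u -> P v -> P (a *: u + v).

Definition lin_span (W : lmodType QA) (S : set W) : set W :=
  [set w | exists (n : nat) (c : 'I_n -> QA) (u : 'I_n -> W),
     (forall j, S (u j)) /\ w = \sum_j c j *: u j].

Section Modules.
Variables k i : nat.
Local Notation N := (width k i).

(* A right [colTL k i]-module is given by a subspace [P] of a vector space [W]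
   (possibly all of [W]) and an action of which only the values at vectors of
   [P] and elements of [colTL k i] are relevant. *)
Record is_rmodule (W : lmodType QA) (P : set W) (act : W -> TL N N -> W) :
    Prop := {
  rmod_subspace : is_subspace P;
  rmod_closed : forall w X, P w -> colTL k i X -> P (act w X);
  rmod_linear_l : forall a w w' X, P w -> P w' -> colTL k i X ->
    act (a *: w + w') X = a *: act w X + act w' X;
  rmod_linear_r : forall a w X Y, P w -> colTL k i X -> colTL k i Y ->
    act w (a *: X + Y) = a *: act w X + act w Y;
  rmod_mul : forall w X Y, P w -> colTL k i X -> colTL k i Y ->
    act w (X *c Y) = act (act w X) Y;
  rmod_one : forall w, P w -> act w (JWpow k i) = w }.

Definition is_submodule (W : lmodType QA) (P : set W) (act : W -> TL N N -> W)
    (Q : set W) : Prop :=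
  [/\ is_subspace Q, Q `<=` P &
      forall w X, Q w -> colTL k i X -> Q (act w X)].

Definition irreducible_rmodule (W : lmodType QA) (P : set W)
    (act : W -> TL N N -> W) : Prop :=
  [/\ is_rmodule P act, P <> [set 0] &
      forall Q, is_submodule P act Q -> Q = [set 0] \/ Q = P].

Definition rmodule_iso (W W' : lmodType QA) (P : set W)
    (act : W -> TL N N -> W) (P' : set W') (act' : W' -> TL N N -> W') : Prop :=
  exists f : W -> W',
    [/\ set_bij P P' f,
        forall a u v, P u -> P v -> f (a *: u + v) = a *: f u + f v &
        forall w X, P w -> colTL k i X -> f (act w X) = act' (f w) X].

Definition ract : TL N N -> TL N N -> TL N N := fun w X => w *c X.

Definition right_ideal (e : TL N N) : set (TL N N) :=
  [set e *c X | X in colTL k i].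

End Modules.
Arguments ract : clear implicits.

(* Main.v *)
From HB Require Import structures.
Require Import Defs.
From mathcomp Require Import all_boot all_order all_algebra.
From mathcomp Require Import fraction zify ring lra.

(* A diagram is determined by the set of its states, the boolean labellings of the
   marked points that are constant on arcs, and gluing diagrams amounts to summing
   over the labels of the common points, each closed loop contributing a factor 2.
   All identities between diagrams are therefore identities of finite sums; only
   the planarity of a composite is proved separately, by contracting adjacent
   points one pair at a time.

   The form <X, Y> = tr (X Y^* ) is anisotropic over Q(A): after clearing denominators
   and specialising A to a large rational number the Gram matrix is dominated by its
   diagonal, because <d, d'> has strictly fewer loops than <d, d> when d <> d'. This
   gives the existence of the Jones-Wenzl idempotents f_n and makes every Delta_n and
   every theta (x, y, z) nonzero without computing them.

   A diagram without caps inside the first x and the last y bottom points and without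
   cups is the one underlying V_{x,y}^z, so f_z TL (f_x (x) f_y) is spanned by
   V_{x,y}^z. Together with the fact that an element killed by all f_z X vanishes,
   this yields f_x (x) f_y = sum_z (Delta_z / theta (x, y, z)) V^* V, hence
   F = sum_s G_{s,s}. Since theta is invariant under rotation, v_s v_s^* = eta(s) f,
   and G_{s,t} X G_{u,w} is a multiple of G_{s,w} or 0 according to the weights, so the
   G_{s,t} behave like matrix units and Schur's lemma applies. *)

Set Implicit Arguments.
Unset Strict Implicit.
Unset Printing Implicit Defensive.

(** * Diagrams and their states *)

(** A product of two diagrams is a power of delta times one diagram, and state counts recover both
    ingredients: the exponent because 2^a determines a, the diagram because its compatible states
    determine it. This is why counting at the single loop value 2 proves identities over Q(A). The
    product V V^* produces theta (x, i, z), while eta is built from theta (z, x, i). The rotation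
    symmetry that reconciles them is not formal: moving a leg of a vertex from bottom to top turns
    the box on that leg by a half turn, and it is the uniqueness of f_n that makes f_n invariant
    under this turn. Since [width k.+1 i] unfolds to [width k i + i] and sequences grow at their
    last entry, strands are always added on the right. Hence the interchange law [tens_comp] is
    enough and no associativity isomorphism for the tensor product is invoked. *)

Section ArcTheory.
Variables (m n : nat) (d : diagram m n).

Lemma arc_neq p : d p != p.
Proof. by have /andP[/forallP/(_ p)/andP[]] := arcP d. Qed.

Lemma arcK : involutive d.
Proof. by move=> p; have /andP[/forallP/(_ p)/andP[_ /eqP]] := arcP d. Qed.

Lemma arc_noncrossing p q :
  bdpos p < bdpos q -> bdpos q < bdpos (d p) -> bdpos (d p) < bdpos (d q) -> False.
Proof.
move=> pq qp pdq; have /andP[_ /forallP/(_ p)/forallP/(_ q)] := arcP d.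
by rewrite pq qp pdq.
Qed.
End ArcTheory.

Lemma bdpos_inj m n : injective (@bdpos m n).
Proof.
move=> [a|a] [b|b] /= e; move: (ltn_ord a) (ltn_ord b) => la lb; try by lia.
  by congr inl; apply: val_inj.
by congr inr; apply: val_inj => /=; lia.
Qed.

(** Under these conditions a relation is the arc relation of one diagram, so that [basis R] is a
    basis vector and not 0. *)
Record planar_matching m n (R : rel (pt m n)) : Prop := PlanarMatching {
  planar_total : forall p, exists q, R p q;
  planar_functional : forall p q q', R p q -> R p q' -> q = q';
  planar_sym : forall p q, R p q -> R q p;
  planar_irreflexive : irreflexive R;
  planar_noncrossing : forall p p' q q', R p p' -> R q q' ->
    bdpos p < bdpos q -> bdpos q < bdpos p' -> bdpos p' < bdpos q' -> False }.

Section DiagramOf.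
Variables (m n : nat) (R : rel (pt m n)) (PR : planar_matching R).

Lemma diagram_of_exists :
  exists d : diagram m n, [forall p, forall q, (d p == q) == R p q].
Proof.
have [Rex Run Rsym Rirr Rnc] := PR.
pose f := [ffun p => odflt p [pick q | R p q]].
have fR p : R p (f p).
  rewrite ffunE; case: pickP => //= H.
  by have [q] := Rex p; rewrite H.
have fd : is_diagram f.
  apply/andP; split; apply/forallP => p.
    apply/andP; split; first by apply/eqP => e; move: (fR p); rewrite e Rirr.
    by apply/eqP; apply: (Run (f p)) => //; apply: Rsym.
  by apply/forallP => q; apply/negP => /and3P[]; apply: Rnc.
exists (Diagram fd); apply/forallP => p; apply/forallP => q /=; apply/eqP.
by apply/eqP/idP => [<- //|Rpq]; apply: (Run p).
Qed.

Definition diagram_of : diagram m n := xchoose diagram_of_exists.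

Lemma diagram_ofE p q : (diagram_of p == q) = R p q.
Proof. by have /forallP/(_ p)/forallP/(_ q)/eqP := xchooseP diagram_of_exists. Qed.
End DiagramOf.

Definition state n := {ffun 'I_n -> bool}.

Definition glue m n (u : state m) (v : state n) (p : pt m n) : bool :=
  match p with inl a => u a | inr b => v b end.

Definition compat m n (d : diagram m n) (u : state m) (v : state n) : bool :=
  [forall p, glue u v (d p) == glue u v p].

Lemma compatP m n (d : diagram m n) u v :
  reflect (forall p, glue u v (d p) = glue u v p) (compat d u v).
Proof. by apply: (iffP forallP) => H p; apply/eqP. Qed.

Lemma glueE m n (s : pt m n -> bool) :
  glue [ffun a => s (inl a)] [ffun b => s (inr b)] =1 s.
Proof. by case=> a /=; rewrite ffunE. Qed.

Lemma compat_cst m n (d : diagram m n) c : compat d [ffun=> c] [ffun=> c].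
Proof. by apply/compatP => p; case: (d p) => a; case: p => b /=; rewrite !ffunE. Qed.

(** The state that is true exactly on the arc through p is compatible, and it separates that arc
    from all other points. The clause p <> q is there because p always has the same label as
    itself. *)
Lemma arc_compatP m n (d : diagram m n) p q :
  reflect (p <> q /\ forall u v, compat d u v -> glue u v p = glue u v q) (d p == q).
Proof.
apply: (iffP eqP) => [<-|[pq H]].
  by split=> [e|u v /compatP/(_ p) //]; have := arc_neq d p; rewrite -e eqxx.
pose s r := (r == p) || (r == d p).
have /H : compat d [ffun a => s (inl a)] [ffun b => s (inr b)].
  apply/compatP => r; rewrite !glueE /s orbC (inj_eq (inv_inj (arcK d))).
  by rewrite (can2_eq (arcK d) (arcK d)).
rewrite !glueE /s eqxx /= => /esym/orP[/eqP qp|/eqP //].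
by case: pq.
Qed.

Lemma compat_inj m n (d d' : diagram m n) :
  (forall u v, compat d u v = compat d' u v) -> d = d'.
Proof.
move=> dd'; apply/val_inj/ffunP => p; apply/eqP/arc_compatP; split.
  by move=> e; have := arc_neq d' p; rewrite /= -e eqxx.
by move=> u v; rewrite dd' => /compatP/(_ p) <-.
Qed.

(** * Composing diagrams preserves planarity *)

Section Contraction.
Variables (T : finType) (pos : T -> nat).

(** [M] is a total function constrained only on [S], so that points can be removed without changing
    the type. *)
Record matching (S : {set T}) (M : T -> T) : Prop := Matching {
  matching_in : forall p, p \in S -> M p \in S;
  matching_neq : forall p, p \in S -> M p <> p;
  matchingK : forall p, p \in S -> M (M p) = p;
  matching_noncrossing : forall p q, p \in S -> q \in S ->
    pos p < pos q -> pos q < pos (M p) -> pos (M p) < pos (M q) -> False }.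

Definition constant_on_arcs (S : {set T}) (M : T -> T) (s : T -> bool) :=
  forall p, p \in S -> s (M p) = s p.

(** The arcs ending at a and b are merged into one. If a and b are joined to each other, they form a
    closed loop, which simply disappears. *)
Definition contract (M : T -> T) (a b : T) (p : T) : T :=
  if M p == a then M b else if M p == b then M a else M p.

Variables (S : {set T}) (M : T -> T) (a b : T).
Hypotheses (MS : matching S M) (aS : a \in S) (bS : b \in S) (ab : a <> b).

Lemma contract_in p : p \in S :\ a :\ b -> contract M a b p \in S :\ a :\ b.
Proof.
have [Min Mneq MK _] := MS.
rewrite !inE => /and3P[/eqP pb /eqP pa pS]; rewrite /contract.
have aux q r : q \in S -> r \in S -> M q = M r -> q = r.
  by move=> qS rS e; rewrite -(MK q) // e MK.
case: (M p =P a) => [e|na]; last case: (M p =P b) => [e|nb].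
- have pE : p = M a by rewrite -e MK.
  rewrite Min // andbT; apply/andP; split; apply/eqP; first exact: Mneq.
  by move=> e2; apply: pb; rewrite pE -e2 MK.
- have pE : p = M b by rewrite -e MK.
  rewrite Min // andbT; apply/andP; split; apply/eqP; last exact: Mneq.
  by move=> e2; apply: pa; rewrite pE -e2 MK.
by rewrite Min // andbT; apply/andP; split; apply/eqP.
Qed.

(** The hypothesis says that no remaining point lies between a and b. An arc that avoids both then
    has them on the same side, so merging their arcs creates no crossing. *)
Lemma contract_matching :
  (forall p, p \in S -> p <> a -> p <> b ->
     (pos p < pos a /\ pos p < pos b) \/ (pos a < pos p /\ pos b < pos p)) ->
  matching (S :\ a :\ b) (contract M a b).
Proof.
have [Min Mneq MK Mnc] := MS => adj.
split=> [|p|p|p q].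
- exact: contract_in.
- rewrite !inE /contract => /and3P[/eqP pb /eqP pa pS].
  case: (M p =P a) => [e|na]; last case: (M p =P b) => [e|nb]; last exact: Mneq.
    by move=> e2; apply: ab; rewrite -e -e2 MK.
  by move=> e2; apply: ab; rewrite -e -e2 MK.
- rewrite !inE /contract => /and3P[/eqP pb /eqP pa pS].
  case: (M p =P a) => [e|na]; last case: (M p =P b) => [e|nb].
  + rewrite MK // (introF eqP (nesym ab)) eqxx -e MK //.
  + by rewrite MK // eqxx -e MK.
  by rewrite MK // (introF eqP pa) (introF eqP pb).
rewrite !inE /contract => /and3P[/eqP pb /eqP pa pS] /and3P[/eqP qb /eqP qa qS].
have nc u v : u \in S -> v \in S ->
  ~ (pos u < pos v /\ pos v < pos (M u) /\ pos (M u) < pos (M v)).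
  by move=> uS vS [h1 [h2 h3]]; apply: (Mnc u v).
(* If u is joined to a or b, then u, a and b all lie on the same side of an arc at v that avoids a
   and b. *)
have {adj}nc' u v : u \in S -> v \in S -> M u = a \/ M u = b ->
  v <> a -> v <> b -> M v <> a -> M v <> b ->
  (pos v < pos u < pos (M v) -> pos v < pos a < pos (M v) /\ pos v < pos b < pos (M v)) /\
  ((pos u < pos v < pos (M v)) || (pos v < pos (M v) < pos u) ->
    ((pos a < pos v) || (pos (M v) < pos a)) /\ ((pos b < pos v) || (pos (M v) < pos b))).
  move=> uS vS e va vb Mva Mvb.
  have MuS := Min _ uS; have MvS := Min _ vS.
  have n1 := nc _ _ uS vS; have n2 := nc _ _ uS MvS.
  have n3 := nc _ _ MuS vS; have n4 := nc _ _ MuS MvS.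
  have n5 := nc _ _ vS uS; have n6 := nc _ _ MvS uS.
  have n7 := nc _ _ vS MuS; have n8 := nc _ _ MvS MuS.
  have a1 := adj _ vS va vb; have a2 := adj _ MvS Mva Mvb.
  rewrite !MK // in n1 n2 n3 n4 n5 n6 n7 n8.
  split=> c; case: e => e; rewrite e in n1 n2 n3 n4 n5 n6 n7 n8; lia.
have MMa : M (M a) = a by rewrite MK.
have MMb : M (M b) = b by rewrite MK.
have MaS := Min _ aS; have MbS := Min _ bS.
case: (M p =P a) => [e|na].
  case: (M q =P a) => [e'|na']; last case: (M q =P b) => [e'|nb'].
  - by have -> : p = q; [rewrite -[LHS]MK // e -e' MK | lia].
  - by rewrite -e MK // -e' MK //; lia.
  move=> o1 o2 o3.
  have := nc' _ _ pS qS (or_introl e) qa qb na' nb'.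
  have := nc' _ _ MbS qS (or_intror MMb) qa qb na' nb'.
  by lia.
case: (M p =P b) => [e|nb].
  case: (M q =P a) => [e'|na']; last case: (M q =P b) => [e'|nb'].
  - by rewrite -e MK // -e' MK //; lia.
  - by have -> : p = q; [rewrite -[LHS]MK // e -e' MK | lia].
  move=> o1 o2 o3.
  have := nc' _ _ pS qS (or_intror e) qa qb na' nb'.
  have := nc' _ _ MaS qS (or_introl MMa) qa qb na' nb'.
  by lia.
case: (M q =P a) => [e|na'].
  move=> o1 o2 o3.
  have := nc' _ _ qS pS (or_introl e) pa pb na nb.
  have := nc' _ _ MbS pS (or_intror MMb) pa pb na nb.
  by lia.
case: (M q =P b) => [e|nb'].
  move=> o1 o2 o3.
  have := nc' _ _ qS pS (or_intror e) pa pb na nb.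
  have := nc' _ _ MaS pS (or_introl MMa) pa pb na nb.
  by lia.
exact: Mnc.
Qed.

Lemma contract_states s :
  constant_on_arcs (S :\ a :\ b) (contract M a b) s <->
  exists t, [/\ forall p, p <> a -> p <> b -> t p = s p, t a = t b &
                constant_on_arcs S M t].
Proof.
have [Min Mneq MK _] := MS; split=> [sc|[t [ts tab tc]]].
  (* When M a = b this is the value of [s] at a removed point, hence arbitrary: a closed loop may
     carry either label. *)
  pose c := s (M a).
  pose t p := if (p == a) || (p == b) then c else s p.
  have tE p : p <> a -> p <> b -> t p = s p.
    by rewrite /t => /eqP/negPf-> /eqP/negPf->.
  have ta : t a = c by rewrite /t eqxx.
  have tb : t b = c by rewrite /t eqxx orbT.
  have MaS := Min _ aS; have MbS := Min _ bS.
  have tMa : t (M a) = c.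
    case: (M a =P b) => [->//|n]; rewrite tE //; exact: Mneq.
  have tMb : t (M b) = c.
    case: (M b =P a) => [->//|n]; rewrite tE //; last exact: Mneq.
    have Mab : M a <> b by move=> e; apply: n; rewrite -e MK.
    have /sc : M a \in S :\ a :\ b.
      by rewrite !inE MaS andbT; apply/andP; split; apply/eqP => //; apply: Mneq.
    by rewrite /contract MK // eqxx.
  exists t; split=> [//||p pS]; first by rewrite ta tb.
  case: (p =P a) => [->|pa]; first by rewrite tMa ta.
  case: (p =P b) => [->|pb]; first by rewrite tMb tb.
  case: (M p =P a) => [e|na]; first by rewrite e ta -tMa -e MK.
  case: (M p =P b) => [e|nb]; first by rewrite e tb -tMb -e MK.
  rewrite !tE //.
  have /sc : p \in S :\ a :\ b.
    by rewrite !inE pS andbT; apply/andP; split; apply/eqP.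
  by rewrite /contract (introF eqP na) (introF eqP nb).
move=> p pS; have qS := contract_in pS; move: pS qS; rewrite !inE.
move=> /and3P[/eqP pb /eqP pa pS] /and3P[/eqP qb /eqP qa qS].
rewrite -(ts p) // -(ts _ qa qb) /contract.
case: (M p =P a) => [e|na]; last case: (M p =P b) => [e|nb]; last exact: tc.
  by rewrite tc // -tab -e tc.
by rewrite tc // tab -e tc.
Qed.
End Contraction.

Section Compose.
Variables (m n p : nat) (x : diagram n p) (y : diagram m n).

(* The two diagrams side by side, bent so that the i-th top point of [y] and the
   i-th bottom point of [x] become adjacent once those with smaller i are gone. *)
Let T : finType := (pt m n + pt n p)%type.
Let pos (t : T) := match t with inl u => bdpos u | inr u => m + n + bdpos u end.

Let rest k : {set T} := [set t : T | match t with
  | inl (inr b) => k <= nat_of_ord b | inr (inl c) => k <= nat_of_ord c | _ => true end].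

Let juxt (t : T) : T := match t with inl u => inl (y u) | inr u => inr (x u) end.

Let bdpos_lt m' n' (u : pt m' n') : bdpos u < m' + n'.
Proof. by case: u => a /=; move: (ltn_ord a); lia. Qed.

(** The k-th middle points sit at positions m + n - k - 1 and m + n + k. The points between them are
    middle points of smaller index, already contracted, so [contract_matching] applies at each
    step. *)
Let contracted k : k <= n -> exists M, matching pos (rest k) M /\
  forall s, constant_on_arcs (rest k) M s <->
   exists t, [/\ forall q, q \in rest k -> t q = s q,
     forall b : 'I_n, b < k -> t (inl (inr b)) = t (inr (inl b)),
     forall q, t (inl (y q)) = t (inl q) & forall q, t (inr (x q)) = t (inr q)].
Proof.
elim: k => [_|k IH kn].
  have rest0 t : t \in rest 0 by rewrite inE; case: t => [[]|[]].
  exists juxt; split.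
    split=> [//|[u|u] _|[u|u] _|[u|u] [v|v] _ _] /=.
    - by case=> e; have := arc_neq y u; rewrite e eqxx.
    - by case=> e; have := arc_neq x u; rewrite e eqxx.
    - by rewrite arcK.
    - by rewrite arcK.
    - exact: arc_noncrossing.
    - by move=> _ h; have := ltn_trans h (bdpos_lt (y u)); lia.
    - by move=> h; have := ltn_trans h (bdpos_lt v); lia.
    - by rewrite !ltn_add2l; exact: arc_noncrossing.
  move=> s; split=> [sc|[t [ts _ ty tx]] [u|u] _ /=]; last 2 first.
  - by rewrite -!ts.
  - by rewrite -!ts.
  exists s; split=> // q; first exact: (sc (inl q)).
  exact: (sc (inr q)).
have [M [MS Mst]] := IH (ltnW kn).
pose a : T := inl (inr (Ordinal kn)); pose b : T := inr (inl (Ordinal kn)).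
have aS : a \in rest k by rewrite inE /=.
have bS : b \in rest k by rewrite inE /=.
have ab : a <> b by [].
have restE : rest k :\ a :\ b = rest k.+1.
  apply/setP=> t; rewrite !inE; case: t => [[c|c]|[c|c]] //=.
    by rewrite [RHS]ltn_neqAle; congr (_ && _); rewrite eq_sym.
  by rewrite [RHS]ltn_neqAle; congr (_ && _); rewrite eq_sym.
exists (contract M a b); rewrite -restE; split.
  apply: contract_matching => // q; rewrite inE.
  case: q => [[c|c]|[c|c]] /=.
  - by move: (ltn_ord c); lia.
  - move=> kc ca _; have : k != c.
      by apply/eqP=> e; apply: ca; congr (inl (inr _)); apply: val_inj.
    by move: (ltn_ord c); lia.
  - move=> kc _ cb; have : k != c.
      by apply/eqP=> e; apply: cb; congr (inr (inl _)); apply: val_inj.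
    by move: (ltn_ord c); lia.
  - by move: (ltn_ord c); lia.
move=> s; rewrite (contract_states MS aS bS); split.
  case=> t [ts tab /Mst[t' [t's t'k ty tx]]]; exists t'; split=> //.
    move=> q; rewrite !inE => /and3P[/eqP qb /eqP qa qS].
    by rewrite t's ?inE // ts.
  move=> c; rewrite ltnS leq_eqVlt => /predU1P[ck|]; last exact: t'k.
  have cE : c = Ordinal kn by apply: val_inj.
  by rewrite cE -/a -/b !t's // tab.
case=> t [ts tk ty tx].
exists (fun q => if (q == a) || (q == b) then t a else s q).
rewrite !eqxx orbT /=; split=> //.
  by move=> q /eqP/negPf-> /eqP/negPf->.
apply/Mst; exists t; split=> // [q qS|c /ltnW ck]; last exact: tk.
case: eqP => [->//|/eqP qa]; case: eqP => [->/=|/eqP qb]; first by rewrite tk //=.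
by rewrite /= ts // !inE qb qa; rewrite inE in qS.
Qed.

(** Only the existence of a middle labelling is recorded, which loses the closed loops; [card_comp]
    recovers their number by counting the labellings. *)
Lemma comp_exists : exists z : diagram m p, forall u w,
  compat z u w = [exists v, compat y u v && compat x v w].
Proof.
have [M [[Min Mneq MK Mnc] Mst]] := contracted (leqnn n).
pose out (q : pt m p) : T := match q with inl a => inl (inl a) | inr b => inr (inr b) end.
have outS q : out q \in rest n by case: q => a; rewrite inE.
have outP t : t \in rest n -> exists q, t = out q.
  rewrite inE; case: t => [[a|b]|[a|b]].
  - by exists (inl a).
  - by rewrite (leqNgt n) ltn_ord.
  - by rewrite (leqNgt n) ltn_ord.
  by exists (inr b).
have out_inj : injective out.
  pose back (t : T) : option (pt m p) := match t with
    inl (inl a) => Some (inl a) | inr (inr b) => Some (inr b) | _ => None end.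
  by apply: (@pcan_inj _ _ out back); case.
have out_lt q r : (pos (out q) < pos (out r)) = (bdpos q < bdpos r).
  by case: q => a; case: r => b /=; move: (ltn_ord a) (ltn_ord b); lia.
have outM : planar_matching (fun q r => M (out q) == out r).
  split.
  - by move=> q; have [r ->] := outP _ (Min _ (outS q)); exists r.
  - by move=> q r r' /eqP e1 /eqP e2; apply: out_inj; rewrite -e1.
  - by move=> q r /eqP <-; rewrite MK.
  - by move=> q; apply/eqP; apply: Mneq.
  move=> q q' r r' /eqP qq' /eqP rr'; rewrite -!out_lt -qq' -rr'.
  exact: Mnc.
have zP := diagram_ofE outM; set z := diagram_of outM in zP.
have zM q : M (out q) = out (z q) by apply/eqP; rewrite -zP.
exists z => u w; pose s (t : T) := match t with
  | inl (inl a) => u a | inr (inr b) => w b | _ => false end.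
have sout q : s (out q) = glue u w q by case: q.
have Ms : compat z u w <-> constant_on_arcs (rest n) M s.
  split=> [/compatP zuw t /outP[q ->]|sc]; first by rewrite zM !sout zuw.
  by apply/compatP => q; rewrite -!sout -zM sc.
apply/idP/existsP => [/Ms/Mst[t [ts tm ty tx]]|[v /andP[/compatP yuv /compatP xvw]]].
  exists [ffun b => t (inl (inr b))].
  have g1 q : glue u [ffun b => t (inl (inr b))] q = t (inl q).
    by case: q => a /=; rewrite ?ffunE // ts ?inE.
  have g2 q : glue [ffun b => t (inl (inr b))] w q = t (inr q).
    by case: q => a /=; rewrite ?ffunE ?tm ?ltn_ord // ts ?inE.
  by apply/andP; split; apply/compatP => q; rewrite ?g1 ?g2.
apply/Ms/Mst; exists (fun t => match t with inl q => glue u v q | inr q => glue v w q end).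
split=> // t /outP[q ->]; rewrite sout; by case: q.
Qed.

End Compose.

(** * Counting states of a stack *)

Lemma comp_exists_bool m n p (x : diagram n p) (y : diagram m n) :
  exists z : diagram m p, [forall u, forall w,
    compat z u w == [exists v, compat y u v && compat x v w]].
Proof.
have [z zP] := comp_exists x y; exists z.
by apply/forallP => u; apply/forallP => w; rewrite zP.
Qed.

Definition compd m n p (x : diagram n p) (y : diagram m n) : diagram m p :=
  xchoose (comp_exists_bool x y).

Lemma compat_comp m n p (x : diagram n p) (y : diagram m n) u w :
  compat (compd x y) u w = [exists v, compat y u v && compat x v w].
Proof.
by have /forallP/(_ u)/forallP/(_ w)/eqP := xchooseP (comp_exists_bool x y).
Qed.

(** With [s0] as base point, the invariant labellings that agree with it off A arise by toggling
    [s0] on an arbitrary set of components contained in A. *)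
Lemma card_invariant (V : finType) (e : rel V) (A : pred V) (s0 : V -> bool) :
  connect_sym e -> closed e A -> (forall u v, e u v -> s0 u = s0 v) ->
  #|[set s : {ffun V -> bool} |
       [forall u, forall v, e u v ==> (s u == s v)]
         && [forall v, (v \notin A) ==> (s v == s0 v)]]| = 2 ^ n_comp e A.
Proof.
move=> sym clA s0e; pose B := [set r | roots e r & r \in A].
pose f (X : {set V}) := [ffun v => s0 v (+) (fingraph.root e v \in X)].
have -> : n_comp e A = #|B| by apply: eq_card => r; rewrite !inE.
rewrite -card_powerset -(@card_in_imset _ _ f); last first.
  move=> X Y; rewrite !inE => /subsetP XB /subsetP YB /ffunP fXY; apply/setP => r.
  case rB: (r \in B); last first.
    by rewrite (contraFF (XB r) rB) (contraFF (YB r) rB).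
  have := fXY r; move: rB; rewrite !ffunE inE => /andP[/eqP -> _].
  by move/addbI.
have inv (s : V -> bool) : (forall u v, e u v -> s u = s v) ->
    forall u v, connect e u v -> s u = s v.
  move=> se u v /connectP[q]; elim: q u => [|w q IH] u /=; first by move=> _ ->.
  by move=> /andP[/se -> wq] /(IH _ wq).
apply: eq_card => s; rewrite inE; apply/andP/imsetP => [[/forallP s1 /forallP s2]|].
  have se u v : e u v -> s u = s v.
    by move=> uv; have /forallP/(_ v)/implyP/(_ uv)/eqP := s1 u.
  exists [set r in B | s r != s0 r].
    by rewrite inE; apply/subsetP => r; rewrite inE => /andP[].
  apply/ffunP => v; rewrite ffunE !inE.
  have vr := connect_root e v.
  rewrite /roots /= root_root // eqxx /= -(inv s se _ _ vr) -(inv s0 s0e _ _ vr).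
  have -> : (fingraph.root e v \in A) = (v \in A) by rewrite -(closed_connect clA vr).
  case: (boolP (v \in A)) => [_|vA] /=.
    by case: (s v); case: (s0 v).
  by have /implyP/(_ vA)/eqP -> := s2 v; rewrite addbF.
case=> X; rewrite inE => /subsetP XB ->; split.
  apply/forallP=> u; apply/forallP => v; apply/implyP => uv; rewrite !ffunE.
  by rewrite (s0e _ _ uv) (fingraph.rootP sym (connect1 uv)).
apply/forallP => v; apply/implyP => vA; rewrite ffunE.
case: (boolP (fingraph.root e v \in X)) => [/XB|_]; last by rewrite addbF.
by rewrite inE -(closed_connect clA (connect_root e v)) (negPf vA) andbF.
Qed.

Lemma sum_nat_bool (I : finType) (P : pred I) :
  (\sum_i P i)%N = #|[set i | P i]|.
Proof.
by rewrite -sum1_card [RHS]big_mkcond; apply: eq_bigr => i _; rewrite inE; case: (P i).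
Qed.

Section StackComp.
Variables (m n p : nat) (x : diagram n p) (y : diagram m n).
Local Notation e := (stack_edge x y).

Let gluing (u : state m) (v : state n) (w : state p) (t : pt m n + 'I_p) : bool :=
  match t with inl q => glue u v q | inr c => w c end.

Lemma stack_edge_sym : symmetric e.
Proof.
suff H u v : e u v -> e v u by move=> u v; apply/idP/idP; apply: H.
case/orP=> /existsP[a /andP[/eqP-> /eqP->]]; apply/orP; [left|right]; apply/existsP.
  by exists (y a); rewrite arcK !eqxx.
by exists (x a); rewrite arcK !eqxx.
Qed.

Let stack_csym : connect_sym e.
Proof. by apply: sym_connect_sym; apply: stack_edge_sym. Qed.

Let invariantP (s : pt m n + 'I_p -> bool) :
  (forall u v, e u v -> s u = s v) <->
  compat y [ffun a => s (inl (inl a))] [ffun b => s (inl (inr b))]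
  && compat x [ffun b => s (inl (inr b))] [ffun c => s (inr c)].
Proof.
have g1 q : glue [ffun a => s (inl (inl a))] [ffun b => s (inl (inr b))] q = s (lowpt p q).
  by case: q => a; rewrite /= ffunE.
have g2 q : glue [ffun b => s (inl (inr b))] [ffun c => s (inr c)] q = s (@highpt m n p q).
  by case: q => a; rewrite /= ffunE.
split=> [H|/andP[/compatP H1 /compatP H2] u v].
  apply/andP; split; apply/compatP => q; rewrite ?g1 ?g2; apply/esym/H.
    by apply/orP; left; apply/existsP; exists q; rewrite !eqxx.
  by apply/orP; right; apply/existsP; exists q; rewrite !eqxx.
case/orP=> /existsP[a /andP[/eqP-> /eqP->]]; first by rewrite -!g1 H1.
by rewrite -!g2 H2.
Qed.

Let gluingE u v w (s : pt m n + 'I_p -> bool) : s =1 gluing u v w ->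
  [/\ [ffun a => s (inl (inl a))] = u, [ffun b => s (inl (inr b))] = v
    & [ffun c => s (inr c)] = w].
Proof. by move=> sE; split; apply/ffunP => a; rewrite ffunE sE. Qed.

Let gluing_inv u v w : compat y u v -> compat x v w ->
  forall s t, connect e s t -> gluing u v w s = gluing u v w t.
Proof.
move=> yuv xvw.
have [e1 e2 e3] := @gluingE u v w _ (frefl _).
have inv : forall s t, e s t -> gluing u v w s = gluing u v w t.
  by apply/invariantP; rewrite e1 e2 e3 yuv xvw.
move=> s t /connectP[q]; elim: q s => [|r q IH] s /=; first by move=> _ ->.
by move=> /andP[/inv -> rq] /(IH _ rq).
Qed.

Let gluing_out u v w q : gluing u v w (outpt n q) = glue u w q.
Proof. by case: q. Qed.

(** For the direction from the composite back to connectedness, the indicator of the component of q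
    is a compatible labelling of the whole stack, so r, having the same label as q, lies in that
    component. *)
Lemma stack_joinE q r : stack_join x y q r = (compd x y q == r).
Proof.
apply/andP/arc_compatP => [[/eqP qr qc]|[/eqP qr H]]; split=> //.
  move=> u w; rewrite compat_comp => /existsP[v /andP[yuv xvw]].
  by rewrite -!(@gluing_out u v w); apply: gluing_inv.
pose s t := connect e (outpt n q) t.
have /invariantP/andP[yuv xvw] : forall t t', e t t' -> s t = s t'.
  by move=> t t' /connect1 tt'; apply: same_connect_r.
have /H : compat (compd x y) [ffun a => s (inl (inl a))] [ffun c => s (inr c)].
  rewrite compat_comp; apply/existsP; exists [ffun b => s (inl (inr b))].
  by rewrite yuv.
have gE t : glue [ffun a => s (inl (inl a))] [ffun c => s (inr c)] t = s (outpt n t).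
  by case: t => a /=; rewrite ffunE.
by rewrite !gE /s connect0 => <-.
Qed.

(** Once one middle labelling [v0] exists, all others differ from it on components without outer
    points only, that is, by a free choice on each closed loop. *)
Lemma card_comp u w :
  (\sum_v (compat y u v && compat x v w))%N =
  (2 ^ stack_loops x y * compat (compd x y) u w)%N.
Proof.
rewrite compat_comp; case: existsP => [[v0 /andP[y0 x0]]|H]; last first.
  by rewrite muln0 big1 // => v _; case yx: (_ && _) => //; case: H; exists v.
rewrite muln1 -(@card_invariant _ e _ (gluing u v0 w)) //; first last.
- by move=> s t /connect1; apply: gluing_inv.
- move=> s t /connect1 st; rewrite !inE; congr (~~ _).
  by apply: eq_existsb => a; apply: same_connect.
rewrite sum_nat_bool.
rewrite -(@card_in_imset _ _ (fun v => [ffun t => gluing u v w t])); last first.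
  move=> v v' _ _ /ffunP vv'; apply/ffunP => b.
  by have := vv' (inl (inr b)); rewrite !ffunE.
apply: eq_card => s; rewrite inE; apply/imsetP/andP.
  case=> v; rewrite inE => /andP[yv xv] ->; split.
    apply/forallP=> t; apply/forallP=> t'; apply/implyP=> tt'; apply/eqP.
    by rewrite !ffunE; apply: gluing_inv => //; apply: connect1.
  apply/forallP => t; rewrite !inE negbK; apply/implyP => /existsP[a ta].
  by rewrite ffunE (gluing_inv yv xv ta) (gluing_inv y0 x0 ta) !gluing_out.
case=> /forallP s1 /forallP s2.
have s1' : forall t t', e t t' -> s t = s t'.
  by move=> t t' tt'; apply/eqP; have /forallP/(_ t')/implyP := s1 t; apply.
have s2' q : s (outpt n q) = glue u w q.
  rewrite -(@gluing_out u v0 w); apply/eqP; have /implyP := s2 (outpt n q); apply.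
  by rewrite !inE negbK; apply/existsP; exists q; rewrite connect0.
have sE : s =1 gluing u [ffun b => s (inl (inr b))] w.
  case=> [[a|b]|c] /=; rewrite ?ffunE //; first exact: (s2' (inl a)).
  exact: (s2' (inr c)).
have [e1 e2 e3] := gluingE sE.
exists [ffun b => s (inl (inr b))]; last by apply/ffunP => t; rewrite ffunE.
by rewrite inE; move/invariantP: s1'; rewrite e1 e3.
Qed.

End StackComp.

Lemma closure_edge_sym n (x : diagram n n) : symmetric (closure_edge x).
Proof.
have swapK : involutive (@swappt n n) by case.
move=> u v; rewrite /closure_edge; congr (_ || _).
  by rewrite eq_sym -(inj_eq (inv_inj (arcK x))) arcK eq_sym.
by rewrite eq_sym -(inj_eq (inv_inj swapK)) swapK eq_sym.
Qed.

Lemma card_closure n (x : diagram n n) :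
  (\sum_u compat x u u)%N = (2 ^ n_comp (closure_edge x) predT)%N.
Proof.
rewrite -(@card_invariant _ _ predT (fun=> true)) //; last first.
  by apply: sym_connect_sym; apply: closure_edge_sym.
rewrite sum_nat_bool.
rewrite -(@card_in_imset _ _ (fun u : state n => [ffun t => glue u u t])); last first.
  move=> v v' _ _ /ffunP vv'; apply/ffunP => b.
  by have := vv' (inl b); rewrite !ffunE.
apply: eq_card => s; rewrite inE; apply/imsetP/andP.
  case=> u; rewrite inE => /compatP xu ->; split; last by apply/forallP.
  apply/forallP=> t; apply/forallP=> t'; apply/implyP; rewrite !ffunE.
  by case/orP => /eqP->; rewrite ?xu //; case: t.
case=> /forallP s1 _.
have s1' : forall t t', closure_edge x t t' -> s t = s t'.
  by move=> t t' tt'; apply/eqP; have /forallP/(_ t')/implyP := s1 t; apply.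
have gE : glue [ffun a => s (inl a)] [ffun a => s (inl a)] =1 s.
  case=> a /=; rewrite ffunE //; apply: s1'; by rewrite /closure_edge eqxx orbT.
exists [ffun a => s (inl a)]; last by apply/ffunP => t; rewrite ffunE gE.
rewrite inE; apply/compatP => q; rewrite !gE; apply/esym/s1'.
by rewrite /closure_edge eqxx.
Qed.

(** * Reflection, rotation and juxtaposition *)

Lemma compat_arcs m n (d : diagram m n) u v :
  reflect (forall p q, d p == q -> glue u v p = glue u v q) (compat d u v).
Proof.
apply: (iffP (compatP d u v)) => [H p q /eqP <-|H p]; first by rewrite H.
by apply/esym/H.
Qed.

Definition id_rel n : rel (pt n n) := fun p q =>
  match p, q with
  | inl a, inr b | inr b, inl a => a == b :> nat
  | _, _ => false end.

Lemma id_planar n : planar_matching (@id_rel n).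
Proof.
split.
- by case=> a; [exists (inr a)|exists (inl a)] => /=.
- move=> [a|a] [b|b] [c|c] //= /eqP e1 /eqP e2; congr (_ _); apply: val_inj => /=;
    by rewrite -?e1 -?e2 ?e1 ?e2.
- by move=> [a|a] [b|b].
- by move=> [a|a].
- move=> [a|a] [b|b] [a'|a'] [b'|b'] //= /eqP e1 /eqP e2;
  move: (ltn_ord a) (ltn_ord a') (ltn_ord b) (ltn_ord b'); lia.
Qed.

Definition id_diagram n : diagram n n := diagram_of (id_planar n).

Lemma compat_id n u v : compat (id_diagram n) u v = (u == v).
Proof.
apply/compat_arcs/eqP => [H|-> [a|a] [b|b]]; last 4 first.
- by rewrite diagram_ofE.
- by rewrite diagram_ofE => /eqP/val_inj->.
- by rewrite diagram_ofE => /eqP/val_inj->.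
- by rewrite diagram_ofE.
by apply/ffunP => a; apply: (H (inl a) (inr a)); rewrite diagram_ofE /=.
Qed.

Definition flip_rel m n (x : diagram m n) : rel (pt n m) :=
  fun u v => x (swappt u) == swappt v.

Lemma swapptK m n : cancel (@swappt m n) (@swappt n m).
Proof. by case. Qed.

Lemma bdpos_swap m n (p : pt m n) : bdpos (swappt p) + bdpos p + 1 = m + n.
Proof. by case: p => a /=; move: (ltn_ord a); lia. Qed.

Lemma flip_planar m n (x : diagram m n) : planar_matching (flip_rel x).
Proof.
split.
- by move=> p; exists (swappt (x (swappt p))); rewrite /flip_rel swapptK.
- by move=> p q r /eqP e1 /eqP e2; apply: (can_inj (@swapptK n m)); rewrite -e1 -e2.
- by move=> p q /eqP e; rewrite /flip_rel -e arcK.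
- by move=> p; apply/negbTE/arc_neq.
move=> p p' q q' /eqP e1 /eqP e2.
have := @arc_noncrossing _ _ x (x (swappt q)) (x (swappt p)).
rewrite !arcK e1 e2.
have := bdpos_swap p; have := bdpos_swap q.
have := bdpos_swap p'; have := bdpos_swap q'; lia.
Qed.

Definition flipd m n (x : diagram m n) : diagram n m := diagram_of (flip_planar x).

Lemma compat_flip m n (x : diagram m n) u v : compat (flipd x) u v = compat x v u.
Proof.
have gE p : glue u v p = glue v u (swappt p) by case: p.
apply/compat_arcs/compat_arcs => H p q.
  move=> xpq; have := H (swappt p) (swappt q); rewrite !gE !swapptK; apply.
  by rewrite diagram_ofE /flip_rel !swapptK.
by rewrite diagram_ofE !gE; apply: H.
Qed.

(** The half turn of the rectangle. It is applied to the boxes on the legs of a vertex in the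
    rotation symmetry of theta. *)
Definition rotpt n (p : pt n n) : pt n n :=
  match p with inl a => inr (rev_ord a) | inr a => inl (rev_ord a) end.

Lemma rotptK n : involutive (@rotpt n).
Proof. by case=> a /=; rewrite rev_ordK. Qed.

Lemma bdpos_rot n (p : pt n n) : 
  bdpos (rotpt p) = if bdpos p < n then bdpos p + n else bdpos p - n.
Proof. case: p => a /=; have := ltn_ord a; case: ifP; lia. Qed.

Definition rot_rel n (x : diagram n n) : rel (pt n n) :=
  fun u v => x (rotpt u) == rotpt v.

(** The half turn shifts [bdpos] cyclically by n. A crossing keeps the cyclic order of its four ends
    but may start at any of them, hence the four instances of [arc_noncrossing]. *)
Lemma rot_planar n (x : diagram n n) : planar_matching (rot_rel x).
Proof.
split.
- by move=> p; exists (rotpt (x (rotpt p))); rewrite /rot_rel rotptK.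
- by move=> p q r /eqP e1 /eqP e2; apply: (can_inj (@rotptK n)); rewrite -e1 -e2.
- by move=> p q /eqP e; rewrite /rot_rel -e arcK.
- by move=> p; apply/negbTE/arc_neq.
move=> p p' q q' /eqP e1 /eqP e2.
have := @arc_noncrossing _ _ x (rotpt p) (rotpt q).
have := @arc_noncrossing _ _ x (rotpt q) (x (rotpt p)).
have := @arc_noncrossing _ _ x (x (rotpt p)) (x (rotpt q)).
have := @arc_noncrossing _ _ x (x (rotpt q)) (rotpt p).
rewrite !arcK e1 e2 !bdpos_rot.
have lt2 (r : pt n n) : bdpos r < n + n by case: r => a /=; have := ltn_ord a; lia.
move: (lt2 q').
move: (bdpos p) (bdpos p') (bdpos q) (bdpos q') => a c b d dn n1 n2 n3 n4 ab bc cd.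
move: n1 n2 n3 n4.
case: (ltnP d n) => dn'; first by rewrite !(ltn_trans _ dn') //; lia.
case: (ltnP c n) => cn'; first by rewrite !(ltn_trans _ cn') //; lia.
case: (ltnP b n) => bn'; first by rewrite !(ltn_trans _ bn') //; lia.
case: (ltnP a n) => an'; lia.
Qed.

Definition rotd n (x : diagram n n) : diagram n n := diagram_of (rot_planar x).

Definition rev_state n (u : state n) : state n := [ffun a => u (rev_ord a)].

Lemma rev_stateK n : involutive (@rev_state n).
Proof. by move=> u; apply/ffunP => a; rewrite !ffunE rev_ordK. Qed.

Lemma compat_rot n (x : diagram n n) u v :
  compat (rotd x) u v = compat x (rev_state v) (rev_state u).
Proof.
have gE p : glue u v p = glue (rev_state v) (rev_state u) (rotpt p).
  by case: p => a /=; rewrite ffunE rev_ordK.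
apply/compat_arcs/compat_arcs => H p q.
  move=> xpq; have := H (rotpt p) (rotpt q); rewrite !gE !rotptK; apply.
  by rewrite diagram_ofE /rot_rel !rotptK.
by rewrite diagram_ofE !gE; apply: H.
Qed.

Section Juxt.
Variables (m n m' n' : nat) (x : diagram m n) (y : diagram m' n').

Lemma leftpt_inj : injective (@leftpt m n m' n').
Proof. by case=> a [] b //= [] e; congr (_ _); apply: val_inj; rewrite /=; lia. Qed.

Lemma rightpt_inj : injective (@rightpt m n m' n').
Proof. by case=> a [] b //= [] e; congr (_ _); apply: val_inj; rewrite /=; lia. Qed.

Lemma left_right (p : pt m n) (q : pt m' n') :
  (leftpt m' n' p == rightpt m n q) = false.
Proof.
by apply/eqP; case: p => a; case: q => b //= [] e; move: (ltn_ord a) (ltn_ord b); lia.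
Qed.

Lemma pt_splitP (p : pt (m + m') (n + n')) :
  (exists q, p = leftpt m' n' q) \/ (exists q, p = rightpt m n q).
Proof.
case: p => a; rewrite -[a]splitK; case: (split a) => b /=.
- by left; exists (inl b).
- by right; exists (inl b).
- by left; exists (inr b).
by right; exists (inr b).
Qed.

Lemma juxt_left p q : juxt_join x y (leftpt m' n' p) q = (leftpt m' n' (x p) == q).
Proof.
apply/orP/eqP => [[]/existsP[r /andP[/eqP e /eqP ->]]|<-].
- by rewrite (leftpt_inj e).
- by move/eqP: e; rewrite left_right.
by left; apply/existsP; exists p; rewrite !eqxx.
Qed.

Lemma juxt_right p q : juxt_join x y (rightpt m n p) q = (rightpt m n (y p) == q).
Proof.
apply/orP/eqP => [[]/existsP[r /andP[/eqP e /eqP ->]]|<-].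
- by move/eqP: e; rewrite eq_sym left_right.
- by rewrite (rightpt_inj e).
by right; apply/existsP; exists p; rewrite !eqxx.
Qed.

Lemma bdpos_right p : bdpos (rightpt m n p : pt (m + m') (n + n')) = m + bdpos p.
Proof. by case: p => a /=; move: (ltn_ord a); lia. Qed.

Lemma bdpos_left p : bdpos (leftpt m' n' p : pt (m + m') (n + n')) =
  bdpos p + if bdpos p < m then 0 else m' + n'.
Proof. by case: p => a /=; move: (ltn_ord a); case: ifP; lia. Qed.

(** On the boundary the right diagram occupies an interval and the left one its complement, so arcs
    of different factors cannot interleave. *)
Lemma juxt_planar : planar_matching (juxt_join x y).
Proof.
split.
- move=> p; case: (pt_splitP p) => -[q ->].
    by exists (leftpt m' n' (x q)); rewrite juxt_left.
  by exists (rightpt m n (y q)); rewrite juxt_right.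
- move=> p q r; case: (pt_splitP p) => -[p' ->].
    by rewrite !juxt_left => /eqP<- /eqP<-.
  by rewrite !juxt_right => /eqP<- /eqP<-.
- move=> p q; case: (pt_splitP p) => -[p' ->].
    by rewrite juxt_left => /eqP<-; rewrite juxt_left arcK.
  by rewrite juxt_right => /eqP<-; rewrite juxt_right arcK.
- move=> p; case: (pt_splitP p) => -[p' ->].
    by rewrite juxt_left (inj_eq leftpt_inj); apply/negbTE/arc_neq.
  by rewrite juxt_right (inj_eq rightpt_inj); apply/negbTE/arc_neq.
have lt2 (r : pt m' n') : bdpos r < m' + n' by case: r => a /=; have := ltn_ord a; lia.
move=> p p' q q'.
case: (pt_splitP p) => -[{}p ->]; case: (pt_splitP q) => -[{}q ->].
- rewrite !juxt_left => /eqP<- /eqP<-; rewrite !bdpos_left.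
  have := @arc_noncrossing _ _ x p q.
  case: ifP; case: ifP; case: ifP; case: ifP; lia.
- rewrite juxt_left juxt_right => /eqP<- /eqP<-; rewrite !bdpos_left !bdpos_right.
  have := lt2 q; have := lt2 (y q); case: ifP; case: ifP; lia.
- rewrite juxt_left juxt_right => /eqP<- /eqP<-; rewrite !bdpos_left !bdpos_right.
  have := lt2 p; have := lt2 (y p); case: ifP; case: ifP; lia.
- rewrite !juxt_right => /eqP<- /eqP<-; rewrite !bdpos_right !ltn_add2l.
  exact: arc_noncrossing.
Qed.

Definition juxtd : diagram (m + m') (n + n') := diagram_of juxt_planar.

End Juxt.

Definition lstate m m' (u : state (m + m')) : state m := [ffun a => u (lshift m' a)].
Definition rstate m m' (u : state (m + m')) : state m' := [ffun a => u (rshift m a)].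
Definition join_state m m' (u : state m) (v : state m') : state (m + m') :=
  [ffun a => match split a with inl b => u b | inr b => v b end].

Lemma join_stateK m m' (u : state (m + m')) : join_state (lstate u) (rstate u) = u.
Proof.
apply/ffunP => a; rewrite ffunE -{2}[a]splitK.
by case: (split a) => b; rewrite ffunE.
Qed.

Lemma lstate_join m m' (u : state m) (v : state m') : lstate (join_state u v) = u.
Proof. by apply/ffunP => a; rewrite !ffunE (unsplitK (inl a)). Qed.

Lemma rstate_join m m' (u : state m) (v : state m') : rstate (join_state u v) = v.
Proof. by apply/ffunP => a; rewrite !ffunE (unsplitK (inr a)). Qed.

Lemma compat_juxt m n m' n' (x : diagram m n) (y : diagram m' n') u v :
  compat (juxtd x y) u v =
  compat x (lstate u) (lstate v) && compat y (rstate u) (rstate v).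
Proof.
have gl p : glue (lstate u) (lstate v) p = glue u v (leftpt m' n' p).
  by case: p => a /=; rewrite ffunE.
have gr p : glue (rstate u) (rstate v) p = glue u v (rightpt m n p).
  by case: p => a /=; rewrite ffunE.
apply/compat_arcs/andP => [H|[/compatP Hx /compatP Hy] p q].
  split; apply/compat_arcs => p q /eqP e; rewrite ?gl ?gr; apply: H.
    by rewrite diagram_ofE juxt_left e.
  by rewrite diagram_ofE juxt_right e.
rewrite diagram_ofE; case: (pt_splitP p) => -[{}p ->].
  by rewrite juxt_left => /eqP<-; rewrite -!gl Hx.
by rewrite juxt_right => /eqP<-; rewrite -!gr Hy.
Qed.

(** * Vertices and cup-caps *)

(* The value at a natural number, [false] out of range. *)
Definition at_ n (u : state n) (k : nat) : bool :=
  if insub k is Some a then u a else false.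

Lemma at_ord n (u : state n) (a : 'I_n) : at_ u a = u a.
Proof. by rewrite /at_ valK. Qed.

Lemma at_lt n (u : state n) k (kn : k < n) : at_ u k = u (Ordinal kn).
Proof. by rewrite -at_ord. Qed.

Lemma eq_at n (u v : state n) : (forall k, k < n -> at_ u k = at_ v k) -> u = v.
Proof. by move=> H; apply/ffunP => a; rewrite -!at_ord H. Qed.

Lemma at_lstate m m' (u : state (m + m')) k : k < m -> at_ (lstate u) k = at_ u k.
Proof. by move=> km; rewrite (at_lt _ km) ffunE -at_ord. Qed.

Lemma at_rstate m m' (u : state (m + m')) k : k < m' -> at_ (rstate u) k = at_ u (m + k).
Proof. by move=> km; rewrite (at_lt _ km) ffunE -at_ord. Qed.

Lemma at_rev n (u : state n) k : k < n -> at_ (rev_state u) k = at_ u (n - k.+1).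
Proof. by move=> km; rewrite (at_lt _ km) ffunE -at_ord. Qed.

Lemma at_ffun n (s : nat -> bool) k : k < n -> at_ [ffun a : 'I_n => s a] k = s k.
Proof. by move=> km; rewrite (at_lt _ km) ffunE. Qed.

(** The relation of [vertexE], with p and r as free parameters in place of the halved sums. *)
Definition vertex_rel x y z p r : rel (pt (x + y) z) := fun u v =>
  match u, v with
  | inl a, inl a' =>
      [&& r <= a, a < x + p & (a + a').+1 == x.*2]%N
  | inl a, inr b | inr b, inl a =>
      ((a < r) && (b == a :> nat)) || ((x + p <= a) && (a == b + p.*2 :> nat))
  | inr _, inr _ => false end.
Arguments vertex_rel : clear implicits.

Section Vertex.
Variables p q r : nat.

Lemma vertex_planar : planar_matching (vertex_rel (r + p) (p + q) (r + q) p r).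
Proof.
split.
- case=> a.
    have := ltn_ord a => la.
    case: (ltnP a r) => ar.
      have br : a < r + q by lia.
      by exists (inr (Ordinal br)); rewrite /= ar eqxx.
    case: (ltnP a (r + p + p)) => arp.
      have br : (r + p).*2 - a.+1 < r + p + (p + q) by lia.
      by exists (inl (Ordinal br)) => /=; lia.
    have br : a - p.*2 < r + q by lia.
    by exists (inr (Ordinal br)) => /=; lia.
  have := ltn_ord a => la.
  case: (ltnP a r) => ar.
    have br : a < r + p + (p + q) by lia.
    by exists (inl (Ordinal br)); rewrite /= ar eqxx.
  have br : a + p.*2 < r + p + (p + q) by lia.
  by exists (inl (Ordinal br)) => /=; lia.
- move=> [a|a] [b|b] [c|c] //= e1 e2; try congr (inl _); try congr (inr _);
  try (apply: val_inj => /=); lia.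
- by move=> [a|a] [b|b] //=; move: (ltn_ord a) (ltn_ord b); lia.
- by move=> [a|a] //=; lia.
move=> [a|a] [b|b] [a'|a'] [b'|b'] //= e1 e2;
  move: (ltn_ord a) (ltn_ord a') (ltn_ord b) (ltn_ord b'); lia.
Qed.

Definition vertexd := diagram_of vertex_planar.

Lemma compat_vertex u w : compat vertexd u w <->
  [/\ forall k, k < r -> at_ w k = at_ u k,
      forall k, k < q -> at_ w (r + k) = at_ u (r + p + p + k)
    & forall k, k < p -> at_ u (r + k) = at_ u (r + p + p - k.+1)].
Proof.
split=> [/compat_arcs H|[H1 H2 H3]].
  split=> k kn.
  - have k1 : k < r + q by lia.
    have k2 : k < r + p + (p + q) by lia.
    rewrite (at_lt _ k1) (at_lt _ k2); apply: (H (inr _) (inl _)).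
    by rewrite diagram_ofE /= kn eqxx.
  - have k1 : r + k < r + q by lia.
    have k2 : r + p + p + k < r + p + (p + q) by lia.
    rewrite (at_lt _ k1) (at_lt _ k2); apply: (H (inr _) (inl _)).
    by rewrite diagram_ofE /=; lia.
  have k1 : r + k < r + p + (p + q) by lia.
  have k2 : r + p + p - k.+1 < r + p + (p + q) by lia.
  rewrite (at_lt _ k1) (at_lt _ k2); apply: (H (inl _) (inl _)).
  by rewrite diagram_ofE /=; lia.
have H12 (a : 'I_(r + p + (p + q))) (b : 'I_(r + q)) :
  ((a < r) && (b == a :> nat)) || ((r + p + p <= a) && (a == b + p.*2 :> nat)) ->
  u a = w b.
  rewrite -!at_ord => /orP[/andP[ar /eqP ->]|/andP[ar /eqP ab]].
    by rewrite H1.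
  have := H2 (b - r); move: (ltn_ord b) => lb.
  have -> : r + (b - r) = b by lia.
  have -> : r + p + p + (b - r) = a by lia.
  by move=> -> //; lia.
apply/compat_arcs => -[a|a] [b|b]; rewrite diagram_ofE /=.
- rewrite -!at_ord => h.
  case: (ltnP a (r + p)) => arp.
    have := H3 (a - r).
    have -> : r + (a - r) = a by lia.
    have -> : r + p + p - (a - r).+1 = b by lia.
    by apply; lia.
  have := H3 (b - r).
  have -> : r + (b - r) = b by lia.
  have -> : r + p + p - (b - r).+1 = a by lia.
  by move=> -> //; lia.
- exact: H12.
- by move=> /H12 ->.
- by [].
Qed.

End Vertex.

Section CupCap.
Variables n j : nat.

Definition e_rel : rel (pt n n) := fun p q =>
  match p, q with
  | inl a, inl b | inr a, inr b =>
      ((a == j :> nat) && (b == j.+1 :> nat))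
      || ((a == j.+1 :> nat) && (b == j :> nat))
  | inl a, inr b | inr b, inl a =>
      [&& a == b :> nat, a != j :> nat & a != j.+1 :> nat] end.

Hypothesis jn : j.+1 < n.

Lemma e_planar : planar_matching e_rel.
Proof.
split.
- have j1 : j < n by lia.
  case=> a.
    case: (a =P j :> nat) => [aj|naj].
      by exists (inl (Ordinal jn)) => /=; rewrite aj !eqxx.
    case: (a =P j.+1 :> nat) => [aj|naj'].
      by exists (inl (Ordinal j1)) => /=; rewrite aj !eqxx orbT.
    by exists (inr a) => /=; lia.
  case: (a =P j :> nat) => [aj|naj].
    by exists (inr (Ordinal jn)) => /=; rewrite aj !eqxx.
  case: (a =P j.+1 :> nat) => [aj|naj'].
    by exists (inr (Ordinal j1)) => /=; rewrite aj !eqxx orbT.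
  by exists (inl a) => /=; lia.
- move=> [a|a] [b|b] [c|c] //= e1 e2; try congr (inl _); try congr (inr _);
  try (apply: val_inj => /=); lia.
- by move=> [a|a] [b|b] //=; lia.
- by move=> [a|a] //=; lia.
move=> [a|a] [b|b] [a'|a'] [b'|b'] //= e1 e2;
  move: (ltn_ord a) (ltn_ord a') (ltn_ord b) (ltn_ord b'); lia.
Qed.

Definition e_diagram := diagram_of e_planar.

Lemma compat_e u v : compat e_diagram u v <->
  [/\ at_ u j = at_ u j.+1, at_ v j = at_ v j.+1 &
      forall k, k < n -> k != j -> k != j.+1 -> at_ u k = at_ v k].
Proof.
have j1 : j < n by lia.
split=> [/compat_arcs H|[H1 H2 H3]].
  split=> [||k kn kj kj1].
  - rewrite (at_lt _ j1) (at_lt _ jn); apply: (H (inl _) (inl _)).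
    by rewrite diagram_ofE /= !eqxx.
  - rewrite (at_lt _ j1) (at_lt _ jn); apply: (H (inr _) (inr _)).
    by rewrite diagram_ofE /= !eqxx.
  rewrite !(at_lt _ kn); apply: (H (inl _) (inr _)).
  by rewrite diagram_ofE /= eqxx kj kj1.
have H12 (a b : 'I_n) : [&& a == b :> nat, a != j :> nat & a != j.+1 :> nat] -> u a = v b.
  by rewrite -!at_ord => /and3P[/eqP <- aj aj1]; rewrite H3.
apply/compat_arcs => -[a|a] [b|b]; rewrite diagram_ofE /=.
- by rewrite -!at_ord => /orP[]/andP[/eqP-> /eqP->].
- exact: H12.
- by move=> /H12 ->.
by rewrite -!at_ord => /orP[]/andP[/eqP-> /eqP->].
Qed.
End CupCap.

(** * Noncrossing involutions of an interval *)

Record nc_involution (N : nat) (P : nat -> nat) : Prop := NcInvolution {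
  nc_lt : forall k, k < N -> P k < N;
  ncK : forall k, k < N -> P (P k) = k;
  nc_neq : forall k, k < N -> P k <> k;
  nc_nc : forall k l, k < l -> l < P k -> P k < P l -> P l < N -> False }.

Section NcInvolution.
Variables (N : nat) (P : nat -> nat).
Hypothesis PN : nc_involution N P.

Lemma nc_inside a c : a < c -> c < P a -> P a < N -> a < P c < P a.
Proof.
move=> ac cb bN; have aN : a < N by lia. have cN : c < N by lia.
have ca : P c <> a by move=> e; move: (ncK PN cN); rewrite e; lia.
have cb' : P c <> P a.
  by move=> e; move: (ncK PN cN) (ncK PN aN); rewrite e; lia.
have h1 := nc_nc PN ac cb; have h2 := nc_lt PN cN.
have := @nc_nc _ _ PN (P c) a; rewrite (ncK PN) // => h3.
lia.
Qed.

(** An innermost arc under the arc at a joins neighbours: unless P a = a + 1, the arc at a + 1 lies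
    strictly inside and is shorter. *)
Lemma adjacent_arc a : a < P a -> P a < N ->
  exists j, [/\ a <= j, j < P a & P j = j.+1].
Proof.
have [b] := ubnP (P a - a); elim: b a => // b IH a lb ab bN.
have [e|ne] := eqVneq (P a) a.+1; first by exists a.
have a1 : a.+1 < P a by lia.
have := nc_inside (ltnSn a) a1 bN => h.
have := @nc_neq _ _ PN a.+1 => ne1.
case: (IH a.+1); try lia.
by move=> j [h1 h2 h3]; exists j; split; lia.
Qed.

(** Neighbours may be joined only across the gap before position c. For a longer arc, the inner arc
    starting at a + 1 gives 2c <= a + 1 + P a, and the inner arc ending at P a - 1 gives the
    opposite inequality. *)
Lemma arcs_about_gap lo hi c : hi <= N ->
  (forall j, lo <= j -> j.+1 < hi -> P j = j.+1 -> j.+1 = c) ->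
  forall a, lo <= a -> a < P a -> P a < hi -> (a + P a).+1 = c.*2.
Proof.
move=> hN gap a; have [b] := ubnP (P a - a); elim: b a => // b IH a lb loa ab bh.
have bN : P a < N by lia.
have [e|ne] := eqVneq (P a) a.+1.
  by have := gap _ loa; rewrite e; lia.
(* The arcs at a + 1 and at P a - 1 lie inside and are symmetric by induction. *)
have h1 : a < a.+1 < P a by lia.
have h2 : a < (P a).-1 < P a by lia.
have /andP[h11 h12] := h1; have /andP[h21 h22] := h2.
have i1 := nc_inside h11 h12 bN; have i2 := nc_inside h21 h22 bN.
have n1 : P a.+1 <> a.+1 by apply: (nc_neq PN); lia.
have n2 : P (P a).-1 <> (P a).-1 by apply: (nc_neq PN); lia.
have n3 : P (P (P a).-1) = (P a).-1 by apply: (ncK PN); lia.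
have := IH a.+1; have := IH (P (P a).-1); rewrite n3; lia.
Qed.

(* Moving the base point of the boundary by s positions. *)
Definition shift s k := if k + s < N then k + s else k + s - N.
Definition unshift s k := if k < s then k + N - s else k - s.

Lemma shiftK s k : s <= N -> k < N -> unshift s (shift s k) = k.
Proof. by rewrite /unshift /shift => sN kN; case: ifP; case: ifP; lia. Qed.

Lemma unshiftK s k : s <= N -> k < N -> shift s (unshift s k) = k.
Proof. by rewrite /unshift /shift => sN kN; case: ifP; case: ifP; lia. Qed.

Lemma shift_lt s k : s <= N -> k < N -> shift s k < N.
Proof. by rewrite /shift => sN kN; case: ifP; lia. Qed.

Lemma unshift_lt s k : s <= N -> k < N -> unshift s k < N.
Proof. by rewrite /unshift => sN kN; case: ifP; lia. Qed.

(** Being noncrossing depends on the cyclic order only; the hypothesis is used once for each end of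
    the would-be crossing that may come first. *)
Lemma nc_shift s : s <= N -> nc_involution N (fun k => unshift s (P (shift s k))).
Proof.
move=> sN; split.
- by move=> k kN; apply: unshift_lt => //; apply: (nc_lt PN); apply: shift_lt.
- move=> k kN; have h1 := shift_lt sN kN; have h2 := nc_lt PN h1.
  by rewrite unshiftK // (ncK PN) // shiftK.
- move=> k kN e; have h1 := shift_lt sN kN; have h2 := nc_lt PN h1.
  by apply: (nc_neq PN h1); rewrite -[LHS](unshiftK sN) // e.
move=> k l kl lk kl' lN.
set a := shift s k; set b := shift s l in lk kl' lN *.
have kN : k < N.
  by case: (ltnP k N) => // h; move: lN lk kl'; lia.
have lN' : l < N by lia.
have aN : a < N by apply: shift_lt.
have bN : b < N by apply: shift_lt.
have PaN := nc_lt PN aN; have PbN := nc_lt PN bN.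
have PPa := ncK PN aN; have PPb := ncK PN bN.
have n1 := @nc_nc _ _ PN a b; have n2 := @nc_nc _ _ PN b (P a).
have n3 := @nc_nc _ _ PN (P a) (P b); have n4 := @nc_nc _ _ PN (P b) a.
move: n1 n2 n3 n4; rewrite !PPa !PPb.
have ka : unshift s a = k by rewrite shiftK.
have lb : unshift s b = l by rewrite shiftK.
rewrite -/a in lk kl'.
move: kl lk kl' lN; rewrite -ka -lb /unshift.
clear -PaN PbN aN bN sN.
move: (P a) (P b) PaN PbN => c d cN dN.
by case: (ltnP a s) => ?; case: (ltnP b s) => ?; case: (ltnP c s) => ?;
  case: (ltnP d s) => ?; lia.
Qed.
End NcInvolution.

(** * The arc pattern forced by the absence of caps inside the three sides *)

Section VertexPattern.
Variables (x y z : nat) (P : nat -> nat).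
Let N := x + y + z.
Hypothesis PN : nc_involution N P.
Hypothesis bottom_gap : forall j, j.+1 < x + y -> P j = j.+1 -> j.+1 = x.
Hypothesis top_gap : forall j, x + y <= j -> j.+1 < N -> P j <> j.+1.

Let in_bottom a : a < P a -> P a < x + y -> (a + P a).+1 = x.*2.
Proof.
move=> aP Pxy; apply: (arcs_about_gap PN (lo := 0) (hi := x + y)) => //.
  by rewrite /N; lia.
by move=> j _; apply: bottom_gap.
Qed.

Let in_right a : x <= a -> a < P a -> P a < N -> (a + P a).+1 = (x + y).*2.
Proof.
apply: (arcs_about_gap PN (lo := x) (hi := N)) => // j xj jN e.
case: (ltnP j.+1 (x + y)) => h; first by have := bottom_gap h e; lia.
case: (ltnP j (x + y)) => h'; first by lia.
by have := top_gap h' jN; rewrite e.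
Qed.

(** The corner between the first and the third side is the base point of the boundary. Rebasing at x
    + y turns it into the gap at position z, to which [arcs_about_gap] applies. *)
Let across a : a < x -> x + y <= P a -> (a + P a).+1 = N.
Proof.
move=> ax aP.
have sN : x + y <= N by rewrite /N; lia.
have PN' := nc_shift PN sN.
have PaN : P a < N by apply: (nc_lt PN); rewrite /N; lia.
have H : (P a - (x + y) + unshift N (x + y) (P (shift N (x + y) (P a - (x + y))))).+1 = z.*2.
  have sPa : shift N (x + y) (P a - (x + y)) = P a by rewrite /shift subnK // PaN.
  have PPa : P (P a) = a by apply: (ncK PN); lia.
  have uE : unshift N (x + y) a = a + z.
    by rewrite /unshift /N; case: ifP; lia.
  apply: (arcs_about_gap PN' (lo := 0) (hi := z + x)) => //.
  - by rewrite /N; lia.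
  - move=> j _ jh e.
    have jN : j < N by rewrite /N; lia.
    have j1N : j.+1 < N by rewrite /N; lia.
    have {e} : P (shift N (x + y) j) = shift N (x + y) j.+1.
      by rewrite -e unshiftK // (nc_lt PN) // shift_lt.
    case: (ltnP j.+1 z) => jz.
      have -> : shift N (x + y) j = j + (x + y) by rewrite /shift /N; case: ifP; lia.
      have -> : shift N (x + y) j.+1 = (j + (x + y)).+1 by rewrite /shift /N; case: ifP; lia.
      by move=> e; case: (@top_gap (j + (x + y))); rewrite /N; lia.
    case: (ltnP j z) => jz'; first by lia.
    have -> : shift N (x + y) j = j - z by rewrite /shift /N; case: ifP; lia.
    have -> : shift N (x + y) j.+1 = (j - z).+1 by rewrite /shift /N; case: ifP; lia.
    by move=> e; have := @bottom_gap (j - z); lia.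
  - by rewrite sPa PPa uE; lia.
  by rewrite sPa PPa uE; lia.
move: H; rewrite /shift subnK // PaN (ncK PN) ?/unshift ?/N; last by lia.
by case: ifP; lia.
Qed.

Let no_top a : x + y <= a -> a < P a -> P a < N -> False.
Proof.
move=> xya aP PaN; have [j [h1 h2 h3]] := adjacent_arc PN aP PaN.
by apply: (@top_gap j) => //; lia.
Qed.

(** The boundary is a triangle with sides x, y, z. Each arc joins two different sides and is
    symmetric about their common corner; the numbers of arcs around the corners are p, q and r. *)
Lemma vertex_pattern : exists p q r, [/\ x = r + p, y = p + q, z = r + q &
  [/\ forall k, k < r -> P k = N - k.+1,
      forall k, r <= k -> k < x + p -> P k = x.*2 - k.+1
    & forall k, x + p <= k -> k < x + y -> P k = (x + y).*2 - k.+1]].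
Proof.
have left_cases k : k < x ->
    (x + y <= P k /\ P k = N - k.+1) \/
    (x <= P k /\ P k < x + y /\ P k = x.*2 - k.+1).
  move=> kx; have kN : k < N by rewrite /N; lia.
  case: (leqP (x + y) (P k)) => h; first by left; have := across kx h; lia.
  right; have := nc_neq PN kN => ne; have := ncK PN kN => kk.
  case: (ltnP k (P k)) => h'; first by have := in_bottom h' h; lia.
  have := @in_bottom (P k); rewrite kk; lia.
have right_cases k : x <= k -> k < x + y ->
    (P k < x /\ P k = x.*2 - k.+1) \/
    (x + y <= P k /\ P k < N /\ P k = (x + y).*2 - k.+1).
  move=> xk kxy; have kN : k < N by rewrite /N; lia.
  have := nc_neq PN kN => ne; have := ncK PN kN => kk.
  have PkN := nc_lt PN kN.
  case: (ltnP k (P k)) => h'.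
    have h2 := in_right xk h' PkN.
    case: (leqP (x + y) (P k)) => h; first by right; lia.
    by have := in_bottom h' h; lia.
  have := @in_bottom (P k); have := @in_right (P k); rewrite kk; lia.
have top_cases k : x + y <= k -> k < N ->
    (P k < x /\ P k = N - k.+1) \/
    (x <= P k /\ P k < x + y /\ P k = (x + y).*2 - k.+1).
  move=> xyk kN; have := nc_neq PN kN => ne; have := ncK PN kN => kk.
  have PkN := nc_lt PN kN.
  case: (ltnP k (P k)) => h'; first by case: (no_top xyk h' PkN).
  case: (leqP (x + y) (P k)) => h.
    by case: (no_top h); rewrite kk // ltn_neqAle h' andbT; apply/eqP.
  case: (leqP x (P k)) => h''.
    by right; have := @in_right (P k); rewrite kk; lia.
  by left; have := @across (P k); rewrite kk; lia.
(* The minimum r is the first point of the first side that is not joined to the top; the disjunct k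
   == x yields r = x if all of them are. *)
pose through k := (k == x) || (P k < x + y).
have ex_r : exists k, through k by exists x; rewrite /through eqxx.
have [r /orP r_through r_min] := ex_minnP ex_r.
have rx : r <= x by apply: r_min; rewrite /through eqxx.
have P1 k : k < r -> x + y <= P k /\ P k = N - k.+1.
  move=> kr; case: (left_cases k) => [|//|[h1 [h2 _]]]; first by lia.
  by have := r_min k; rewrite /through h2 orbT; lia.
have P2 k : r <= k -> k < x -> x <= P k /\ P k < x + y /\ P k = x.*2 - k.+1.
  move=> rk kx; case: (left_cases k kx) => [[h1 h2]|h]; last by [].
  have Pr : P r < x + y by case: r_through => [/eqP|//]; lia.
  have kr : r != k by apply/eqP=> e; move: h1; rewrite -e; lia.
  have rlt : r < x by lia.
  case: (left_cases r rlt) => [h3|[h3 [_ h5]]]; first by lia.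
  exfalso; apply: (@nc_nc _ _ PN r k); rewrite /N in h2 *; lia.
have P3 k : x <= k -> k < x + (x - r) -> P k = x.*2 - k.+1.
  move=> xk kp; have := P2 (x.*2 - k.+1).
  case=> [||_ [_ e]]; try lia.
  have := ncK PN (k := x.*2 - k.+1); rewrite e.
  have -> : x.*2 - (x.*2 - k.+1).+1 = k by lia.
  by apply; rewrite /N; lia.
have yp : x - r <= y.
  case: (ltnP r x) => h; last by lia.
  by have := P2 r (leqnn r) h; lia.
have P4 k : x + (x - r) <= k -> k < x + y ->
    x + y <= P k /\ P k < N /\ P k = (x + y).*2 - k.+1.
  move=> xpk ky; case: (right_cases k) => [|//|[h1 h2]|//]; first by lia.
  have kN : k < N by rewrite /N; lia.
  have kk := ncK PN kN; case: (ltnP (P k) r) => h.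
    by have := P1 _ h; rewrite kk /N; lia.
  by have := P2 _ h; rewrite kk; lia.
exists (x - r), (y - (x - r)), r; split; [lia|lia| |split].
(* If z is too small, two points share a partner or a partner leaves the boundary; if z is too
   large, the top point N - r - 1 has no possible partner. *)
- case: (ltngtP z (r + (y - (x - r)))) => // h; exfalso.
    have h1 : r <= z.
      case: (posnP r) => r0; first by lia.
      have := P1 r.-1; rewrite /N; lia.
    have h2 := P4 (x + (x - r)).
    have h3 := P1 (z - (y - (x - r))).
    have : P (z - (y - (x - r))) = P (x + (x - r)) by rewrite /N in h2 h3; lia.
    move=> e; have := ncK PN (k := x + (x - r)); rewrite -e (ncK PN) /N; lia.
  have := top_cases (N - r.+1); rewrite /N => -[||[h1 h2]|[h1 [h2 h3]]]; try lia.
    have := P2 r; have := ncK PN (k := N - r.+1); rewrite /N h2 => h3.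
    have e : x + y + z - (x + y + z - r.+1).+1 = r by lia.
    by rewrite e in h2 h3; lia.
  have kN : x + y + z - r.+1 < N by rewrite /N; lia.
  have := P3 (P (x + y + z - r.+1)); have := P4 (P (x + y + z - r.+1)).
  by rewrite (ncK PN kN); lia.
- by move=> k /P1[].
- move=> k rk kp; case: (ltnP k x) => kx; last exact: P3.
  by have [_ []] := P2 k rk kx.
by move=> k xp ky; have [_ []] := P4 k xp ky.
Qed.
End VertexPattern.

(** * Classification of diagrams by adjacent arcs *)

Lemma diagram_of_unique m n (R : rel (pt m n)) (PR : planar_matching R) (d : diagram m n) :
  (forall p q, R p q -> d p = q) -> d = diagram_of PR.
Proof.
move=> H; apply/val_inj/ffunP => p; apply: (H p).
by rewrite -(diagram_ofE PR) eqxx.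
Qed.

Lemma bdpos_lt m n (p : pt m n) : bdpos p < m + n.
Proof. by case: p => a /=; move: (ltn_ord a); lia. Qed.

Lemma bdpos_surj m n k : k < m + n -> exists p : pt m n, bdpos p = k.
Proof.
move=> kN; case: (ltnP k m) => km; first by exists (inl (Ordinal km)).
have h : n - (k - m).+1 < n by lia.
by exists (inr (Ordinal h)) => /=; lia.
Qed.

(** The diagram read as an involution of boundary positions. The default k makes k < [partner d k]
    imply that k is a position on the boundary. *)
Definition partner m n (d : diagram m n) (k : nat) : nat :=
  if [pick p : pt m n | bdpos p == k] is Some p then bdpos (d p) else k.

Lemma partnerE m n (d : diagram m n) p : partner d (bdpos p) = bdpos (d p).
Proof.
rewrite /partner; case: pickP => [q /eqP/bdpos_inj -> //|/(_ p)].
by rewrite eqxx.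
Qed.

Lemma nc_partner m n (d : diagram m n) : nc_involution (m + n) (partner d).
Proof.
split.
- by move=> _ /bdpos_surj[p <-]; rewrite partnerE bdpos_lt.
- by move=> _ /bdpos_surj[p <-]; rewrite !partnerE arcK.
- move=> _ /bdpos_surj[p <-]; rewrite partnerE => /bdpos_inj e.
  by have := arc_neq d p; rewrite e eqxx.
move=> k l kl lk kl' lN.
have [p kE] : exists p : pt m n, bdpos p = k.
  rewrite /partner in lk; move: lk; case: pickP => [p /eqP e _|_]; first by exists p.
  by lia.
subst k; have /bdpos_surj[q lE] : l < m + n.
  by rewrite partnerE in lk; have := bdpos_lt (d p); lia.
subst l; move: kl lk kl'; rewrite !partnerE; exact: arc_noncrossing.
Qed.

Definition bottom_adj m n (d : diagram m n) (j : nat) : bool :=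
  (j.+1 < m) && (partner d j == j.+1).

Definition top_adj m n (d : diagram m n) (j : nat) : bool := bottom_adj (flipd d) j.

Lemma flipdK m n : cancel (@flipd m n) (@flipd n m).
Proof. by move=> d; apply: compat_inj => u v; rewrite !compat_flip. Qed.

Lemma flipdE m n (d : diagram m n) p : flipd d p = swappt (d (swappt p)).
Proof. by apply/eqP; rewrite diagram_ofE /flip_rel swapptK. Qed.

Lemma partner_flip m n (d : diagram m n) k : k < m + n ->
  partner (flipd d) k = m + n - (partner d (m + n - k.+1)).+1.
Proof.
rewrite addnC => /bdpos_surj[p <-].
have -> : n + m - (bdpos p).+1 = bdpos (swappt p) by have := bdpos_swap p; lia.
rewrite !partnerE flipdE; have := bdpos_swap (d (swappt p)); lia.
Qed.

(** Positions on the top side run from right to left, so the pair j, j + 1 appears in reversed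
    order, counted from the right end. *)
Lemma top_adjE m n (d : diagram m n) j : j.+1 < n ->
  top_adj d j = (partner d (m + (n - j.+2)) == m + (n - j.+1)).
Proof.
move=> jn; have PN := nc_partner d.
rewrite /top_adj /bottom_adj jn partner_flip /=; last by lia.
have -> : m + n - j.+1 = m + (n - j.+1) by lia.
have h1 : m + (n - j.+1) < m + n by lia.
have h2 : m + (n - j.+2) < m + n by lia.
have l1 := nc_lt PN h1; have l2 := nc_lt PN h2.
have e1 := ncK PN h1; have e2 := ncK PN h2.
apply/eqP/eqP => e.
  have <- : partner d (m + (n - j.+1)) = m + (n - j.+2) by lia.
  by rewrite e1.
have -> : partner d (m + (n - j.+1)) = m + (n - j.+2) by rewrite -e e2.
lia.
Qed.

Lemma bottom_adj_arc m n (d : diagram m n) j (jm : j.+1 < m) :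
  bottom_adj d j -> d (inl (Ordinal (ltnW jm))) = inl (Ordinal jm).
Proof.
rewrite /bottom_adj jm /= => /eqP e; apply: bdpos_inj.
by rewrite -partnerE.
Qed.

Lemma bottom_adjP m n (d : diagram m n) j : j.+1 < m ->
  reflect (forall u v, compat d u v -> at_ u j = at_ u j.+1) (bottom_adj d j).
Proof.
move=> jm; apply: (iffP idP) => [h u v /compatP|H].
  move/(_ (inl (Ordinal (ltnW jm)))); rewrite bottom_adj_arc //= => e.
  by rewrite (at_lt _ jm) (at_lt _ (ltnW jm)).
have /eqP e : d (inl (Ordinal (ltnW jm))) == inl (Ordinal jm).
  apply/arc_compatP; split; first by case; lia.
  by move=> u v /H; rewrite (at_lt _ jm) (at_lt _ (ltnW jm)).
rewrite /bottom_adj jm /=; apply/eqP.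
by rewrite -[j]/(bdpos (inl (Ordinal (ltnW jm)) : pt m n)) partnerE e.
Qed.

(** Only the underlying diagram is compared here; the loop created by the product is divided out in
    [dv_bottom_adj]. *)
Lemma comp_bottom_adj m n (d : diagram m n) j (jm : j.+1 < m) :
  bottom_adj d j -> compd d (e_diagram jm) = d.
Proof.
move=> dj; have dab := bottom_adj_arc jm dj.
have dba : d (inl (Ordinal jm)) = inl (Ordinal (ltnW jm)) by rewrite -dab arcK.
apply: compat_inj => u w; rewrite compat_comp.
apply/existsP/idP => [[v /andP[/compat_e[h1 h2 h3] /compatP dvw]]|duw]; last first.
  exists u; rewrite duw andbT; apply/compat_e.
  by have := (bottom_adjP d jm) dj u w duw.
have gE p : p != inl (Ordinal jm) -> p != inl (Ordinal (ltnW jm)) ->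
    glue u w p = glue v w p.
  case: p => [a|b] //= n1 n2; by rewrite -!at_ord h3.
have uab : u (Ordinal jm) = u (Ordinal (ltnW jm)) by rewrite -!at_ord.
apply/compatP => p.
have [->|n1] := eqVneq p (inl (Ordinal jm)); first by rewrite dba /= uab.
have [->|n2] := eqVneq p (inl (Ordinal (ltnW jm))); first by rewrite dab /= uab.
rewrite !gE //.
  by rewrite -dab (inj_eq (inv_inj (arcK d))).
by rewrite -dba (inj_eq (inv_inj (arcK d))).
Qed.

Lemma flipd_comp m n p (x : diagram n p) (y : diagram m n) :
  flipd (compd x y) = compd (flipd y) (flipd x).
Proof.
apply: compat_inj => u w; rewrite compat_flip !compat_comp.
by apply: eq_existsb => v; rewrite !compat_flip andbC.
Qed.

Lemma flipd_e n j (jn : j.+1 < n) : flipd (e_diagram jn) = e_diagram jn.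
Proof.
apply: compat_inj => u v; rewrite compat_flip.
by apply/idP/idP => /compat_e[h1 h2 h3]; apply/compat_e; split=> // k *; rewrite h3.
Qed.

Lemma comp_top_adj m n (d : diagram m n) j (jn : j.+1 < n) :
  top_adj d j -> compd (e_diagram jn) d = d.
Proof.
by move=> dj; apply: (can_inj (@flipdK m n)); rewrite flipd_comp flipd_e comp_bottom_adj.
Qed.

Lemma no_bottom_arc m n (d : diagram m n) : (forall j, ~~ bottom_adj d j) ->
  forall k, k < m -> m <= partner d k.
Proof.
move=> H k km; have PN := nc_partner d.
rewrite leqNgt; apply/negP => Pm.
have aux a : a < partner d a -> partner d a < m -> False.
  move=> aP aPm; case: (adjacent_arc PN aP) => [|j [h1 h2 h3]]; first by lia.
  by have := H j; rewrite /bottom_adj h3 eqxx andbT; lia.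
have kN : k < m + n by lia.
have ne := nc_neq PN kN; have kk := ncK PN kN.
case: (ltnP k (partner d k)) => h; first exact: aux h _.
by apply: (aux (partner d k)); rewrite kk //; lia.
Qed.

Lemma no_bottom_leq m n (d : diagram m n) : (forall j, ~~ bottom_adj d j) -> m <= n.
Proof.
move=> H; have PN := nc_partner d; have Hk := no_bottom_arc H.
have lt (a : 'I_m) : partner d a - m < n.
  by have := nc_lt PN (k := a); have := Hk _ (ltn_ord a); have := ltn_ord a; lia.
pose f (a : 'I_m) := Ordinal (lt a).
suff /leq_card : injective f by rewrite !card_ord.
move=> a b [e]; apply: val_inj => /=.
have ea := Hk _ (ltn_ord a); have eb := Hk _ (ltn_ord b).
have e' : partner d a = partner d b by lia.
have aN : a < m + n by have := ltn_ord a; lia.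
have bN : b < m + n by have := ltn_ord b; lia.
by rewrite -(ncK PN aN) -(ncK PN bN) e'.
Qed.

(** All bottom points are joined to the top, and by counting all top points to the bottom. So
    neighbours can be joined only across the corner at n, and symmetry of every arc about that
    corner is the identity diagram. *)
Lemma no_bottom_id n (d : diagram n n) : (forall j, ~~ bottom_adj d j) -> d = id_diagram n.
Proof.
move=> H; have PN := nc_partner d; have Hk := no_bottom_arc H.
have lt (a : 'I_n) : partner d a - n < n.
  by have := nc_lt PN (k := a); have := Hk _ (ltn_ord a); have := ltn_ord a; lia.
pose f (a : 'I_n) := Ordinal (lt a).
have f_inj : injective f.
  move=> a b [e]; apply: val_inj => /=.
  have ea := Hk _ (ltn_ord a); have eb := Hk _ (ltn_ord b).
  have e' : partner d a = partner d b by lia.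
  have aN : a < n + n by have := ltn_ord a; lia.
  have bN : b < n + n by have := ltn_ord b; lia.
  by rewrite -(ncK PN aN) -(ncK PN bN) e'.
have Ht k : n <= k -> k < n + n -> partner d k < n.
  move=> nk kN; have kn : k - n < n by lia.
  have [g fK gK] := injF_bij f_inj.
  have /(congr1 val) /= := gK (Ordinal kn) => e.
  have := Hk _ (ltn_ord (g (Ordinal kn))) => h.
  have -> : k = partner d (g (Ordinal kn)) by lia.
  by rewrite (ncK PN) //; have := ltn_ord (g (Ordinal kn)); lia.
have sumP k : k < n -> (k + partner d k).+1 = n.*2.
  move=> kn; apply: (arcs_about_gap PN (lo := 0) (hi := n + n)) => //.
  - move=> j _ jN e; case: (ltnP j n) => jn.
      by have := Hk _ jn; lia.
    by have := Ht _ jn; lia.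
  - by have := Hk _ kn; lia.
  by apply: (nc_lt PN); lia.
apply: diagram_of_unique => p q pq; apply: bdpos_inj; rewrite -partnerE.
case: p q pq => [a|a] [b|b] //= /eqP ab.
  by have := sumP a (ltn_ord a); move: (ltn_ord b); lia.
have e := sumP b (ltn_ord b).
have -> : n + (n - a.+1) = partner d b by move: (ltn_ord b); lia.
by rewrite (ncK PN) //; move: (ltn_ord b); lia.
Qed.

Lemma not_id_bottom_adj n (d : diagram n n) : d <> id_diagram n -> exists j, bottom_adj d j.
Proof.
move=> dn; have [/existsP[j dj]|H] := boolP [exists j : 'I_n, bottom_adj d j]; first by exists j.
case: dn; apply: no_bottom_id => j; apply/negP => dj.
have jn : j < n by case/andP: dj; lia.
by move/existsP: H; case; exists (Ordinal jn).
Qed.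

Lemma flipd_id n : flipd (id_diagram n) = id_diagram n.
Proof. by apply: compat_inj => u v; rewrite compat_flip !compat_id eq_sym. Qed.

Lemma not_id_top_adj n (d : diagram n n) : d <> id_diagram n -> exists j, top_adj d j.
Proof.
move=> dn; apply: not_id_bottom_adj => e; apply: dn.
by rewrite -(flipdK d) e flipd_id.
Qed.

Lemma rectangular_adj m n (d : diagram m n) : m <> n ->
  (exists j, bottom_adj d j) \/ (exists j, top_adj d j).
Proof.
move=> mn.
have [/existsP[j dj]|H] := boolP [exists j : 'I_m, bottom_adj d j]; first by left; exists j.
have [/existsP[j dj]|H'] := boolP [exists j : 'I_n, top_adj d j]; first by right; exists j.
case: mn; apply/eqP; rewrite eqn_leq; apply/andP; split.
  apply: (no_bottom_leq (d := d)) => j; apply/negP => dj.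
  have jn : j < m by case/andP: dj; lia.
  by move/existsP: H; case; exists (Ordinal jn).
apply: (no_bottom_leq (d := flipd d)) => j; apply/negP => dj.
have jn : j < n by case/andP: dj; lia.
by move/existsP: H'; case; exists (Ordinal jn).
Qed.

Lemma vertex_classification x y z (d : diagram (x + y) z) :
  (forall j, bottom_adj d j -> j.+1 = x) -> (forall j, ~~ top_adj d j) ->
  exists p q r, [/\ x = r + p, y = p + q, z = r + q &
    forall s t, vertex_rel x y z p r s t -> d s = t].
Proof.
move=> Hb Ht; have PN := nc_partner d.
have [||p [q [r [ex ey ez [P1 P2 P3]]]]] := vertex_pattern PN.
- by move=> j jxy e; apply: Hb; rewrite /bottom_adj jxy e eqxx.
(* Boundary positions j and j + 1 on the top side are the top points with indices one apart counted
   from the right, whence this index. *)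
- move=> j xyj jN e; have := Ht (z - (j - (x + y)).+2).
  rewrite top_adjE; last by lia.
  have -> : x + y + (z - (z - (j - (x + y)).+2).+2) = j by lia.
  have -> : x + y + (z - (z - (j - (x + y)).+2).+1) = j.+1 by lia.
  by rewrite e eqxx.
exists p, q, r; split=> // s t st; apply: bdpos_inj; rewrite -partnerE.
have PK k : k < x + y + z -> partner d (partner d k) = k by apply: ncK.
case: s t st => [a|a] [b|b] //=; have la := ltn_ord a; have lb := ltn_ord b.
- by move=> h; rewrite P2; lia.
- case/orP => [/andP[h1 /eqP e]|/andP[h1 /eqP e]]; first by rewrite P1 //; lia.
  by rewrite P3 //; lia.
case/orP => [/andP[h1 /eqP e]|/andP[h1 /eqP e]].
  by rewrite -[RHS]PK; last lia; congr partner; rewrite P1 //; lia.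
by rewrite -[RHS]PK; last lia; congr partner; rewrite P3 //; lia.
Qed.

(** * The Temperley-Lieb category *)

Import Order.TTheory GRing.Theory Num.Theory.
Local Open Scope ring_scope.

Definition dv m n (d : diagram m n) : TL m n := [ffun d' => (d' == d)%:R : QA].

Lemma basis_dv m n (R : rel (pt m n)) (d : diagram m n) :
  (forall p q, R p q = (d p == q)) -> basis R = dv d.
Proof.
move=> H; apply/ffunP => d'; rewrite !ffunE; congr (nat_of_bool _)%:R.
apply/forallP/eqP => [H'|-> p]; last by apply/forallP => q; rewrite H.
apply/val_inj/ffunP => p; have /forallP/(_ (d p))/eqP := H' p.
by rewrite H eqxx => /eqP.
Qed.

Lemma TL_sum m n (X : TL m n) : X = \sum_d (X d : QA) *: dv d.
Proof.
apply/ffunP => d; rewrite sum_ffunE (bigD1 d) //= big1 => [|d' dd'].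
  by rewrite !ffunE eqxx addr0 /GRing.scale /= mulr1.
by rewrite !ffunE eq_sym (negPf dd') scaler0.
Qed.

(** Reduces a multilinear identity to diagrams, one argument at a time. *)
Lemma TL_ind m n (P : TL m n -> Prop) : P 0 ->
  (forall (a : QA) X Y, P X -> P Y -> P (a *: X + Y)) -> (forall d, P (dv d)) ->
  forall X, P X.
Proof.
move=> P0 PD Pd X; rewrite (TL_sum X); elim: (index_enum _) => [|d s IH].
  by rewrite big_nil.
by rewrite big_cons; apply: PD.
Qed.

Lemma big_dv (W : lmodType QA) m n (d : diagram m n) (F : diagram m n -> W) :
  \sum_e (dv d e : QA) *: F e = F d.
Proof.
rewrite (bigD1 d) //= big1 => [|e ed]; last by rewrite ffunE (negPf ed) scale0r.
by rewrite ffunE eqxx scale1r addr0.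
Qed.

Lemma TL_linE m n (a : QA) (X Y : TL m n) d : (a *: X + Y) d = a * X d + Y d :> QA.
Proof. by rewrite !ffunE. Qed.

Lemma compTLE m n p (X : TL n p) (Y : TL m n) :
  X *c Y = \sum_x (X x : QA) *:
    \sum_y (Y y : QA) *: (delta ^+ stack_loops x y *: dv (compd x y)).
Proof.
apply: eq_bigr => x _; rewrite scaler_sumr; apply: eq_bigr => y _.
rewrite (@basis_dv _ _ _ (compd x y)) ?scalerA ?mulrA // => p' q.
exact: stack_joinE.
Qed.

Lemma comp_dv m n p (x : diagram n p) (y : diagram m n) :
  dv x *c dv y = delta ^+ stack_loops x y *: dv (compd x y).
Proof. by rewrite compTLE !big_dv. Qed.

Lemma comp_linl m n p (a : QA) (X X' : TL n p) (Y : TL m n) :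
  (a *: X + X') *c Y = a *: (X *c Y) + X' *c Y.
Proof.
rewrite !compTLE scaler_sumr -big_split; apply: eq_bigr => x _ /=.
by rewrite TL_linE scalerDl -scalerA.
Qed.

Lemma comp_linr m n p (a : QA) (X : TL n p) (Y Y' : TL m n) :
  X *c (a *: Y + Y') = a *: (X *c Y) + X *c Y'.
Proof.
rewrite !compTLE scaler_sumr -big_split; apply: eq_bigr => x _ /=.
rewrite scalerA mulrC -scalerA -scalerDr; congr (_ *: _).
rewrite scaler_sumr -big_split; apply: eq_bigr => y _ /=.
by rewrite TL_linE scalerDl -scalerA.
Qed.

Lemma juxt_basis m n m' n' (x : diagram m n) (y : diagram m' n') :
  basis (juxt_join x y) = dv (juxtd x y).
Proof. by apply: basis_dv => p q; rewrite diagram_ofE. Qed.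

Lemma tensTLE m n m' n' (X : TL m n) (Y : TL m' n') :
  X *t Y = \sum_x (X x : QA) *: \sum_y (Y y : QA) *: dv (juxtd x y).
Proof.
apply: eq_bigr => x _; rewrite scaler_sumr; apply: eq_bigr => y _.
by rewrite juxt_basis scalerA.
Qed.

Lemma tens_dv m n m' n' (x : diagram m n) (y : diagram m' n') :
  dv x *t dv y = dv (juxtd x y).
Proof. by rewrite tensTLE !big_dv. Qed.

Lemma tens_linl m n m' n' (a : QA) (X X' : TL m n) (Y : TL m' n') :
  (a *: X + X') *t Y = a *: (X *t Y) + X' *t Y.
Proof.
rewrite !tensTLE scaler_sumr -big_split; apply: eq_bigr => x _ /=.
by rewrite TL_linE scalerDl -scalerA.
Qed.

Lemma tens_linr m n m' n' (a : QA) (X : TL m n) (Y Y' : TL m' n') :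
  X *t (a *: Y + Y') = a *: (X *t Y) + X *t Y'.
Proof.
rewrite !tensTLE scaler_sumr -big_split; apply: eq_bigr => x _ /=.
rewrite scalerA mulrC -scalerA -scalerDr; congr (_ *: _).
rewrite scaler_sumr -big_split; apply: eq_bigr => y _ /=.
by rewrite TL_linE scalerDl -scalerA.
Qed.

Lemma flipTLE m n (X : TL m n) : flipTL X = \sum_x (X x : QA) *: dv (flipd x).
Proof.
apply: eq_bigr => x _; congr (_ *: _); apply: basis_dv => p q.
by rewrite diagram_ofE.
Qed.

Lemma flip_dv m n (x : diagram m n) : flipTL (dv x) = dv (flipd x).
Proof. by rewrite flipTLE big_dv. Qed.

Lemma flip_lin m n (a : QA) (X Y : TL m n) :
  flipTL (a *: X + Y) = a *: flipTL X + flipTL Y.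
Proof.
rewrite !flipTLE scaler_sumr -big_split; apply: eq_bigr => x _ /=.
by rewrite TL_linE scalerDl -scalerA.
Qed.

Definition rotTL n (X : TL n n) : TL n n := \sum_x (X x : QA) *: dv (rotd x).

Lemma rot_dv n (x : diagram n n) : rotTL (dv x) = dv (rotd x).
Proof. by rewrite /rotTL big_dv. Qed.

Lemma rot_lin n (a : QA) (X Y : TL n n) :
  rotTL (a *: X + Y) = a *: rotTL X + rotTL Y.
Proof.
rewrite /rotTL scaler_sumr -big_split; apply: eq_bigr => x _ /=.
by rewrite TL_linE scalerDl -scalerA.
Qed.

Definition trd n (x : diagram n n) : nat := n_comp (closure_edge x) predT.

Lemma tr_dv n (x : diagram n n) : trTL (dv x) = delta ^+ trd x.
Proof. exact: (@big_dv QA^o). Qed.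

Lemma tr_lin n (a : QA) (X Y : TL n n) : trTL (a *: X + Y) = a * trTL X + trTL Y.
Proof.
rewrite /trTL mulr_sumr -big_split; apply: eq_bigr => x _ /=.
by rewrite TL_linE mulrA mulrDl.
Qed.

Section LinearConsequences.
Variables (U V : lmodType QA) (f : U -> V).
Hypothesis lin : forall (a : QA) x y, f (a *: x + y) = a *: f x + f y.

Lemma lin_additive0 : f 0 = 0.
Proof. by have := lin (-1) 0 0; rewrite scaler0 addr0 scaleN1r addNr. Qed.

Lemma lin_additiveD x y : f (x + y) = f x + f y.
Proof. by rewrite -{1}[x]scale1r lin scale1r. Qed.

Lemma lin_scale a x : f (a *: x) = a *: f x.
Proof. by rewrite -[X in f X]addr0 lin lin_additive0 addr0. Qed.

Lemma lin_additiveB x y : f (x - y) = f x - f y.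
Proof. by rewrite -scaleN1r addrC lin addrC scaleN1r. Qed.

Lemma lin_big I (r : seq I) (P : pred I) (F : I -> U) :
  f (\sum_(i <- r | P i) F i) = \sum_(i <- r | P i) f (F i).
Proof.
elim: r => [|i r IH]; first by rewrite !big_nil lin_additive0.
by rewrite !big_cons; case: ifP => // _; rewrite lin_additiveD IH.
Qed.
End LinearConsequences.

Section CompLinear.
Variables (m n p : nat).
Implicit Types (X : TL n p) (Y : TL m n).

Lemma comp0l Y : (0 : TL n p) *c Y = 0.
Proof. exact: (lin_additive0 (fun a X X' => comp_linl a X X' Y)). Qed.
Lemma comp0r X : X *c (0 : TL m n) = 0.
Proof. exact: (lin_additive0 (fun a => comp_linr a X)). Qed.
Lemma compBr X Y Y' : X *c (Y - Y') = X *c Y - X *c Y'.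
Proof. exact: (lin_additiveB (fun a => comp_linr a X)). Qed.
Lemma compZl (a : QA) X Y : (a *: X) *c Y = a *: (X *c Y).
Proof. exact: (lin_scale (fun a X X' => comp_linl a X X' Y)). Qed.
Lemma compZr (a : QA) X Y : X *c (a *: Y) = a *: (X *c Y).
Proof. exact: (lin_scale (fun a => comp_linr a X)). Qed.
Lemma comp_suml I (r : seq I) (P : pred I) (F : I -> TL n p) Y :
  (\sum_(i <- r | P i) F i) *c Y = \sum_(i <- r | P i) F i *c Y.
Proof. exact: (lin_big (fun a X X' => comp_linl a X X' Y)). Qed.
Lemma comp_sumr I (r : seq I) (P : pred I) (F : I -> TL m n) X :
  X *c (\sum_(i <- r | P i) F i) = \sum_(i <- r | P i) X *c F i.
Proof. exact: (lin_big (fun a => comp_linr a X)). Qed.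
End CompLinear.

Lemma expn2_inj a b : (2 ^ a = 2 ^ b)%N -> a = b.
Proof. by move=> /eqP; rewrite eqn_exp2l // => /eqP. Qed.

(* Every identity between diagrams, loop factors included, is checked on
   boolean states, that is, at loop value 2. *)
Lemma scaled_dv_eq m n (d d' : diagram m n) a b :
  (forall u v, (2 ^ a * compat d u v = 2 ^ b * compat d' u v)%N) ->
  delta ^+ a *: dv d = delta ^+ b *: dv d'.
Proof.
(* A constant state is compatible with every diagram, so it isolates the exponents. *)
move=> H; have := H [ffun=> true] [ffun=> true].
rewrite !compat_cst !muln1 => /expn2_inj ab; subst b.
suff -> : d = d' by [].
apply: compat_inj => u v; have /eqP := H u v.
by rewrite eqn_pmul2l ?expn_gt0 //; case: compat; case: compat.
Qed.

Lemma card_comp_mul m n p (x : diagram n p) (y : diagram m n) u w :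
  (2 ^ stack_loops x y * compat (compd x y) u w = \sum_v compat y u v * compat x v w)%N.
Proof. by rewrite -card_comp; apply: eq_bigr => v _; rewrite mulnb. Qed.

Lemma compTLA m n p q (X : TL p q) (Y : TL n p) (Z : TL m n) :
  X *c Y *c Z = X *c (Y *c Z).
Proof.
elim/TL_ind: X => [|a X X' IH IH'|x]; first by rewrite !comp0l.
  by rewrite !comp_linl IH IH'.
elim/TL_ind: Y => [|a Y Y' IH IH'|y]; first by rewrite !(comp0r, comp0l).
  by rewrite !(comp_linr, comp_linl) IH IH'.
elim/TL_ind: Z => [|a Z Z' IH IH'|z]; first by rewrite !(comp0r, comp0l).
  by rewrite !(comp_linr, comp_linl) IH IH'.
rewrite !comp_dv compZl compZr !comp_dv !scalerA -!exprD.
apply: scaled_dv_eq => u v; rewrite !expnD -!mulnA !card_comp_mul !big_distrr /=.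
under eq_bigr => w _ do rewrite mulnCA card_comp_mul big_distrr /=.
under [RHS]eq_bigr => w _ do rewrite mulnA card_comp_mul big_distrl /=.
rewrite exchange_big; apply: eq_bigr => w _; apply: eq_bigr => w' _.
by rewrite mulnA.
Qed.

Lemma idTLE n : idTL n = dv (id_diagram n).
Proof. by apply: basis_dv => p q; rewrite diagram_ofE. Qed.

Lemma eTLE n j (jn : (j.+1 < n)%N) : eTL n j = dv (e_diagram jn).
Proof. by apply: basis_dv => p q; rewrite diagram_ofE. Qed.

Lemma compd_idr m n (x : diagram m n) :
  compd x (id_diagram m) = x /\ stack_loops x (id_diagram m) = 0%N.
Proof.
have E u w :
    (2 ^ stack_loops x (id_diagram m) * compat (compd x (id_diagram m)) u w = compat x u w)%N.
  rewrite card_comp_mul (bigD1 u) //= compat_id eqxx mul1n big1 ?addn0 // => v vu.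
  by rewrite compat_id eq_sym (negPf vu).
have e0 := E [ffun=> true] [ffun=> true]; rewrite !compat_cst muln1 in e0.
have l0 : stack_loops x (id_diagram m) = 0%N by apply: expn2_inj; rewrite e0.
split=> //; apply: compat_inj => u w; have := E u w; rewrite l0 mul1n.
by case: compat; case: compat.
Qed.

Lemma compd_idl m n (x : diagram m n) :
  compd (id_diagram n) x = x /\ stack_loops (id_diagram n) x = 0%N.
Proof.
have E u w :
    (2 ^ stack_loops (id_diagram n) x * compat (compd (id_diagram n) x) u w = compat x u w)%N.
  rewrite card_comp_mul (bigD1 w) //= compat_id eqxx muln1 big1 ?addn0 // => v vu.
  by rewrite compat_id (negPf vu) muln0.
have e0 := E [ffun=> true] [ffun=> true]; rewrite !compat_cst muln1 in e0.
have l0 : stack_loops (id_diagram n) x = 0%N by apply: expn2_inj; rewrite e0.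
split=> //; apply: compat_inj => u w; have := E u w; rewrite l0 mul1n.
by case: compat; case: compat.
Qed.

Lemma comp1r m n (X : TL m n) : X *c idTL m = X.
Proof.
elim/TL_ind: X => [|a X X' IH IH'|x]; first by rewrite comp0l.
  by rewrite comp_linl IH IH'.
by rewrite idTLE comp_dv; have [-> ->] := compd_idr x; rewrite scale1r.
Qed.

Lemma comp1l m n (X : TL m n) : idTL n *c X = X.
Proof.
elim/TL_ind: X => [|a X X' IH IH'|x]; first by rewrite comp0r.
  by rewrite comp_linr IH IH'.
by rewrite idTLE comp_dv; have [-> ->] := compd_idl x; rewrite scale1r.
Qed.

Section TensLinear.
Variables (m n m' n' : nat).
Implicit Types (X : TL m n) (Y : TL m' n').
Lemma tens0l Y : (0 : TL m n) *t Y = 0.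
Proof. exact: (lin_additive0 (fun a X X' => tens_linl a X X' Y)). Qed.
Lemma tens0r X : X *t (0 : TL m' n') = 0.
Proof. exact: (lin_additive0 (fun a => tens_linr a X)). Qed.
Lemma tensZl (a : QA) X Y : (a *: X) *t Y = a *: (X *t Y).
Proof. exact: (lin_scale (fun a X X' => tens_linl a X X' Y)). Qed.
Lemma tens_suml I (r : seq I) (P : pred I) (F : I -> TL m n) Y :
  (\sum_(i <- r | P i) F i) *t Y = \sum_(i <- r | P i) F i *t Y.
Proof. exact: (lin_big (fun a X X' => tens_linl a X X' Y)). Qed.
End TensLinear.

Lemma sum_join m m' (F : state (m + m') -> nat) :
  (\sum_s F s = \sum_u \sum_v F (join_state u v))%N.
Proof.
rewrite pair_big /= (reindex (fun uv : state m * state m' => join_state uv.1 uv.2)) //.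
exists (fun s => (lstate s, rstate s)) => s _; last by rewrite join_stateK.
by rewrite lstate_join rstate_join -surjective_pairing.
Qed.

Lemma tens_comp m n p m' n' p' (X : TL n p) (Y : TL m n) (Z : TL n' p') (W : TL m' n') :
  (X *c Y) *t (Z *c W) = (X *t Z) *c (Y *t W).
Proof.
elim/TL_ind: X => [|a X X' IH IH'|x]; first by rewrite !(comp0l, tens0l).
  by rewrite !(comp_linl, tens_linl) IH IH'.
elim/TL_ind: Y => [|a Y Y' IH IH'|y]; first by rewrite !(comp0r, tens0l).
  by rewrite !(comp_linr, tens_linl) IH IH'.
elim/TL_ind: Z => [|a Z Z' IH IH'|z]; first by rewrite !(tens0r, comp0l, tens0r).
  by rewrite !(comp_linl, tens_linr) IH IH'.
elim/TL_ind: W => [|a W W' IH IH'|w]; first by rewrite !(tens0r, comp0r, tens0r).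
  by rewrite !(comp_linr, tens_linr) IH IH'.
rewrite !tens_dv !comp_dv.
rewrite tensZl (lin_scale (fun a => tens_linr a _)) tens_dv scalerA -exprD.
apply: scaled_dv_eq => u v; rewrite card_comp_mul sum_join compat_juxt -mulnb expnD.
rewrite mulnACA !card_comp_mul big_distrl /=; apply: eq_bigr => s _.
rewrite big_distrr /=; apply: eq_bigr => t _.
by rewrite !compat_juxt !lstate_join !rstate_join -!mulnb mulnACA.
Qed.

Lemma tens_id n n' : idTL n *t idTL n' = idTL (n + n').
Proof.
rewrite !idTLE tens_dv; congr dv; apply: compat_inj => u v.
rewrite compat_juxt !compat_id; apply/andP/eqP => [[/eqP l /eqP r]|->//].
by rewrite -(join_stateK u) l r join_stateK.
Qed.

Section FlipLinear.
Variables (m n : nat).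
Implicit Types X Y : TL m n.
Lemma flip0 : flipTL (0 : TL m n) = 0.
Proof. exact: (lin_additive0 (@flip_lin m n)). Qed.
Lemma flipZ (a : QA) X : flipTL (a *: X) = a *: flipTL X.
Proof. exact: (lin_scale (@flip_lin m n)). Qed.
End FlipLinear.

Lemma flipK m n (X : TL m n) : flipTL (flipTL X) = X.
Proof.
elim/TL_ind: X => [|a X X' IH IH'|x]; first by rewrite !flip0.
  by rewrite !flip_lin IH IH'.
by rewrite !flip_dv flipdK.
Qed.

Lemma flip_comp m n p (X : TL n p) (Y : TL m n) :
  flipTL (X *c Y) = flipTL Y *c flipTL X.
Proof.
elim/TL_ind: X => [|a X X' IH IH'|x]; first by rewrite comp0l !flip0 comp0r.
  by rewrite comp_linl !flip_lin comp_linr IH IH'.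
elim/TL_ind: Y => [|a Y Y' IH IH'|y]; first by rewrite comp0r !flip0 comp0l.
  by rewrite comp_linr !flip_lin comp_linl IH IH'.
rewrite comp_dv flipZ !flip_dv comp_dv; apply: scaled_dv_eq => u v.
rewrite compat_flip !card_comp_mul; apply: eq_bigr => w _.
by rewrite !compat_flip mulnC.
Qed.

Lemma flip_tens m n m' n' (X : TL m n) (Y : TL m' n') :
  flipTL (X *t Y) = flipTL X *t flipTL Y.
Proof.
elim/TL_ind: X => [|a X X' IH IH'|x]; first by rewrite tens0l !flip0 tens0l.
  by rewrite tens_linl !flip_lin tens_linl IH IH'.
elim/TL_ind: Y => [|a Y Y' IH IH'|y]; first by rewrite tens0r !flip0 tens0r.
  by rewrite tens_linr !flip_lin tens_linr IH IH'.
rewrite tens_dv !flip_dv tens_dv; congr dv; apply: compat_inj => u v.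
by rewrite compat_flip !compat_juxt !compat_flip.
Qed.

Lemma flip_id n : flipTL (idTL n) = idTL n.
Proof. by rewrite idTLE flip_dv flipd_id. Qed.

Lemma flip_e n j : (j.+1 < n)%N -> flipTL (eTL n j) = eTL n j.
Proof. by move=> jn; rewrite (eTLE jn) flip_dv flipd_e. Qed.

Lemma rotTL0 n : rotTL (0 : TL n n) = 0.
Proof. exact: (lin_additive0 (@rot_lin n)). Qed.
Lemma rotZ n (a : QA) (X : TL n n) : rotTL (a *: X) = a *: rotTL X.
Proof. exact: (lin_scale (@rot_lin n)). Qed.

Lemma rotTLK n (X : TL n n) : rotTL (rotTL X) = X.
Proof.
elim/TL_ind: X => [|a X X' IH IH'|x]; first by rewrite !rotTL0.
  by rewrite !rot_lin IH IH'.
rewrite !rot_dv; congr dv; apply: compat_inj => u v.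
by rewrite !compat_rot !rev_stateK.
Qed.

Lemma sum_rev n (F : state n -> nat) : (\sum_s F s = \sum_s F (rev_state s))%N.
Proof. exact: (reindex_inj (inv_inj (@rev_stateK n))). Qed.

Lemma rot_comp n (X Y : TL n n) : rotTL (X *c Y) = rotTL Y *c rotTL X.
Proof.
elim/TL_ind: X => [|a X X' IH IH'|x]; first by rewrite comp0l !rotTL0 comp0r.
  by rewrite comp_linl !rot_lin comp_linr IH IH'.
elim/TL_ind: Y => [|a Y Y' IH IH'|y]; first by rewrite comp0r !rotTL0 comp0l.
  by rewrite comp_linr !rot_lin comp_linl IH IH'.
rewrite comp_dv rotZ !rot_dv comp_dv; apply: scaled_dv_eq => u v.
rewrite compat_rot !card_comp_mul sum_rev; apply: eq_bigr => w _.
by rewrite !compat_rot mulnC.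
Qed.

Lemma rot_e n j : (j.+1 < n)%N -> rotTL (eTL n j) = eTL n (n - j.+2).
Proof.
move=> jn; have jn' : ((n - j.+2).+1 < n)%N by lia.
rewrite (eTLE jn) (eTLE jn') rot_dv; congr dv; apply: compat_inj => u v.
rewrite compat_rot; have nj : (n - (n - j.+2).+1 = j.+1)%N by lia.
have e1 : (n - j.+1 = (n - j.+2).+1)%N by lia.
have j1 : (j < n)%N by lia.
apply/idP/idP => /compat_e; rewrite ?at_rev // => -[h1 h2 h3]; apply/compat_e;
  rewrite ?at_rev //; split; try by rewrite -?e1.
- move=> k kn k1 k2; have := h3 (n - k.+1)%N; rewrite !at_rev; try lia.
  have -> : (n - (n - k.+1).+1 = k)%N by lia.
  by move=> ->; lia.
- by rewrite e1.
- by rewrite e1.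
move=> k kn k1 k2; rewrite !at_rev // -h3; lia.
Qed.

Lemma trd_sum n (x : diagram n n) : (2 ^ trd x = \sum_u compat x u u)%N.
Proof. by rewrite card_closure. Qed.

Lemma tr0 n : trTL (0 : TL n n) = 0.
Proof. exact: (@lin_additive0 _ QA^o _ (@tr_lin n)). Qed.
Lemma trZ n (a : QA) (X : TL n n) : trTL (a *: X) = a * trTL X.
Proof. exact: (@lin_scale _ QA^o _ (@tr_lin n)). Qed.

Lemma tr_comp_dv m n (x : diagram m n) (y : diagram n m) : exists l,
  trTL (dv x *c dv y) = delta ^+ l /\
  (2 ^ l = \sum_u \sum_v compat y u v * compat x v u)%N.
Proof.
exists (stack_loops x y + trd (compd x y))%N; rewrite comp_dv trZ tr_dv exprD; split=> //.
rewrite expnD trd_sum big_distrr /=; apply: eq_bigr => u _.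
by rewrite card_comp_mul.
Qed.

Lemma trC m n (X : TL m n) (Y : TL n m) : trTL (X *c Y) = trTL (Y *c X).
Proof.
elim/TL_ind: X => [|a X X' IH IH'|x]; first by rewrite comp0l comp0r !tr0.
  by rewrite comp_linl comp_linr !tr_lin IH IH'.
elim/TL_ind: Y => [|a Y Y' IH IH'|y]; first by rewrite comp0l comp0r !tr0.
  by rewrite comp_linl comp_linr !tr_lin IH IH'.
have [l [-> lE]] := tr_comp_dv x y; have [l' [-> l'E]] := tr_comp_dv y x.
congr (_ ^+ _); apply: expn2_inj; rewrite lE l'E exchange_big.
by apply: eq_bigr => u _; apply: eq_bigr => v _; rewrite mulnC.
Qed.

(** * Anisotropy of the trace pairing *)

Section PairingDegree.
Variables m n : nat.
Implicit Types x y : diagram m n.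

Definition pair_states x y : {set state m * state n} :=
  [set uv | compat x uv.1 uv.2 && compat y uv.1 uv.2].

Definition pair_loops x y : nat :=
  (stack_loops x (flipd y) + trd (compd x (flipd y)))%N.

Lemma card_pair_states x y : #|pair_states x y| = (2 ^ pair_loops x y)%N.
Proof.
rewrite /pair_loops expnD trd_sum big_distrr /=.
under eq_bigr => u _ do rewrite card_comp_mul.
rewrite exchange_big /= pair_big /= -sum_nat_bool.
by apply: eq_bigr => -[u v] _; rewrite compat_flip mulnb andbC.
Qed.

(** The common states of x and y form a subset of the states of x. It is proper when x <> y, because
    a diagram all of whose states are states of y has the arcs of y. *)
Lemma pair_loops_lt x y : x <> y -> (pair_loops x y < pair_loops x x)%N.
Proof.
move=> xy.
suff: (#|pair_states x y| < #|pair_states x x|)%N.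
  by rewrite !card_pair_states ltn_exp2l.
apply/proper_card/properP; split.
  by apply/subsetP => uv; rewrite !inE andbb => /andP[].
case: (boolP [exists uv, compat x uv.1 uv.2 && ~~ compat y uv.1 uv.2]).
  by case/existsP=> uv /andP[h1 h2]; exists uv; rewrite inE h1 ?(negPf h2).
move/existsPn => H; case: xy; apply/val_inj/ffunP => p.
apply/eqP/arc_compatP; split.
  by move=> e; have := arc_neq y p; rewrite /= -e eqxx.
move=> u v xuv; have := H (u, v); rewrite /= xuv negbK => /compatP/(_ p).
by move=> ->.
Qed.

(** A state of x is a free choice of one label per arc. The set [L] picks from each arc its end of
    smaller position, so the states correspond to the subsets of [L]. *)
Lemma pair_loops_diag x : pair_loops x x = (m + n)./2.
Proof.
pose L := [set p | bdpos p < bdpos (x p)]%N.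
have Lx p : (x p \in L) = (p \notin L).
  rewrite !inE arcK -leqNgt [RHS]leq_eqVlt; case: eqP => // e.
  by have := arc_neq x p; rewrite (bdpos_inj e) eqxx.
have cardL : (#|L| + #|L| = m + n)%N.
  have -> : (m + n = #|{: pt m n}|)%N by rewrite card_sum !card_ord.
  rewrite -(cardsC L); congr (_ + _)%N.
  rewrite -(card_imset _ (inv_inj (arcK x))); apply: eq_card => p.
  rewrite inE -Lx; apply/imsetP/idP => [[q qL ->]|pL]; first by rewrite arcK.
  by exists (x p); rewrite ?arcK.
have -> : ((m + n)./2 = #|L|)%N by rewrite -cardL addnn doubleK.
apply: expn2_inj; rewrite -card_pair_states -card_powerset.
pose s (X : {set pt m n}) (p : pt m n) := if p \in L then p \in X else x p \in X.
pose f X := ([ffun a => s X (inl a)] : state m, [ffun b => s X (inr b)] : state n).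
have gE X p : glue (f X).1 (f X).2 p = s X p by rewrite /f /= (glueE (s X)).
rewrite -(@card_in_imset _ _ f); last first.
  move=> X Y; rewrite !inE => /subsetP XL /subsetP YL fXY; apply/setP => p.
  case pL: (p \in L); last by rewrite (contraFF (XL p) pL) (contraFF (YL p) pL).
  by have := gE X p; rewrite fXY gE /s pL.
apply: eq_card => -[u v]; rewrite inE andbb /=.
apply/idP/imsetP => [/compatP xuv|[X _ e]]; last first.
  have [-> ->] : u = (f X).1 /\ v = (f X).2 by rewrite -e.
  apply/compatP => p; rewrite !gE /s Lx arcK.
  by case: (p \in L).
exists [set p in L | glue u v p].
  by rewrite inE; apply/subsetP => p; rewrite inE => /andP[].
have sE p : s [set p in L | glue u v p] p = glue u v p.
  by rewrite /s; case: ifP => pL; rewrite inE ?Lx pL //= xuv.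
by congr pair; apply/ffunP => a; rewrite ffunE sE.
Qed.

Definition pairing (X Y : TL m n) : QA := trTL (X *c flipTL Y).

Lemma pairing_dv x y : pairing (dv x) (dv y) = delta ^+ pair_loops x y.
Proof. by rewrite /pairing flip_dv comp_dv trZ tr_dv -exprD. Qed.

Lemma pairing_linl (a : QA) X X' Y :
  pairing (a *: X + X') Y = a * pairing X Y + pairing X' Y.
Proof. by rewrite /pairing comp_linl tr_lin. Qed.

Lemma pairing_linr (a : QA) X Y Y' :
  pairing X (a *: Y + Y') = a * pairing X Y + pairing X Y'.
Proof. by rewrite /pairing flip_lin comp_linr tr_lin. Qed.

Lemma pairingE X Y :
  pairing X Y = \sum_x \sum_y X x * Y y * delta ^+ pair_loops x y.
Proof.
rewrite {1}[X]TL_sum (@lin_big _ QA^o (pairing^~ Y)); last first.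
  by move=> a X1 X2; exact: pairing_linl.
apply: eq_bigr => x _; rewrite (@lin_scale _ QA^o (pairing^~ Y)); last first.
  by move=> a X1 X2; exact: pairing_linl.
rewrite {1}[Y]TL_sum (@lin_big _ QA^o (pairing (dv x))); last first.
  by move=> a X1 X2; exact: pairing_linr.
rewrite scaler_sumr; apply: eq_bigr => y _.
rewrite (@lin_scale _ QA^o (pairing (dv x))); last first.
  by move=> a X1 X2; exact: pairing_linr.
by rewrite pairing_dv /GRing.scale /= mulrA.
Qed.

End PairingDegree.

(** * Clearing denominators and specialising A *)

Lemma fraction_denominator (R : idomainType) (x : {fraction R}) :
  exists2 d : R, d != 0 & exists c : R, x * tofrac d = tofrac c.
Proof.
elim/quotW: x => r; exists (\d_r); first exact: denom_ratioP.
exists (\n_r); rewrite !piE; apply/eqmodP.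
rewrite /= FracField.equivfE /FracField.mulf !numden_Ratio ?(oner_eq0, mulf_neq0, denom_ratioP) //.
by rewrite !mulr1 mulrC.
Qed.

Lemma common_denominator (R : idomainType) (I : finType) (x : I -> {fraction R}) :
  exists2 d : R, d != 0 & exists c : I -> R, forall i, x i * tofrac d = tofrac (c i).
Proof.
suff [d d0 dP] : exists2 d : R, d != 0 & forall i, i \in enum I ->
    exists c : R, x i * tofrac d = tofrac c.
  have dP' i : exists c : R, x i * tofrac d == tofrac c.
    by have [c e] := dP i (mem_enum _ i); exists c; apply/eqP.
  by exists d => //; exists (fun i => xchoose (dP' i)) => i; apply/eqP/(xchooseP (dP' i)).
elim: (enum I) => [|i s [d d0 dP]]; first by exists 1; rewrite ?oner_eq0.
have [d' d'0 [c' c'P]] := fraction_denominator (x i).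
exists (d' * d); first by rewrite mulf_neq0.
move=> j; rewrite inE => /orP[/eqP->|js].
  by exists (c' * d); rewrite !tofracM mulrA c'P.
by have [c cP] := dP _ js; exists (c * d'); rewrite !tofracM mulrCA cP mulrC.
Qed.

(* The Gram matrix of the diagrams is dominated by its diagonal when A is
   specialised to a large rational number, so the form is definite there. *)
Section Dominance.
Variables (I : finType) (l : I -> I -> nat) (N : nat).
Hypothesis l_diag : forall i, l i i = N.
Hypothesis l_off : forall i j, i != j -> (l i j < N)%N.

(** This is a^(2N) delta^k at A = a, a polynomial in a for k <= N, since a^2 delta = -(a^4 + 1). *)
Let w (a : rat) k : rat := (- (a ^+ 4 + 1)) ^+ k * (a ^+ 2) ^+ (N - k).

(** With b = a^4 + 1 and g = a^2, the diagonal entries have absolute value b^N and the others at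
    most g b^(N-1). The bound on a gives |I| g < b, so the diagonal outweighs the rest. *)
Lemma definite_at (a : rat) (c : I -> rat) : (#|I|.+1)%:R <= a ->
  \sum_i \sum_j c i * c j * w a (l i j) = 0 -> forall i, c i = 0.
Proof.
move=> aI; pose b := a ^+ 4 + 1; pose g := a ^+ 2.
have a1 : 1 <= a by apply: le_trans aI; rewrite ler1n.
have g1 : 1 <= g by rewrite exprn_ege1.
have bE : b = g * g + 1 by rewrite /b /g; ring.
have ag : a <= g by rewrite /g expr2 ler_peMr //; lra.
have gb : g <= b by rewrite bE; nra.
have b0 : 0 < b by lra.
have bIg : #|I|%:R * g < b.
  have : #|I|%:R + 1 <= a by rewrite -natr1 in aI.
  move=> h; rewrite bE; have : #|I|%:R * g <= g * g by rewrite ler_wpM2r; lra.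
  lra.
(* The factor b on the left avoids the exponent N - 1. *)
have off k : (k < N)%N -> b * `|w a k| <= g * b ^+ N.
  move=> kN; rewrite /w normrM !normrX normrN -/b -/g !ger0_norm; try lra.
  have -> : (N - k = (N - k.+1).+1)%N by lia.
  have -> : b * (b ^+ k * g ^+ (N - k.+1).+1) = g * (b ^+ k.+1 * g ^+ (N - k.+1)).
    by rewrite !exprS; ring.
  have -> : b ^+ N = b ^+ k.+1 * b ^+ (N - k.+1) by rewrite -exprD subnKC.
  rewrite ler_pM2l; last by lra.
  by rewrite ler_pM2l ?exprn_gt0 // lerXn2r // ?nnegrE; lra.
have wN : w a N = (-1) ^+ N * b ^+ N by rewrite /w subnn expr0 mulr1 [LHS]exprNn.
pose S := \sum_i c i ^+ 2; have S0 : 0 <= S by apply: sumr_ge0 => i _; apply: sqr_ge0.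
move=> H.
(* The diagonal part equals minus the off-diagonal one, which is estimated by the mean of squares.
   Nonnegative terms with j = i are added so that the double sum factors as in [SS]. *)
have Hb : b * b ^+ N * S <= \sum_i \sum_j g * b ^+ N * ((c i ^+ 2 + c j ^+ 2) / 2).
  have e : b * b ^+ N * S = - (-1) ^+ N * b * \sum_i \sum_(j | j != i) c i * c j * w a (l i j).
    have : \sum_i (c i * c i * w a N + \sum_(j | j != i) c i * c j * w a (l i j)) = 0.
      rewrite -[RHS]H; apply: eq_bigr => i _; rewrite [RHS](bigD1 i) //= l_diag.
      by congr (_ + _); apply: eq_bigl.
    rewrite big_split /= => /eqP; rewrite addr_eq0 -mulr_suml wN => /eqP e.
    have {e} -> : \sum_i \sum_(j | j != i) c i * c j * w a (l i j) =
      - (S * ((-1) ^+ N * b ^+ N)) by rewrite e opprK.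
    rewrite mulrN mulNr !mulNr opprK.
    have : (-1) ^+ N * (-1) ^+ N = 1 :> rat by rewrite -expr2 sqrr_sign.
    move: ((-1) ^+ N) => s ss; rewrite -[LHS]mul1r -ss; ring.
  rewrite e mulr_sumr; apply: ler_sum => i _; rewrite mulr_sumr.
  rewrite [X in _ <= X](bigD1 i) //= -[X in X <= _]add0r lerD //.
    by rewrite mulr_ge0 ?mulr_ge0 ?exprn_ge0 //; have := sqr_ge0 (c i); lra.
  apply: ler_sum => j ji; apply: (le_trans (ler_norm _)).
  have := off _ (l_off (i := i) (j := j) _); rewrite eq_sym => /(_ ji).
  move: (w a (l i j)) => v h.
  rewrite !normrM normrN normrX normrN1 expr1n (ger0_norm (ltW b0)).
  have -> : 1 * b * (`|c i| * `|c j| * `|v|) =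
    (b * `|v|) * (`|c i| * `|c j|) by ring.
  have cc : `|c i| * `|c j| <= (c i ^+ 2 + c j ^+ 2) / 2.
    have := sqr_ge0 (`|c i| - `|c j|); rewrite -[c i ^+ 2]real_normK ?num_real //.
    rewrite -[c j ^+ 2]real_normK ?num_real //; nra.
  by apply: ler_pM => //; rewrite mulr_ge0 // ltW.
have SS : \sum_i \sum_j g * b ^+ N * ((c i ^+ 2 + c j ^+ 2) / 2) = g * b ^+ N * (#|I|%:R * S).
  under eq_bigr => i _ do rewrite -mulr_sumr -mulr_suml big_split /= sumr_const.
  rewrite -mulr_sumr -mulr_suml big_split /= sumr_const -/S.
  under eq_bigr => i _ do rewrite cardT -cardE -[_ *+ _]mulr_natl.
  rewrite -mulr_sumr -/S -[S *+ _]mulr_natl.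
  by congr (_ * _); field.
have S00 : S = 0.
  apply/eqP; rewrite eq_le S0 andbT leNgt; apply/negP => Sp.
  move: Hb; rewrite SS; apply/negP; rewrite -ltNge.
  rewrite [X in _ < X]mulrAC mulrA -[g * _ * _]mulrA mulrCA mulrA.
  rewrite -[X in _ < X]mulrA -[X in X < _]mulrA.
  have bN : 0 < b ^+ N by rewrite exprn_gt0.
  have : 0 < b ^+ N * S by rewrite mulr_gt0.
  nra.
move=> i; apply/eqP; rewrite -sqrf_eq0; apply/eqP.
move/eqP: S00; rewrite psumr_eq0 => [/allP/(_ i)|j _]; last exact: sqr_ge0.
by rewrite mem_index_enum => /(_ isT)/eqP.
Qed.
End Dominance.

Lemma varA_neq0 : varA != 0.
Proof. by rewrite /varA tofrac_eq0 polyX_eq0. Qed.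

Lemma delta_scaled1 (K : fieldType) (A : K) : A != 0 ->
  A ^+ 2 * (- A ^+ 2 - A ^- 2) = - (A ^+ 4 + 1).
Proof. by move=> A0; field. Qed.

Lemma delta_scaled N l : (l <= N)%N -> varA ^+ 2 ^+ N * delta ^+ l =
  tofrac ((- ('X ^+ 4 + 1)) ^+ l * ('X ^+ 2) ^+ (N - l) : {poly rat}).
Proof.
move=> lN; rewrite tofracM !tofracXn tofracN tofracD !tofracXn tofrac1 -/varA.
rewrite -{1}(subnK lN) exprD -mulrA -exprMn mulrC; congr (_ ^+ _ * _).
exact: (delta_scaled1 varA_neq0).
Qed.

Theorem pairing_anisotropic m n (X : TL m n) : pairing X X = 0 -> X = 0.
Proof.
rewrite pairingE => H.
have [d d0 [c cP]] := common_denominator X.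
pose N := ((m + n)./2)%N.
pose W l : {poly rat} := (- ('X ^+ 4 + 1)) ^+ l * ('X ^+ 2) ^+ (N - l).
have lN x y : (@pair_loops m n x y <= N)%N.
  have [->|/eqP xy] := eqVneq x y; first by rewrite pair_loops_diag.
  by apply: ltnW; have := pair_loops_lt xy; rewrite pair_loops_diag.
have Hc : \sum_x \sum_y c x * c y * W (pair_loops x y) = 0.
  apply/eqP; rewrite -tofrac_eq0 rmorph_sum /=; apply/eqP.
  (* Here d^2 clears the two coefficients and A^(2N) clears every delta^l with l <= N. *)
  transitivity (tofrac d ^+ 2 * varA ^+ 2 ^+ N *
    \sum_x \sum_y X x * X y * delta ^+ pair_loops x y); last by rewrite H mulr0.
  rewrite mulr_sumr; apply: eq_bigr => x _; rewrite rmorph_sum mulr_sumr /=.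
  apply: eq_bigr => y _; rewrite tofracM (tofracM (c x)) -!cP.
  rewrite -(delta_scaled (lN x y)).
  move: (X x : QA) (X y : QA) (tofrac d) (delta ^+ _) (varA ^+ 2 ^+ N) => x1 x2 x3 x4 x5.
  ring.
have c0 x : c x = 0.
  pose M := #|{: diagram m n}|.
  (* Every integer above the number of diagrams is a root of [c x]; taking [size (c x)] of them, one
     more than the degree of a nonzero polynomial, forces [c x] to be 0. *)
  apply: (@roots_geq_poly_eq0 _ _ [seq (M.+1 + k)%:R | k <- iota 0 (size (c x))]).
  - apply/allP => _ /mapP[k _ ->]; apply/eqP.
    apply: (@definite_at _ (@pair_loops m n) N _ _ (M.+1 + k)%:R
      (fun x => (c x).[(M.+1 + k)%:R])).
    + exact: pair_loops_diag.
    + by move=> i j /eqP/pair_loops_lt; rewrite pair_loops_diag.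
    + by rewrite ler_nat leq_addr.
    move/(congr1 (fun p => p.[(M.+1 + k)%:R])): Hc; rewrite horner0 horner_sum.
    move=> e; rewrite -[RHS]e.
    apply: eq_bigr => i _; rewrite horner_sum; apply: eq_bigr => j _.
    by rewrite /W !hornerM !horner_exp !(hornerE, horner_exp).
  - rewrite map_inj_uniq ?iota_uniq // => k k' /eqP.
    by rewrite eqr_nat eqn_add2l => /eqP.
  by rewrite size_map size_iota.
apply/ffunP => x; rewrite ffunE; apply/eqP.
have := cP x; rewrite c0 tofrac0 => /eqP; rewrite mulf_eq0 tofrac_eq0 (negPf d0) orbF.
by [].
Qed.

From mathcomp Require Import boolp classical_sets.

(** * Jones-Wenzl idempotents *)

Opaque compTL tensTL flipTL trTL eTL idTL.

Lemma pairing0l m n (Y : TL m n) : pairing 0 Y = 0.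
Proof. by rewrite /pairing comp0l tr0. Qed.

Lemma pairing_dvr m n (X : TL m n) d :
  pairing X (dv d) = \sum_x X x * delta ^+ pair_loops x d.
Proof.
rewrite pairingE; apply: eq_bigr => x _; rewrite (bigD1 d) //= big1 => [|y yd].
  by rewrite ffunE eqxx mulr1 addr0.
by rewrite ffunE (negPf yd) mulr0 mul0r.
Qed.

Lemma pairing_sumr m n (X Y : TL m n) : pairing X Y = \sum_d Y d * pairing X (dv d).
Proof.
rewrite pairingE exchange_big; apply: eq_bigr => y _; rewrite pairing_dvr mulr_sumr.
by apply: eq_bigr => x _; rewrite mulrCA mulrA.
Qed.

(** A vector in the kernel of the Gram matrix pairs to 0 with every diagram, hence with itself;
    anisotropy makes the matrix invertible. *)
Lemma pairing_dual m n (phi : diagram m n -> QA) :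
  exists X : TL m n, forall d, pairing X (dv d) = phi d.
Proof.
pose N := #|{: diagram m n}|.
pose G : 'M[QA]_N := \matrix_(i, j) delta ^+ pair_loops (enum_val i) (enum_val j).
pose T (v : 'rV[QA]_N) : TL m n := [ffun d => v 0 (enum_rank d)].
have TG v d : pairing (T v) (dv d) = (v *m G) 0 (enum_rank d).
  rewrite pairing_dvr mxE (reindex (fun i : 'I_N => enum_val i)) /=.
    by apply: eq_bigr => i _; rewrite ffunE mxE enum_valK enum_rankK.
  by exists enum_rank => i _; rewrite (enum_valK, enum_rankK).
have G_free : row_free G.
  apply: inj_row_free => v vG; have T0 : T v = 0.
    apply: pairing_anisotropic; rewrite pairing_sumr big1 // => d _.
    by rewrite TG vG mxE mulr0.
  apply/rowP => i; rewrite mxE -[i](enum_valK).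
  by have /ffunP/(_ (enum_val i)) := T0; rewrite !ffunE.
exists (T ((\row_i phi (enum_val i)) *m invmx G)) => d.
by rewrite TG mulmxKV -?row_free_unit // mxE enum_rankK.
Qed.

(** delta is the value of the form at the identity of TL_1. *)
Lemma delta_neq0 : delta != 0.
Proof.
apply/eqP => d0.
have /pairing_anisotropic/ffunP/(_ (id_diagram 1)) : pairing (idTL 1) (idTL 1) = 0.
  by rewrite idTLE pairing_dv pair_loops_diag expr1.
by rewrite idTLE !ffunE eqxx => /eqP; rewrite oner_eq0.
Qed.

Lemma id_no_bottom_adj n j : bottom_adj (id_diagram n) j = false.
Proof.
apply/negP => h; have jn : (j.+1 < n)%N by case/andP: h.
have /eqP := bottom_adj_arc jn h; by rewrite diagram_ofE.
Qed.

Lemma compd_bottom_adj m n p (x : diagram n p) (y : diagram m n) j :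
  bottom_adj y j -> bottom_adj (compd x y) j.
Proof.
move=> h; have jn : (j.+1 < m)%N by case/andP: h.
apply/(bottom_adjP _ jn) => u w; rewrite compat_comp => /existsP[v /andP[yuv _]].
exact: (bottom_adjP y jn) yuv.
Qed.

Lemma compd_top_adj m n p (x : diagram n p) (y : diagram m n) j :
  top_adj x j -> top_adj (compd x y) j.
Proof. by rewrite /top_adj flipd_comp; apply: compd_bottom_adj. Qed.

Lemma e_bottom_adj n j (jn : (j.+1 < n)%N) : bottom_adj (e_diagram jn) j.
Proof. by apply/(bottom_adjP _ jn) => u v /compat_e[]. Qed.

Lemma dv_bottom_adj m n (d : diagram m n) j (jm : (j.+1 < m)%N) : bottom_adj d j ->
  exists c : QA, dv d = c *: (dv d *c eTL m j).
Proof.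
move=> dj; exists (delta ^- stack_loops d (e_diagram jm)).
rewrite (eTLE jm) comp_dv comp_bottom_adj // scalerA mulVf ?scale1r //.
by rewrite expf_neq0 // delta_neq0.
Qed.

Lemma dv_top_adj m n (d : diagram m n) j (jn : (j.+1 < n)%N) : top_adj d j ->
  exists c : QA, dv d = c *: (eTL n j *c dv d).
Proof.
move=> dj; exists (delta ^- stack_loops (e_diagram jn) d).
rewrite (eTLE jn) comp_dv comp_top_adj // scalerA mulVf ?scale1r //.
by rewrite expf_neq0 // delta_neq0.
Qed.

Section Kill.
Variables (n : nat) (f : TL n n).
Hypothesis fe : forall j, (j.+1 < n)%N -> eTL n j *c f = 0 /\ f *c eTL n j = 0.

Lemma kill_bottom p (d : diagram n p) j : bottom_adj d j -> dv d *c f = 0.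
Proof.
move=> dj; have jn : (j.+1 < n)%N by case/andP: dj.
have [c ->] := dv_bottom_adj jn dj.
by rewrite compZl compTLA (fe jn).1 comp0r scaler0.
Qed.

Lemma kill_top m (d : diagram m n) j : top_adj d j -> f *c dv d = 0.
Proof.
move=> dj; have jn : (j.+1 < n)%N by case/andP: dj.
have [c ->] := dv_top_adj jn dj.
by rewrite compZr -compTLA (fe jn).2 comp0l scaler0.
Qed.

(** Every diagram other than the identity has an adjacent cap at the bottom, which f kills.
    Idempotence of f is not assumed, so this also serves for the unnormalised element in
    [JW_exists]. *)
Lemma kill_coefl (X : TL n n) : X *c f = (X (id_diagram n) : QA) *: f.
Proof.
rewrite {1}[X]TL_sum comp_suml (bigD1 (id_diagram n)) //= big1.
  by rewrite compZl -idTLE comp1l addr0.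
move=> d /eqP /not_id_bottom_adj[j dj].
by rewrite compZl (kill_bottom dj) scaler0.
Qed.

Lemma kill_coefr (X : TL n n) : f *c X = (X (id_diagram n) : QA) *: f.
Proof.
rewrite {1}[X]TL_sum comp_sumr (bigD1 (id_diagram n)) //= big1.
  by rewrite compZr -idTLE comp1r addr0.
move=> d /eqP /not_id_top_adj[j dj].
by rewrite compZr (kill_top dj) scaler0.
Qed.
End Kill.

(** Every diagram occurring in Z e_j inherits the cap at j. *)
Lemma comp_coef_id_bottom m n (Z : TL m n) j (jm : (j.+1 < m)%N) (d : diagram m n) :
  bottom_adj d j = false -> (Z *c eTL m j) d = 0.
Proof.
move=> dj; elim/TL_ind: Z => [|a Z Z' IH IH'|z]; first by rewrite comp0l ffunE.
  by rewrite comp_linl TL_linE IH IH' mulr0 addr0.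
rewrite (eTLE jm) comp_dv !ffunE; case: eqP => [e|_]; last by rewrite scaler0.
by move: dj; rewrite e compd_bottom_adj ?e_bottom_adj.
Qed.

Lemma JW_exists n : exists f : TL n n, is_JW f.
Proof.
(* [g] represents the coefficient of the identity; as [eTL n j *c Z] never involves
   the identity, [eTL n j *c g] is orthogonal to everything. *)
have [g gP] := pairing_dual (fun d => (d == id_diagram n)%:R).
have gE Z : pairing g Z = Z (id_diagram n).
  rewrite pairing_sumr (bigD1 (id_diagram n)) //= gP eqxx mulr1 big1 ?addr0 //.
  by move=> d dn; rewrite gP (negPf dn) mulr0.
have ge j : (j.+1 < n)%N -> g *c eTL n j = 0.
  move=> jn; apply: pairing_anisotropic.
  have -> Z : pairing (g *c eTL n j) Z = pairing g (Z *c eTL n j).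
    by rewrite /pairing flip_comp (flip_e jn) compTLA.
  by rewrite gE comp_coef_id_bottom // id_no_bottom_adj.
have eg j : (j.+1 < n)%N -> eTL n j *c g = 0.
  move=> jn; apply: pairing_anisotropic.
  have -> Z : pairing (eTL n j *c g) Z = pairing g (eTL n j *c Z).
    rewrite /pairing flip_comp (flip_e jn) [X in trTL X = _]compTLA [LHS]trC.
    by rewrite [X in trTL X = _]compTLA.
  (* Reflection moves e_j to the right, where [comp_coef_id_bottom] applies, and it preserves the
     coefficient of the identity. *)
  rewrite gE -[eTL n j *c _]flipK flip_comp flip_e //.
  rewrite flipTLE sum_ffunE big1 // => d _.
  rewrite ffunE; case: (eqVneq d (id_diagram n)) => [->|dn].
    by rewrite comp_coef_id_bottom ?id_no_bottom_adj // scale0r.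
  rewrite !ffunE -[id_diagram n]flipd_id (inj_eq (can_inj (@flipdK n n))).
  by rewrite eq_sym (negPf dn) scaler0.
have g0 : g <> 0.
  move=> e; have := gP (id_diagram n); rewrite e pairing0l eqxx.
  by move/eqP; rewrite eq_sym oner_eq0.
have gid : g (id_diagram n) != 0 :> QA.
  by apply/eqP => e; apply: g0; apply: pairing_anisotropic; rewrite gE.
have fe j (jn : (j.+1 < n)%N) := conj (eg j jn) (ge j jn).
exists ((g (id_diagram n) : QA)^-1 *: g); split.
- move=> /eqP; rewrite scaler_eq0 invr_eq0 (negPf gid) => /eqP; exact: g0.
- rewrite compZl compZr (kill_coefl fe); congr (_ *: _).
  by rewrite scalerA mulVf // scale1r.
by move=> j jn; rewrite compZl compZr eg // ge // !scaler0.
Qed.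

Lemma is_JW_id n (f : TL n n) : is_JW f -> f (id_diagram n) = 1 :> QA.
Proof.
case=> f0 ff fe; move: ff; rewrite (kill_coefl fe) => e.
have /eqP : ((f (id_diagram n) : QA) - 1) *: f = 0.
  by rewrite scalerBl e scale1r subrr.
by rewrite scaler_eq0 subr_eq0 => /orP[/eqP|/eqP].
Qed.

(** Computed from either factor, f g is the other's identity coefficient times that factor, and both
    coefficients are 1. *)
Lemma is_JW_unique n (f g : TL n n) : is_JW f -> is_JW g -> f = g.
Proof.
move=> Hf Hg; have [_ _ fe] := Hf; have [_ _ ge] := Hg.
by have := kill_coefr fe g; rewrite (kill_coefl ge) !is_JW_id // !scale1r.
Qed.

Lemma JWP n : is_JW (JW n).
Proof. by have [f fP] := JW_exists n; exact: (xgetI 0 fP). Qed.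

Lemma JW_neq0 n : JW n <> 0. Proof. by have [] := JWP n. Qed.
Lemma JW_idem n : JW n *c JW n = JW n. Proof. by have [] := JWP n. Qed.
Lemma JW_e n j : (j.+1 < n)%N -> eTL n j *c JW n = 0 /\ JW n *c eTL n j = 0.
Proof. by have [_ _ fe] := JWP n; apply: fe. Qed.
Lemma JW_id n : JW n (id_diagram n) = 1 :> QA. Proof. exact/is_JW_id/JWP. Qed.

Lemma JW_flip n : flipTL (JW n) = JW n.
Proof.
apply: is_JW_unique; last exact: JWP.
have [f0 ff fe] := JWP n; split.
- by move=> e; apply: f0; rewrite -[JW n]flipK e flip0.
- by rewrite -flip_comp ff.
move=> j jn; have [h1 h2] := fe _ jn.
by rewrite -(flip_e jn) -!flip_comp h1 h2 flip0.
Qed.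

Lemma JW_rot n : rotTL (JW n) = JW n.
Proof.
apply: is_JW_unique; last exact: JWP.
have [f0 ff fe] := JWP n; split.
- by move=> e; apply: f0; rewrite -[JW n]rotTLK e rotTL0.
- by rewrite -rot_comp ff.
move=> j jn; have jn' : ((n - j.+2).+1 < n)%N by lia.
have [h1 h2] := fe _ jn'.
have -> : eTL n j = rotTL (eTL n (n - j.+2)).
  by rewrite rot_e //; congr eTL; lia.
by rewrite -!rot_comp h1 h2 rotTL0.
Qed.

(** When m and n differ, each diagram joins two neighbours on one of its sides, where the idempotent
    kills it. *)
Lemma JW_sandwich0 m n (X : TL m n) : m <> n -> JW n *c X *c JW m = 0.
Proof.
move=> mn; rewrite [X]TL_sum comp_sumr comp_suml big1 // => d _.
rewrite compZr compZl; case: (rectangular_adj d mn) => -[j dj].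
  by rewrite compTLA (kill_bottom (@JW_e m) dj) comp0r scaler0.
by rewrite (kill_top (@JW_e n) dj) comp0l scaler0.
Qed.

Lemma JW_sandwich n (X : TL n n) : JW n *c X *c JW n = (X (id_diagram n) : QA) *: JW n.
Proof. by rewrite (kill_coefr (@JW_e n)) compZl JW_idem. Qed.

Lemma Delta_neq0 n : Delta n != 0.
Proof.
apply/eqP => D0; apply: (@JW_neq0 n); apply: pairing_anisotropic.
by rewrite /pairing JW_flip JW_idem.
Qed.

(** * Trivalent vertices *)

Lemma admissibleP x y z :
  reflect (exists p q r, [/\ x = r + p, y = p + q & z = r + q])%N (admissible x y z).
Proof.
apply: (iffP idP) => [/and4P[h1 h2 h3 h4]|[p [q [r [-> -> ->]]]]].
  have := odd_double_half (x + y + z); rewrite (negbTE h1).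
  exists ((x + y + z)./2 - z)%N, ((x + y + z)./2 - x)%N, ((x + y + z)./2 - y)%N.
  by split; lia.
by rewrite /admissible; apply/and4P; split; lia.
Qed.

Lemma vertexE_dv p q r : vertexE (r + p) (p + q) (r + q) = dv (vertexd p q r).
Proof.
apply: basis_dv => s t; rewrite diagram_ofE.
have -> : ((r + p + (p + q) - (r + q))./2 = p)%N.
  by rewrite (_ : _ - _ = p.*2)%N ?doubleK //; lia.
have -> : ((r + p + (r + q) - (p + q))./2 = r)%N.
  by rewrite (_ : _ - _ = r.*2)%N ?doubleK //; lia.
by [].
Qed.

Lemma vertexd_bottom_adj p q r j : bottom_adj (vertexd p q r) j -> j.+1 = (r + p)%N.
Proof.
move=> h; have jn : (j.+1 < r + p + (p + q))%N by case/andP: h.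
have /eqP := bottom_adj_arc jn h; rewrite diagram_ofE /=; lia.
Qed.

Lemma vertexd_top_adj p q r j : top_adj (vertexd p q r) j = false.
Proof.
apply/negP => h; have jn : (j.+1 < r + q)%N by case/andP: h.
have /eqP := bottom_adj_arc jn h; rewrite diagram_ofE /flip_rel.
by move/eqP => e; have : vertexd p q r (inr (Ordinal (ltnW jn))) == inr (Ordinal jn);
  [apply/eqP|rewrite diagram_ofE].
Qed.

Lemma juxt_bottom_adjl m n m' n' (x : diagram m n) (y : diagram m' n') j :
  bottom_adj x j -> bottom_adj (juxtd x y) j.
Proof.
move=> h; have jm : (j.+1 < m)%N by case/andP: h.
have jn : (j.+1 < m + m')%N by lia.
apply/(bottom_adjP _ jn) => u v; rewrite compat_juxt => /andP[xuv _].
have := (bottom_adjP x jm) h _ _ xuv.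
by rewrite !at_lstate // ltnW.
Qed.

Lemma juxt_bottom_adjr m n m' n' (x : diagram m n) (y : diagram m' n') j :
  bottom_adj y j -> bottom_adj (juxtd x y) (m + j).
Proof.
move=> h; have jm : (j.+1 < m')%N by case/andP: h.
have jn : ((m + j).+1 < m + m')%N by lia.
apply/(bottom_adjP _ jn) => u v; rewrite compat_juxt => /andP[_ yuv].
have := (bottom_adjP y jm) h _ _ yuv.
by rewrite !at_rstate ?addnS // ltnW.
Qed.

Lemma eTL_left x y j : (j.+1 < x)%N -> eTL (x + y) j = eTL x j *t idTL y.
Proof.
move=> jx; have jxy : (j.+1 < x + y)%N by lia.
rewrite (eTLE jx) (eTLE jxy) idTLE tens_dv; congr dv; apply: compat_inj => u v.
rewrite compat_juxt compat_id.
apply/idP/andP => [/compat_e[h1 h2 h3]|[/compat_e[h1 h2 h3] /eqP uv]].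
  split.
    apply/compat_e; rewrite !at_lstate //; try lia.
    by split=> // k kx kj kj1; rewrite !at_lstate // h3 //; lia.
  apply/eqP/eq_at => k ky; rewrite !at_rstate // h3 //; lia.
apply/compat_e; rewrite !at_lstate in h1 h2; try lia.
split=> // k kxy kj kj1; case: (ltnP k x) => kx.
  by rewrite -!(at_lstate _ kx) h3.
have kE : k = (x + (k - x))%N by lia.
have kxl : (k - x < y)%N by lia.
by rewrite kE -!at_rstate // uv.
Qed.

Lemma eTL_right x y j : (j.+1 < y)%N -> eTL (x + y) (x + j) = idTL x *t eTL y j.
Proof.
move=> jy; have jxy : ((x + j).+1 < x + y)%N by lia.
rewrite (eTLE jy) (eTLE jxy) idTLE tens_dv; congr dv; apply: compat_inj => u v.
rewrite compat_juxt compat_id.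
apply/idP/andP => [/compat_e[h1 h2 h3]|[/eqP uv /compat_e[h1 h2 h3]]].
  split.
    apply/eqP/eq_at => k kx; rewrite !at_lstate // h3 //; lia.
  apply/compat_e; rewrite !at_rstate ?addnS //; try lia.
  by split=> // k kx kj kj1; rewrite !at_rstate // h3 //; lia.
apply/compat_e; rewrite !at_rstate ?addnS // in h1 h2; try lia.
split=> // k kxy kj kj1; case: (ltnP k x) => kx.
  by rewrite -!(at_lstate _ kx) uv.
have kE : k = (x + (k - x))%N by lia.
have kxl : (k - x < y)%N by lia.
by rewrite kE -!at_rstate // h3 //; lia.
Qed.

(** A cap that is not astride the gap after the first x points lies inside one tensor factor, whose
    idempotent kills it. *)
Lemma kill_tens x y z (d : diagram (x + y) z) j : bottom_adj d j -> j.+1 <> x ->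
  dv d *c (JW x *t JW y) = 0.
Proof.
move=> dj jx; have jxy : (j.+1 < x + y)%N by case/andP: dj.
have [c ->] := dv_bottom_adj jxy dj; rewrite compZl compTLA.
case: (ltnP j.+1 x) => h.
  by rewrite (eTL_left y h) -tens_comp (JW_e h).1 tens0l comp0r scaler0.
have -> : j = (x + (j - x))%N by lia.
have h' : ((j - x).+1 < y)%N by lia.
by rewrite (eTL_right x h') -tens_comp (JW_e h').1 tens0r comp0r scaler0.
Qed.

Lemma vertex_dv x y z (d : diagram (x + y) z) :
  JW z *c dv d *c (JW x *t JW y) <> 0 -> admissible x y z /\ dv d = vertexE x y z.
Proof.
move=> nz.
have [||p [q [r [ex ey ez dE]]]] := @vertex_classification x y z d.
- move=> j dj; apply/eqP/negPn/negP => /eqP jx; apply: nz.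
  by rewrite compTLA (kill_tens dj jx) comp0r.
- by move=> j; apply/negP => dj; apply: nz; rewrite (kill_top (@JW_e z) dj) comp0l.
split; first by apply/admissibleP; exists p, q, r.
subst x y z; rewrite vertexE_dv; congr dv; exact: diagram_of_unique.
Qed.

Lemma vertex_span x y z (X : TL (x + y) z) : admissible x y z ->
  exists c : QA, JW z *c X *c (JW x *t JW y) = c *: vertex x y z.
Proof.
move=> adm; elim/TL_ind: X => [|a X X' [c cE] [c' c'E]|d].
- by exists 0; rewrite comp0r comp0l scale0r.
- by exists (a * c + c'); rewrite comp_linr comp_linl cE c'E scalerDl scalerA.
have [e|/eqP ne] := eqVneq (JW z *c dv d *c (JW x *t JW y)) 0.
  by exists 0; rewrite e scale0r.
by exists 1; have [_ ->] := vertex_dv ne; rewrite scale1r.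
Qed.

Lemma vertex_not_admissible x y z (X : TL (x + y) z) : ~~ admissible x y z ->
  JW z *c X *c (JW x *t JW y) = 0.
Proof.
move=> adm; elim/TL_ind: X => [|a X X' IH IH'|d].
- by rewrite comp0r comp0l.
- by rewrite comp_linr comp_linl IH IH' scaler0 addr0.
apply/eqP/negPn/negP => /eqP /vertex_dv[h _].
by rewrite h in adm.
Qed.

(** * Leading coefficients and nonvanishing of the vertex *)

Definition coef m n (E : diagram m n) (X : TL m n) : QA := X E.

Lemma coef0 m n (E : diagram m n) : coef E 0 = 0.
Proof. by rewrite /coef ffunE. Qed.

Lemma coef_lin m n (E : diagram m n) (a : QA) X Y :
  coef E (a *: X + Y) = a * coef E X + coef E Y.
Proof. exact: TL_linE. Qed.

Lemma coef_dv m n (E d : diagram m n) : coef E (dv d) = (E == d)%:R.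
Proof. by rewrite /coef ffunE. Qed.

Lemma coefZ m n (E : diagram m n) (a : QA) X : coef E (a *: X) = a * coef E X.
Proof. by rewrite -[X in coef E X]addr0 coef_lin coef0 addr0. Qed.

(** A non-identity diagram stacked on top leaves a cup on the top side, which E does not have; so
    only the identity part of X contributes. *)
Lemma coef_no_top m n (E : diagram m n) (Y : TL m n) (X : TL n n) :
  (forall j, ~~ top_adj E j) -> coef E (X *c Y) = coef (id_diagram n) X * coef E Y.
Proof.
move=> EP; elim/TL_ind: X => [|a X X' IH IH'|x].
- by rewrite comp0l !coef0 mul0r.
- by rewrite comp_linl !coef_lin IH IH' mulrDl mulrA.
rewrite coef_dv eq_sym; have [->|/eqP nx] := eqVneq x (id_diagram n).
  by rewrite -idTLE comp1l mul1r.
rewrite mul0r; elim/TL_ind: Y => [|a Y Y' IH IH'|y]; first by rewrite comp0r coef0.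
  by rewrite comp_linr coef_lin IH IH' mulr0 addr0.
rewrite comp_dv coefZ coef_dv; case: eqP => [e|_]; last by rewrite mulr0.
have [j xj] := not_id_top_adj nx.
by have := EP j; rewrite e compd_top_adj.
Qed.

Lemma trilinear1 (R : comNzRingType) (a x x' y z : R) :
  forall s t, s = x * y * z -> t = x' * y * z -> a * s + t = (a * x + x') * y * z.
Proof. by move=> _ _ -> ->; ring. Qed.

Lemma trilinear2 (R : comNzRingType) (a x y y' z : R) :
  forall s t, s = x * y * z -> t = x * y' * z -> a * s + t = x * (a * y + y') * z.
Proof. by move=> _ _ -> ->; ring. Qed.

(** A non-identity diagram in either tensor factor leaves a cap strictly inside that factor, while E
    has caps only across the gap at x. *)
Lemma coef_no_bottom x y z (E : diagram (x + y) z) (Y : TL (x + y) z)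
    (X : TL x x) (X' : TL y y) :
  (forall j, bottom_adj E j -> j.+1 = x) ->
  coef E (Y *c (X *t X')) = coef (id_diagram x) X * coef (id_diagram y) X' * coef E Y.
Proof.
move=> EP; elim/TL_ind: X => [|a X1 X2 IH IH'|d].
- by rewrite tens0l comp0r !coef0 !mul0r.
- by rewrite tens_linl comp_linr !coef_lin; exact: (trilinear1 _ IH IH').
elim/TL_ind: X' => [|a X1 X2 IH IH'|d'].
- by rewrite tens0r comp0r !coef0 mulr0 mul0r.
- by rewrite tens_linr comp_linr !coef_lin; exact: (trilinear2 _ IH IH').
rewrite tens_dv !coef_dv ![id_diagram _ == _]eq_sym.
have killed j : bottom_adj (juxtd d d') j -> j.+1 <> x -> coef E (Y *c dv (juxtd d d')) = 0.
  move=> dj jx; elim/TL_ind: Y => [|a Y1 Y2 IH IH'|w]; first by rewrite comp0l coef0.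
    by rewrite comp_linl coef_lin IH IH' mulr0 addr0.
  rewrite comp_dv coefZ coef_dv; case: eqP => [e|_]; last by rewrite mulr0.
  by case: jx; apply: EP; rewrite e compd_bottom_adj.
have [ed|/eqP nd] := eqVneq d (id_diagram x); last first.
  have [j dj] := not_id_bottom_adj nd; rewrite !mul0r.
  apply: (killed j); first exact: juxt_bottom_adjl.
  by case/andP: dj; lia.
have [ed'|/eqP nd] := eqVneq d' (id_diagram y); last first.
  have [j dj] := not_id_bottom_adj nd; rewrite mulr0 mul0r.
  apply: (killed (x + j)%N); first exact: juxt_bottom_adjr.
  by lia.
by rewrite ed ed' -tens_dv -!idTLE tens_id comp1r !mul1r.
Qed.

(** Its underlying diagram occurs with coefficient 1, because the identity occurs with coefficient 1
    in each of the three idempotents. *)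
Lemma vertex_neq0 x y z : admissible x y z -> vertex x y z <> 0.
Proof.
case/admissibleP=> p [q [r [-> -> ->]]] V0.
have : coef (vertexd p q r) (vertex (r + p) (p + q) (r + q)) = 1.
  rewrite /vertex coef_no_bottom; last exact: vertexd_bottom_adj.
  rewrite coef_no_top; last by move=> j; rewrite vertexd_top_adj.
  by rewrite ![coef (id_diagram _) _]JW_id !mul1r vertexE_dv coef_dv eqxx.
by rewrite V0 coef0 => /eqP; rewrite eq_sym oner_eq0.
Qed.

Lemma theta_neq0 x y z : admissible x y z -> theta x y z != 0.
Proof.
move=> adm; apply/eqP => t0; apply: (vertex_neq0 adm).
exact: pairing_anisotropic.
Qed.

Lemma JW_vertex x y z : JW z *c vertex x y z = vertex x y z.
Proof. by rewrite /vertex -!compTLA JW_idem. Qed.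

Lemma vertex_JW x y z : vertex x y z *c (JW x *t JW y) = vertex x y z.
Proof. by rewrite /vertex [LHS]compTLA -tens_comp !JW_idem. Qed.

Lemma flip_vertex_JW x y z : flipTL (vertex x y z) *c JW z = flipTL (vertex x y z).
Proof. by rewrite -{1}(JW_flip z) -flip_comp JW_vertex. Qed.

(** Anything between two copies of f_z is a multiple of f_z; taking traces determines the scalar. *)
Lemma vertex_flip x y z :
  vertex x y z *c flipTL (vertex x y z) = (theta x y z / Delta z) *: JW z.
Proof.
have [c e] : exists c : QA, vertex x y z *c flipTL (vertex x y z) = c *: JW z.
  exists (coef (id_diagram z) (vertex x y z *c flipTL (vertex x y z))).
  rewrite -JW_sandwich [RHS]compTLA [X in _ = _ *c X]compTLA flip_vertex_JW.
  by rewrite -[RHS]compTLA JW_vertex.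
have -> : theta x y z = c * Delta z by rewrite /theta e trZ.
by rewrite mulfK ?Delta_neq0.
Qed.

Lemma vertex_flip0 x y z z' : z <> z' ->
  vertex x y z *c flipTL (vertex x y z') = 0.
Proof.
move=> zz'.
have -> : vertex x y z *c flipTL (vertex x y z') =
    JW z *c (vertex x y z *c flipTL (vertex x y z')) *c JW z'.
  by rewrite -(compTLA (JW z)) JW_vertex [RHS]compTLA flip_vertex_JW.
by apply: JW_sandwich0 => e; apply: zz'.
Qed.

(** * Rotation symmetry of theta *)

(* [X] is a multiple of one diagram by a power of delta, and [F] counts the states
   of the picture it came from, closed loops included. *)
Definition weighs m n (X : TL m n) (F : state m -> state n -> nat) :=
  exists l d, X = delta ^+ l *: dv d /\ forall u v, (2 ^ l * compat d u v = F u v)%N.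

Lemma weighs_dv m n (d : diagram m n) : weighs (dv d) (fun u v => compat d u v).
Proof. by exists 0%N, d; rewrite scale1r; split=> // u v; rewrite mul1n. Qed.

Lemma weighs_comp m n p (X : TL n p) (Y : TL m n) F G : weighs X F -> weighs Y G ->
  weighs (X *c Y) (fun u w => \sum_v G u v * F v w)%N.
Proof.
move=> [l [x [-> lF]]] [k [y [-> kG]]].
exists (l + k + stack_loops x y)%N, (compd x y); split.
  by rewrite compZl compZr comp_dv !scalerA -!exprD.
move=> u w; rewrite !expnD -mulnA card_comp_mul big_distrr /=.
by apply: eq_bigr => v _; rewrite -lF -kG; ring.
Qed.

Lemma weighs_tr n (X : TL n n) F : weighs X F ->
  exists l, trTL X = delta ^+ l /\ (2 ^ l = \sum_u F u u)%N.
Proof.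
move=> [l [x [-> lF]]]; exists (l + trd x)%N; rewrite trZ tr_dv exprD; split=> //.
rewrite expnD trd_sum big_distrr /=; apply: eq_bigr => u _; exact: lF.
Qed.

(** The theta network with arbitrary boxes on its three edges. It is trilinear in the boxes, so
    identities about it can be checked on diagrams. *)
Definition theta_net x y z (E : diagram (x + y) z) (X : TL x x) (Y : TL y y)
    (Z : TL z z) : QA :=
  trTL (Z *c dv E *c (X *t Y) *c dv (flipd E)).

(** In V V^* each idempotent occurs twice; idempotence and cyclicity of the trace merge the two
    copies. *)
Lemma theta_net_JW x y z (E : diagram (x + y) z) : vertexE x y z = dv E ->
  theta x y z = theta_net E (JW x) (JW y) (JW z).
Proof.
move=> EE; rewrite /theta /theta_net.
set V := vertex x y z; set F := JW x *t JW y.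
have flV : flipTL V = F *c (dv (flipd E) *c JW z).
  by rewrite /V /vertex EE flip_comp flip_tens !JW_flip flip_comp JW_flip flip_dv.
have VE : V = JW z *c dv E *c F by rewrite /V /vertex EE.
have VF : V *c F = V by apply: vertex_JW.
have JV : JW z *c V = V by apply: JW_vertex.
rewrite flV; clearbody V.
rewrite -(compTLA V F) VF -(compTLA V (dv _)) [LHS]trC -(compTLA (JW z) V) JV.
by rewrite VE.
Qed.

Section ThetaNetLinear.
Variables (x y z : nat) (E : diagram (x + y) z).
Implicit Types (X : TL x x) (Y : TL y y) (Z : TL z z).

Lemma theta_net_lin1 (a : QA) X X' Y Z :
  theta_net E (a *: X + X') Y Z = a * theta_net E X Y Z + theta_net E X' Y Z.
Proof. by rewrite /theta_net tens_linl comp_linr comp_linl tr_lin. Qed.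

Lemma theta_net_lin2 (a : QA) X Y Y' Z :
  theta_net E X (a *: Y + Y') Z = a * theta_net E X Y Z + theta_net E X Y' Z.
Proof. by rewrite /theta_net tens_linr comp_linr comp_linl tr_lin. Qed.

Lemma theta_net_lin3 (a : QA) X Y Z Z' :
  theta_net E X Y (a *: Z + Z') = a * theta_net E X Y Z + theta_net E X Y Z'.
Proof. by rewrite /theta_net !comp_linl tr_lin. Qed.

Lemma theta_net0 X Y Z :
  [/\ theta_net E 0 Y Z = 0, theta_net E X 0 Z = 0 & theta_net E X Y 0 = 0].
Proof. by rewrite /theta_net tens0l tens0r !comp0l comp0r comp0l tr0. Qed.
End ThetaNetLinear.

(** The state sum of a theta network: s labels the legs at the reflected vertex and t those at the
    vertex. The boxes on x and y are read from s to t, the one on z from t back to s. *)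
Definition network x y z (T : state x -> state y -> state z -> bool)
    (D1 : state x -> state x -> bool) (D2 : state y -> state y -> bool)
    (D3 : state z -> state z -> bool) : nat :=
  (\sum_(s : state x * state y * state z) \sum_(t : state x * state y * state z)
    T s.1.1 s.1.2 s.2 * T t.1.1 t.1.2 t.2 *
    (D1 s.1.1 t.1.1 * D2 s.1.2 t.1.2 * D3 t.2 s.2))%N.

Lemma theta_net_dv x y z (E : diagram (x + y) z) d1 d2 d3 : exists l,
  theta_net E (dv d1) (dv d2) (dv d3) = delta ^+ l /\
  (2 ^ l = network (fun s1 s2 u => compat E (join_state s1 s2) u)
     (compat d1) (compat d2) (compat d3))%N.
Proof.
have := weighs_comp (weighs_comp (weighs_comp (weighs_dv d3) (weighs_dv E))
  (weighs_dv (juxtd d1 d2))) (weighs_dv (flipd E)).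
rewrite -tens_dv => /weighs_tr[l [tE lE]]; exists l; split=> //.
rewrite lE exchange_big sum_join /network.
rewrite -(pair_bigA _ (fun s12 u => \sum_t compat E (join_state s12.1 s12.2) u *
  compat E (join_state t.1.1 t.1.2) t.2 *
  (compat d1 s12.1 t.1.1 * compat d2 s12.2 t.1.2 * compat d3 t.2 u)))%N /=.
rewrite -(pair_bigA _ (fun s1 s2 => \sum_u \sum_t compat E (join_state s1 s2) u *
  compat E (join_state t.1.1 t.1.2) t.2 *
  (compat d1 s1 t.1.1 * compat d2 s2 t.1.2 * compat d3 t.2 u)))%N /=.
apply: eq_bigr => s1 _; apply: eq_bigr => s2 _; apply: eq_bigr => u _.
rewrite -(pair_bigA _ (fun t12 v => compat E (join_state s1 s2) u *
  compat E (join_state t12.1 t12.2) v *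
  (compat d1 s1 t12.1 * compat d2 s2 t12.2 * compat d3 v u)))%N /=.
rewrite -(pair_bigA _ (fun t1 t2 => \sum_v compat E (join_state s1 s2) u *
  compat E (join_state t1 t2) v *
  (compat d1 s1 t1 * compat d2 s2 t2 * compat d3 v u)))%N /=.
rewrite sum_join big_distrr; apply: eq_bigr => t1 _.
rewrite big_distrr; apply: eq_bigr => t2 _.
rewrite !big_distrr; apply: eq_bigr => v _ /=.
rewrite compat_flip compat_juxt !lstate_join !rstate_join -!mulnb.
by ring.
Qed.

(** Passing from (x, y, z) to (y, z, x) moves leg x to the top and leg z to the bottom. Their states
    are reversed and their boxes make a half turn, while leg y stays at the bottom. *)
Lemma network_rotate x y z T T' D1 D2 D3 D1' D3' :
  (forall s1 s2 u, T' s2 (rev_state u) (rev_state s1) = T s1 s2 u) ->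
  (forall u v, D1' u v = D1 (rev_state v) (rev_state u)) ->
  (forall u v, D3' u v = D3 (rev_state v) (rev_state u)) ->
  @network x y z T D1 D2 D3 = @network y z x T' D2 D3' D1'.
Proof.
move=> TT' D1E D3E.
pose h (s : state x * state y * state z) := (s.1.2, rev_state s.2, rev_state s.1.1).
pose g (s : state y * state z * state x) := (rev_state s.2, s.1.1, rev_state s.1.2).
have hK : cancel h g by case=> [[a b] c]; rewrite /h /g /= !rev_stateK.
have gK : cancel g h by case=> [[a b] c]; rewrite /h /g /= !rev_stateK.
rewrite /network [RHS](reindex h) /=; last by exists g => s _.
apply: eq_bigr => s _; rewrite [RHS](reindex h) /=; last by exists g => t _.
apply: eq_bigr => t _; rewrite !TT' D1E D3E !rev_stateK.
by ring.
Qed.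

(** Equations on x, y, z, in place of literal sums, let this apply to both (x, y, z) and (y, z,
    x). *)
Lemma vertex_at x y z p q r : x = (r + p)%N -> y = (p + q)%N -> z = (r + q)%N ->
  exists E : diagram (x + y) z, vertexE x y z = dv E /\
    forall s1 s2 u, compat E (join_state s1 s2) u <->
      [/\ forall k, (k < r)%N -> at_ u k = at_ s1 k,
          forall k, (k < q)%N -> at_ u (r + k) = at_ s2 (p + k)
        & forall k, (k < p)%N -> at_ s1 (r + k) = at_ s2 (p - k.+1)].
Proof.
move=> -> -> ->; exists (vertexd p q r); rewrite vertexE_dv; split=> // s1 s2 u.
set s := join_state s1 s2.
have e1 k : (k < r + p)%N -> at_ s k = at_ s1 k.
  by move=> h; rewrite -(at_lstate s h) lstate_join.
have e2 k : (k < p + q)%N -> at_ s (r + p + k) = at_ s2 k.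
  by move=> h; rewrite -(at_rstate s h) rstate_join.
have e3 k : (k < q)%N -> at_ s (r + p + p + k) = at_ s2 (p + k).
  by move=> h; rewrite -e2; [congr at_; lia|lia].
have e4 k : (k < p)%N -> at_ s (r + p + p - k.+1) = at_ s2 (p - k.+1).
  by move=> h; rewrite -e2; [congr at_; lia|lia].
have e5 k : (k < p)%N -> at_ s (r + k) = at_ s1 (r + k) by move=> h; apply: e1; lia.
have e6 k : (k < r)%N -> at_ s k = at_ s1 k by move=> h; apply: e1; lia.
rewrite compat_vertex; split=> -[h1 h2 h3]; split=> k kn.
- by rewrite -e6 // h1.
- by rewrite -e3 // h2.
- by rewrite -e5 // -e4 // h3.
- by rewrite e6 // h1.
- by rewrite e3 // h2.
by rewrite e5 // e4 // h3.
Qed.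

Lemma theta_rotate x y z : admissible x y z -> theta x y z = theta y z x.
Proof.
case/admissibleP=> p [q [r [ex ey ez]]].
have [E [EE EP]] := vertex_at ex ey ez.
have [|||E' [EE' EP']] := @vertex_at y z x q r p; try lia.
(* With the half turns made explicit the identity holds for arbitrary boxes, so the idempotents can
   be generalised and replaced by diagrams. *)
rewrite (theta_net_JW EE) (theta_net_JW EE') -[in RHS](JW_rot x) -[in RHS](JW_rot z).
move: (JW x) (JW y) (JW z) => X Y Z.
elim/TL_ind: X => [|a X X' IH IH'|d1].
- rewrite rotTL0; have [-> _ _] := theta_net0 E 0 Y Z.
  by have [_ _ ->] := theta_net0 E' Y (rotTL Z) 0.
- by rewrite rot_lin theta_net_lin1 theta_net_lin3 IH IH'.
elim/TL_ind: Y => [|a Y Y' IH IH'|d2].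
- have [_ -> _] := theta_net0 E (dv d1) 0 Z.
  by have [-> _ _] := theta_net0 E' 0 (rotTL Z) (rotTL (dv d1)).
- by rewrite theta_net_lin2 theta_net_lin1 IH IH'.
elim/TL_ind: Z => [|a Z Z' IH IH'|d3].
- rewrite rotTL0; have [_ _ ->] := theta_net0 E (dv d1) (dv d2) 0.
  by have [_ -> _] := theta_net0 E' (dv d2) 0 (rotTL (dv d1)).
- by rewrite rot_lin theta_net_lin3 theta_net_lin2 IH IH'.
rewrite !rot_dv.
have [l [-> lE]] := theta_net_dv E d1 d2 d3.
have [l' [-> l'E]] := theta_net_dv E' d2 (rotd d3) (rotd d1).
congr (_ ^+ _); apply: expn2_inj; rewrite lE l'E.
apply: network_rotate => [s1 s2 u|u v|u v]; try exact: compat_rot.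
have r1 k : (k < p)%N -> at_ (rev_state s1) k = at_ s1 (r + (p - k.+1)).
  by move=> kp; rewrite at_rev; [congr at_; lia|lia].
have r2 k : (k < r)%N -> at_ (rev_state s1) (p + k) = at_ s1 (r - k.+1).
  by move=> kp; rewrite at_rev; [congr at_; lia|lia].
have r3 k : (k < r)%N -> at_ (rev_state u) (q + k) = at_ u (r - k.+1).
  by move=> kp; rewrite at_rev; [congr at_; lia|lia].
have r4 k : (k < q)%N -> at_ (rev_state u) (q - k.+1) = at_ u (r + k).
  by move=> kp; rewrite at_rev; [congr at_; lia|lia].
have revk n k : (k < n)%N -> (n - (n - k.+1).+1 = k)%N by lia.
have lt n k : (k < n)%N -> (n - k.+1 < n)%N by lia.
apply/idP/idP => [/EP'[h1 h2 h3]|/EP[h1 h2 h3]].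
  apply/EP; split=> k kn.
  - by rewrite -{1}(revk r k kn) -r3 ?lt // -h2 ?lt // r2 ?lt // revk.
  - by rewrite h3 // r4.
  by rewrite -h1 ?lt // r1 ?lt // revk.
apply/EP'; split=> k kn.
- by rewrite r1 // h3 ?lt // revk.
- by rewrite r2 // r3 // h1 // lt.
by rewrite r4 // h2.
Qed.

(** * Fusion and the elements v_s *)

Opaque delta JW Delta vertex theta.

(** A single cap is a vertex with p = 1, so [compat_vertex] describes its states. *)
Definition capd j b : diagram (j + 1 + (1 + b)) (j + b) := vertexd 1 b j.

Lemma e_factor j b (jn : (j.+1 < j + 1 + (1 + b))%N) :
  compd (flipd (capd j b)) (capd j b) = e_diagram jn.
Proof.
apply: compat_inj => u v; rewrite compat_comp; apply/existsP/idP.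
  case=> w /andP[/compat_vertex[h1 h2 h3]].
  rewrite compat_flip => /compat_vertex[h1' h2' h3'].
  apply/compat_e; split.
  - have := h3 0%N; rewrite addn0 => -> //; congr at_; lia.
  - have := h3' 0%N; rewrite addn0 => -> //; congr at_; lia.
  move=> k kn kj kj1; case: (ltnP k j) => kj2; first by rewrite -h1 // h1'.
  have -> : k = (j + 1 + 1 + (k - j.+2))%N by lia.
  by rewrite -h2 ?h2' //; lia.
case/compat_e=> h1 h2 h3.
pose s a := if (a < j)%N then at_ u a else at_ u a.+2.
exists [ffun a : 'I_(j + b) => s a]; rewrite compat_flip.
have sE k : (k < j + b)%N -> at_ [ffun a : 'I_(j + b) => s a] k = s k by apply: at_ffun.
apply/andP; split; apply/compat_vertex; split=> k kn.
- by rewrite sE /s ?kn //; lia.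
- rewrite sE /s; last by lia.
  by case: ifP; [lia | move=> _; congr at_; lia].
- have -> : k = 0%N by lia.
  by rewrite addn0 h1; congr at_; lia.
- by rewrite sE /s ?kn ?h3 //; lia.
- rewrite sE /s; last by lia.
  case: ifP; first by lia.
  by move=> _; rewrite h3; try lia; congr at_; lia.
have -> : k = 0%N by lia.
by rewrite addn0 h2; congr at_; lia.
Qed.

Lemma eTL_factor n j : (j.+1 < n)%N ->
  exists (m : nat) (C : TL n m) (C' : TL m n), (m < n)%N /\ eTL n j = C' *c C.
Proof.
move=> jn; have e : n = (j + 1 + (1 + (n - j.+2)))%N by lia.
move: (n - j.+2)%N e => b e; subst n.
exists (j + b)%N, (dv (capd j b)),
  (delta ^- stack_loops (flipd (capd j b)) (capd j b) *: dv (flipd (capd j b))).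
split; first by lia.
rewrite compZl comp_dv scalerA mulVf ?scale1r ?expf_neq0 ?delta_neq0 //.
by rewrite e_factor (eTLE jn).
Qed.

Lemma JW_faithful m n (Y : TL m n) :
  (forall z (X : TL n z), JW z *c X *c Y = 0) -> Y = 0.
Proof.
(* Generalising from the identity to all X permits induction on the number z of top points. *)
move=> H; suff XY z (X : TL n z) : X *c Y = 0 by rewrite -[Y]comp1l XY.
have [b] := ubnP z; elim: b z X => // b IH z X zb.
(* [JW z] is the identity up to diagrams with a cap, and those factor through
   fewer than z points. *)
have e : JW z *c (X *c Y) = X *c Y.
  rewrite {1}[JW z]TL_sum comp_suml (bigD1 (id_diagram z)) //= big1.
    by rewrite compZl JW_id scale1r -idTLE comp1l addr0.
  move=> d /eqP /not_id_bottom_adj[j dj]; rewrite compZl.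
  have jz : (j.+1 < z)%N by case/andP: dj.
  have [c ->] := dv_bottom_adj jz dj.
  have [z' [C [C' [zz' ->]]]] := eTL_factor jz.
  have CXY : C *c (X *c Y) = 0 by rewrite -(compTLA C X Y); apply: IH; lia.
  by rewrite compZl (compTLA (dv d)) (compTLA C') CXY !comp0r !scaler0.
by rewrite -e -(compTLA (JW z) X) H.
Qed.

Lemma admissible_xzy x y z : admissible x y z -> admissible x z y.
Proof. by rewrite /admissible; case/and4P=> *; apply/and4P; split; lia. Qed.

Lemma admissible_yzx x y z : admissible x y z -> admissible y z x.
Proof. by rewrite /admissible; case/and4P=> *; apply/and4P; split; lia. Qed.

(** By [JW_faithful] it is enough that f_z X (F - S) = 0. Since F - S = F (F - S) and f_z X F is a
    multiple of V, this reduces to V S = V = V F, where only the term with the same z survives in V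
    S. *)
Lemma fusion x y : JW x *t JW y =
  \sum_(z < (x + y).+1 | admissible x y z)
    (theta x y z / Delta z)^-1 *: (flipTL (vertex x y z) *c vertex x y z).
Proof.
apply/eqP; rewrite -subr_eq0; apply/eqP.
set F := JW x *t JW y; set S := \sum_(z < _ | _) _.
have FF : F *c F = F by rewrite -tens_comp !JW_idem.
have Fflip : flipTL F = F by rewrite flip_tens !JW_flip.
have FV z : F *c flipTL (vertex x y z) = flipTL (vertex x y z).
  by rewrite -{1}Fflip -flip_comp vertex_JW.
have FS : F *c S = S.
  rewrite comp_sumr; apply: eq_bigr => z _.
  by rewrite compZr -(compTLA F) FV.
have VS z : admissible x y z -> vertex x y z *c S = vertex x y z.
  move=> adm; have zxy : (z < (x + y).+1)%N by case/and4P: adm; lia.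
  rewrite comp_sumr (bigD1 (Ordinal zxy)) //= big1 => [|w /andP[_ wz]].
    rewrite compZr -(compTLA (vertex x y z)) vertex_flip compZl JW_vertex scalerA.
    by rewrite mulVf ?scale1r ?addr0 // mulf_neq0 ?invr_neq0 ?Delta_neq0 ?theta_neq0.
  rewrite compZr -(compTLA (vertex x y z)) vertex_flip0 ?comp0l ?scaler0 // => e.
  by case/eqP: wz; apply: val_inj.
apply: JW_faithful => z X.
have -> : F - S = F *c (F - S) by rewrite compBr FF FS.
rewrite -(compTLA _ F); have [adm|nadm] := boolP (admissible x y z).
  have [c ->] := vertex_span X adm.
  by rewrite compZl compBr VS // vertex_JW subrr scaler0.
by rewrite vertex_not_admissible // comp0l.
Qed.

Lemma tens_id0 n (X : TL n n) : idTL 0 *t X = X.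
Proof.
elim/TL_ind: X => [|a X X' IH IH'|d]; first exact: tens0r.
  by rewrite tens_linr IH IH'.
rewrite idTLE tens_dv; congr dv; apply: compat_inj => u v.
have rE (w : state n) : rstate (m := 0) w = w.
  by apply/ffunP => a; rewrite ffunE; congr (w _); apply: val_inj.
rewrite compat_juxt compat_id !rE.
suff -> : lstate (m := 0) u == lstate (m := 0) v by [].
by apply/eqP/ffunP; case.
Qed.

(** * The elements v_s and the resolution of F *)

Section Sequences.
Variable i : nat.

Lemma JW_v k z (s : aseq i k z) : JW z *c vTL s = vTL s.
Proof.
case: s => [|{}k x {}z s a] /=; first exact: JW_idem.
by rewrite -(compTLA (JW z)) JW_vertex.
Qed.

Lemma v_JWpow k z (s : aseq i k z) : vTL s *c JWpow k i = vTL s.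
Proof.
elim: s => [|{}k x {}z s IH a] /=; first by rewrite tens_id0; exact: JW_idem.
rewrite (compTLA (vertex x i z)) -tens_comp IH comp1l -{1}vertex_JW.
rewrite (compTLA (vertex x i z)) -tens_comp JW_v JW_idem -{2}vertex_JW.
by rewrite (compTLA (vertex x i z)) -tens_comp JW_v comp1r.
Qed.

Lemma vertex_JWl x z : vertex x i z *c (JW x *t idTL i) = vertex x i z.
Proof.
by rewrite -{1}vertex_JW (compTLA (vertex x i z)) -tens_comp JW_idem comp1r vertex_JW.
Qed.

(** Puts the theta factor of [eta] in the cyclic order in which [vertex_flip] produces it. *)
Lemma eta_rcons k x z (s : aseq i k x) (a : admissible x z i) :
  eta (aseq_rcons s a) = eta s * (theta x i z / Delta z).
Proof.
rewrite /=; congr (_ * (_ / _)); apply: theta_rotate.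
by do 2 apply: admissible_yzx; apply: admissible_xzy.
Qed.

Lemma eta_neq0 k z (s : aseq i k z) : eta s != 0.
Proof.
elim: s => [|{}k x {}z s IH a]; first by rewrite [eta _]/= oner_neq0.
rewrite eta_rcons; apply: mulf_neq0; first exact: IH.
apply: mulf_neq0; last by rewrite invr_neq0 ?Delta_neq0.
by apply: theta_neq0; apply: admissible_xzy.
Qed.

Lemma v_flip k z (s : aseq i k z) : vTL s *c flipTL (vTL s) = eta s *: JW z.
Proof.
elim: s => [|{}k x {}z s IH a]; first by rewrite /= JW_flip JW_idem scale1r.
rewrite eta_rcons [vTL _]/= flip_comp flip_tens flip_id.
set V := vertex x i z; rewrite (compTLA V) -(compTLA (vTL s *t _)) -tens_comp IH comp1l.
by rewrite tensZl compZl compZr -(compTLA V) vertex_JWl vertex_flip scalerA.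
Qed.

(** The weight is part of the type of a sequence, so sequences of varying weight are packed with it;
    a list of them stands in for a finite index type. *)
Definition G_sum k (Y : TL (width k i) (width k i)) : Prop :=
  exists L : seq {z & aseq i k z}, Y = \sum_(p <- L) GTL (tagged p) (tagged p).

Lemma G_sum_big k I (r : seq I) (P : pred I) (F : I -> TL (width k i) (width k i)) :
  (forall j, P j -> G_sum (F j)) -> G_sum (\sum_(j <- r | P j) F j).
Proof.
move=> H; elim: r => [|j r [L LE]]; first by exists [::]; rewrite !big_nil.
rewrite big_cons; case: ifP => [Pj|_]; last by exists L.
have [L' L'E] := H j Pj; exists (L' ++ L).
by rewrite big_cat -L'E -LE.
Qed.

Lemma G_completeness k : (0 < k)%N -> G_sum (JWpow k i).
Proof.
case: k => // k _; elim: k => [|k [L LE]].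
  exists [:: Tagged (fun z => aseq i 1 z) (aseq_one i)].
  by rewrite big_seq1 /GTL /= invr1 scale1r tens_id0 JW_flip JW_idem.
rewrite [JWpow _ _]/= -/(JWpow k.+1 i) LE tens_suml; apply: G_sum_big => -[x s] _ /=.
(* The factor f_x (x) f_i is exposed between the two copies of v_s so that fusion can split it; each
   resulting term is the G of an extension of s. *)
have -> : GTL s s *t JW i =
  (eta s)^-1 *: (flipTL (vTL s) *t idTL i *c (JW x *t JW i) *c (vTL s *t idTL i)).
  rewrite /GTL tensZl; congr (_ *: _).
  rewrite -(tens_comp (flipTL (vTL s)) (JW x) (idTL i) (JW i)) comp1l.
  rewrite -(tens_comp _ (vTL s) (JW i) (idTL i)) comp1r.
  by rewrite (compTLA (flipTL _)) JW_v.
set A := _ *t idTL i; set B := _ *t idTL i.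
rewrite fusion [A *c _]comp_sumr [_ *c B]comp_suml scaler_sumr.
apply: G_sum_big => z adm.
have a : admissible x z i by apply: admissible_xzy.
exists [:: Tagged (fun z => aseq i k.+2 z) (aseq_rcons s a)].
rewrite big_seq1 -[GTL _ _]/(GTL (aseq_rcons s a) (aseq_rcons s a)).
rewrite /GTL eta_rcons compZr compZl scalerA; congr (_ *: _).
  by rewrite [RHS]invfM.
have -> : vTL (aseq_rcons s a) = vertex x i z *c B by [].
rewrite (flip_comp (vertex x i z) B) /B (flip_tens (vTL s)) flip_id -/A -/B.
by rewrite -(compTLA A (flipTL (vertex x i z))) (compTLA _ (vertex x i z)).
Qed.
End Sequences.

From mathcomp Require Import functions.

(** * Matrix units and modules *)

Local Open Scope classical_set_scope.

Lemma subspace0 (W : lmodType QA) (P : set W) : is_subspace P -> P 0.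
Proof. by case. Qed.

Lemma subspaceD (W : lmodType QA) (P : set W) u v : is_subspace P -> P u -> P v -> P (u + v).
Proof. by case=> _ H Pu Pv; rewrite -[u]scale1r; apply: H. Qed.

Lemma subspaceZ (W : lmodType QA) (P : set W) a u : is_subspace P -> P u -> P (a *: u).
Proof. by case=> P0 H Pu; rewrite -[_ *: _]addr0; apply: H. Qed.

Lemma subspace_sum (W : lmodType QA) (P : set W) I (r : seq I) (F : I -> W) :
  is_subspace P -> (forall j, P (F j)) -> P (\sum_(j <- r) F j).
Proof.
move=> PS PF; elim: r => [|j r IH]; first by rewrite big_nil; apply: subspace0.
by rewrite big_cons; apply: subspaceD.
Qed.

Lemma lin_span_subspace (W : lmodType QA) (S : set W) : is_subspace (lin_span S).
Proof.
split; first by exists 0%N, (fun=> 0), (fun=> 0); split=> [[]//|]; rewrite big_ord0.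
move=> a u v [n [c [x [xS ->]]]] [n' [c' [x' [x'S ->]]]].
exists (n + n')%N,
  (fun j => match fintype.split j with inl l => a * c l | inr l => c' l end),
  (fun j => match fintype.split j with inl l => x l | inr l => x' l end).
split=> [j|]; first by case: (fintype.split j).
rewrite big_split_ord /= scaler_sumr; congr (_ + _); apply: eq_bigr => j _.
  by rewrite (unsplitK (inl j)) scalerA.
by rewrite (unsplitK (inr j)).
Qed.

Lemma lin_span_sub (W : lmodType QA) (S : set W) w : S w -> lin_span S w.
Proof.
move=> Sw; exists 1%N, (fun=> 1), (fun=> w); split=> //.
by rewrite big_ord1 scale1r.
Qed.

Lemma lin_span_min (W : lmodType QA) (S P : set W) :
  is_subspace P -> S `<=` P -> lin_span S `<=` P.
Proof.
move=> PS SP w [n [c [u [uS ->]]]]; apply: subspace_sum => // j.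
by apply: subspaceZ => //; apply: SP.
Qed.

(** * The colored algebra and its matrix units *)

Section ColoredAlgebra.
Variables k i : nat.
Local Notation N := (width k i).
Local Notation F := (JWpow k i).

Lemma JWpow_idem : F *c F = F.
Proof.
elim: k => [|k' IH] /=; first exact: comp1l.
by rewrite -tens_comp IH JW_idem.
Qed.

Lemma colTL_unit X : colTL k i X -> F *c X = X /\ X *c F = X.
Proof.
case=> Y _ <-; split; last by rewrite (compTLA _ F F) JWpow_idem.
by rewrite (compTLA F Y F) -(compTLA F F) JWpow_idem.
Qed.

Lemma colTL_intro X : F *c X = X -> X *c F = X -> colTL k i X.
Proof. by move=> FX XF; exists X; [|rewrite FX XF]. Qed.

Lemma colTL_subspace : is_subspace (colTL k i).
Proof.
split; first by apply: colTL_intro; rewrite ?comp0r ?comp0l.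
move=> a X Y /colTL_unit[FX XF] /colTL_unit[FY YF].
by apply: colTL_intro; rewrite ?comp_linr ?comp_linl ?FX ?XF ?FY ?YF.
Qed.

Lemma colTL_comp X Y : colTL k i X -> colTL k i Y -> colTL k i (X *c Y).
Proof.
move=> /colTL_unit[FX _] /colTL_unit[_ YF]; apply: colTL_intro.
  by rewrite -(compTLA F X) FX.
by rewrite (compTLA X Y) YF.
Qed.

Lemma JWpow_flip : flipTL F = F.
Proof.
elim: k => [|k' IH] /=; first exact: flip_id.
by rewrite flip_tens IH JW_flip.
Qed.

Lemma G_col lam (s t : aseq i k lam) : colTL k i (GTL s t).
Proof.
apply: colTL_intro; rewrite /GTL ?compZl ?compZr; congr (_ *: _).
  by rewrite -(compTLA F) -{1}JWpow_flip -flip_comp v_JWpow.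
by rewrite (compTLA (flipTL _)) v_JWpow.
Qed.

Lemma v_sandwich lam (t u : aseq i k lam) X : exists c : QA,
  vTL t *c X *c flipTL (vTL u) = c *: JW lam.
Proof.
exists (coef (id_diagram lam) (vTL t *c X *c flipTL (vTL u))).
rewrite -JW_sandwich; set Y := flipTL (vTL u).
have YJ : Y *c JW lam = Y by rewrite -{1}(JW_flip lam) -flip_comp JW_v.
rewrite (compTLA (JW lam)) (compTLA _ Y) YJ -(compTLA (JW lam)).
by rewrite -(compTLA (JW lam)) JW_v.
Qed.

Lemma v_sandwich0 lam mu (t : aseq i k lam) (u : aseq i k mu) X : lam <> mu ->
  vTL t *c X *c flipTL (vTL u) = 0.
Proof.
move=> lm; set Y := flipTL (vTL u).
have YJ : Y *c JW mu = Y by rewrite -{1}(JW_flip mu) -flip_comp JW_v.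
rewrite -(JW_v t) -YJ (compTLA (JW lam)) -(compTLA _ Y) (compTLA (JW lam)).
by apply: JW_sandwich0 => e; apply: lm.
Qed.

Lemma G_mul lam (s t u : aseq i k lam) : GTL s t *c GTL t u = GTL s u.
Proof.
rewrite /GTL compZl compZr scalerA (compTLA (flipTL _)).
rewrite -(compTLA (vTL t)) v_flip compZl compZr JW_v scalerA.
by rewrite -mulrA (mulVf (eta_neq0 t)) mulr1.
Qed.

Lemma G_sandwich lam (s t u w : aseq i k lam) X : exists c : QA,
  GTL s t *c X *c GTL u w = c *: GTL s w.
Proof.
have [c cE] := v_sandwich t u X; exists ((eta u)^-1 * c).
rewrite /GTL !compZl compZr; set V := flipTL (vTL s).
rewrite (compTLA V) (compTLA V) -(compTLA _ (flipTL (vTL u))) cE.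
rewrite compZl JW_v compZr !scalerA.
congr (_ *: _); rewrite -mulrA mulrC; congr (_ * _).
Qed.

Lemma G_sandwich0 lam mu (s t : aseq i k lam) (u w : aseq i k mu) X : lam <> mu ->
  GTL s t *c X *c GTL u w = 0.
Proof.
move=> lm; rewrite /GTL !compZl compZr; set V := flipTL (vTL s).
rewrite (compTLA V) (compTLA V) -(compTLA _ (flipTL (vTL u))) v_sandwich0 //.
by rewrite comp0l comp0r !scaler0.
Qed.

Lemma G_diag_neq0 lam (s : aseq i k lam) : GTL s s <> 0.
Proof.
move=> G0; apply: (@JW_neq0 lam).
have : vTL s *c GTL s s *c flipTL (vTL s) = eta s *: JW lam.
  rewrite /GTL compZr compZl -(compTLA (vTL s)) v_flip compZl JW_v compZl v_flip.
  by rewrite scalerA mulVf ?eta_neq0 // scale1r.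
rewrite G0 comp0r comp0l => /esym/eqP; rewrite scaler_eq0 (negPf (eta_neq0 s)).
by move/eqP.
Qed.

Section Ideal.
Variables (lam : nat) (s : aseq i k lam).
Local Notation e := (GTL s s).

Lemma ideal_subspace : is_subspace (right_ideal (k := k) (i := i) e).
Proof.
split; first by exists 0; [apply: subspace0 colTL_subspace|rewrite comp0r].
move=> a _ _ [X Xc <-] [Y Yc <-]; exists (a *: X + Y); last by rewrite comp_linr.
by apply: colTL_subspace.2.
Qed.

Lemma ideal_col y : right_ideal (k := k) (i := i) e y -> colTL k i y.
Proof. by case=> X Xc <-; apply: colTL_comp => //; apply: G_col. Qed.

Lemma ideal_e y : right_ideal (k := k) (i := i) e y -> e *c y = y.
Proof. by case=> X Xc <-; rewrite -(compTLA e) G_mul. Qed.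

Lemma G_ideal t : right_ideal (k := k) (i := i) e (GTL s t).
Proof. by exists (GTL s t); [apply: G_col|rewrite G_mul]. Qed.

Lemma ideal_comp y X : right_ideal (k := k) (i := i) e y -> colTL k i X ->
  right_ideal (k := k) (i := i) e (y *c X).
Proof.
by case=> Y Yc <- Xc; exists (Y *c X); [apply: colTL_comp|rewrite -(compTLA e)].
Qed.

(** For y in the ideal, y = e y F. Expanding F as a sum of G_{t,t} turns each term into a multiple
    of G_{s,t}, or 0 when the weights differ. *)
Lemma ideal_span (k0 : (0 < k)%N) :
  right_ideal (k := k) (i := i) e = lin_span [set GTL s t | t in setT].
Proof.
apply/seteqP; split; last first.
  by apply: lin_span_min => [|_ [t _ <-]]; [apply: ideal_subspace|apply: G_ideal].
move=> y yI; have [L LE] := G_completeness i k0.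
have -> : y = \sum_(p <- L) e *c y *c GTL (tagged p) (tagged p).
  by rewrite -comp_sumr -LE ideal_e // (colTL_unit (ideal_col yI)).2.
apply: subspace_sum => [|[mu t] /=]; first exact: lin_span_subspace.
have [lm|/eqP lm] := eqVneq lam mu; last first.
  by rewrite G_sandwich0 //; apply: subspace0; apply: lin_span_subspace.
subst mu; have [c ->] := G_sandwich s s t t y.
by apply: subspaceZ; [apply: lin_span_subspace|apply: lin_span_sub; exists t].
Qed.

Lemma ideal_rmodule : is_rmodule (right_ideal (k := k) (i := i) e) (ract k i).
Proof.
split.
- exact: ideal_subspace.
- by move=> w X; apply: ideal_comp.
- by move=> a w w' X _ _ _; apply: comp_linl.
- by move=> a w X Y _ _ _; apply: comp_linr.
- by move=> w X Y _ _ _; rewrite /ract (compTLA w).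
by move=> w /ideal_col/colTL_unit[].
Qed.
End Ideal.

(** * Abstract modules and Schur's lemma *)

Section Module.
Variables (W : lmodType QA) (P : set W) (act : W -> TL N N -> W).
Hypothesis M : is_rmodule P act.

(** The action is linear only on [P] and [colTL], so the general [lin_big] is not applicable. *)
Lemma act_sum w I (r : seq I) (X : I -> TL N N) : P w -> (forall j, colTL k i (X j)) ->
  act w (\sum_(j <- r) X j) = \sum_(j <- r) act w (X j).
Proof.
move=> Pw Xc; have c0 := subspace0 colTL_subspace.
elim: r => [|j r IH]; last first.
  rewrite !big_cons -IH -{1}[X j]scale1r (rmod_linear_r M) ?scale1r //.
  by apply: subspace_sum => //; apply: colTL_subspace.
rewrite !big_nil; have := rmod_linear_r M (-1) Pw c0 c0.
by rewrite scaler0 addr0 scaleN1r addNr.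
Qed.

Lemma act0 X : colTL k i X -> act 0 X = 0.
Proof.
move=> Xc; have P0 := subspace0 (rmod_subspace M).
have := rmod_linear_l M (-1) P0 P0 Xc.
by rewrite scaler0 addr0 scaleN1r addNr.
Qed.

Lemma nonzero_component w : (0 < k)%N -> P w -> w <> 0 ->
  exists lam (t : aseq i k lam), act w (GTL t t) <> 0.
Proof.
move=> k0 Pw w0; apply: contrapT => H; apply: w0.
have [L LE] := G_completeness i k0.
rewrite -(rmod_one M Pw) LE act_sum // => [|p]; last exact: G_col.
rewrite big1 // => -[mu t] _ /=; apply: contrapT => h; apply: H.
by exists mu, t.
Qed.
End Module.

(** The kernel and the image of g are submodules. The map g runs opposite to the required
    isomorphism because a homomorphism out of the ideal e A is easy to write down: it is the action
    on a fixed vector. *)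
Lemma schur (W W' : lmodType QA) (P : set W) (I : set W')
    (act : W -> TL N N -> W) (act' : W' -> TL N N -> W') (g : W' -> W) :
  irreducible_rmodule P act -> irreducible_rmodule I act' ->
  (forall a y z, I y -> I z -> g (a *: y + z) = a *: g y + g z) ->
  (forall y X, I y -> colTL k i X -> g (act' y X) = act (g y) X) ->
  (forall y, I y -> P (g y)) -> (exists2 y, I y & g y <> 0) ->
  rmodule_iso (k := k) (i := i) P act I act'.
Proof.
move=> [M _ Pirr] [M' _ Iirr] g_lin g_act g_P [y0 Iy0 gy0].
have IS := rmod_subspace M'; have I0 := subspace0 IS.
have g0 : g 0 = 0.
  by have := g_lin (-1) _ _ I0 I0; rewrite scaler0 addr0 scaleN1r addNr.
have kerg y : I y -> g y = 0 -> y = 0.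
  have [|K0|KI] := Iirr [set y | I y /\ g y = 0].
  - split.
    + split; first by split.
      move=> a u v [Iu gu] [Iv gv]; split; first exact: IS.2.
      by rewrite g_lin // gu gv scaler0 addr0.
    + by move=> u [].
    + move=> u X [Iu gu] Xc; split; first exact: (rmod_closed M').
      by rewrite g_act // gu (act0 M).
  - move=> Iy gy; have : [set y | I y /\ g y = 0] y by [].
    by rewrite K0.
  have : [set y | I y /\ g y = 0] y0 by rewrite KI.
  by case=> _ /gy0.
have g_inj y z : I y -> I z -> g y = g z -> y = z.
  move=> Iy Iz gyz; apply/eqP; rewrite -subr_eq0 -scaleN1r addrC; apply/eqP.
  apply: kerg; first exact: IS.2.
  by rewrite g_lin // gyz scaleN1r addNr.
have g_surj v : P v -> exists2 y, I y & g y = v.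
  have [|Q0|QP] := Pirr [set v | exists2 y, I y & g y = v].
  - split.
    + split; first by exists 0.
      move=> a _ _ [y Iy <-] [z Iz <-]; exists (a *: y + z); first exact: IS.2.
      exact: g_lin.
    + by move=> _ [y Iy <-]; apply: g_P.
    + move=> _ X [y Iy <-] Xc; exists (act' y X); first exact: (rmod_closed M').
      exact: g_act.
  - have : [set v | exists2 y, I y & g y = v] (g y0) by exists y0.
    by rewrite Q0 => /gy0.
  by move=> Pv; have : [set v | exists2 y, I y & g y = v] v by rewrite QP.
(* The inverse of g; the default 0 is taken only outside [P]. *)
pose f v := xget 0 [set y | I y /\ g y = v].
have fP v : P v -> I (f v) /\ g (f v) = v.
  move=> Pv; have [y Iy gy] := g_surj v Pv.
  have yv : [set y | I y /\ g y = v] y by [].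
  exact: (xgetI 0 yv).
exists f; split.
- split.
  + by move=> v /fP[].
  + move=> u v; rewrite !inE => /fP[_ gu] /fP[_ gv] e.
    by rewrite -gu -gv e.
  + move=> y Iy; exists (g y); first exact: g_P.
    have [If gf] := fP _ (g_P _ Iy); exact: g_inj.
- move=> a u v Pu Pv; have [Iu gu] := fP _ Pu; have [Iv gv] := fP _ Pv.
  have [|Iuv guv] := fP (a *: u + v); first exact: (rmod_subspace M).2.
  apply: g_inj => //; first exact: IS.2.
  by rewrite guv g_lin // gu gv.
move=> v X Pv Xc; have [Iv gv] := fP _ Pv.
have [|IvX gvX] := fP (act v X); first exact: (rmod_closed M).
apply: g_inj => //; first exact: (rmod_closed M').
by rewrite gvX g_act // gv.
Qed.

Lemma nonzero_vector (W : lmodType QA) (P : set W) : is_subspace P -> P <> [set 0] ->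
  exists2 w, P w & w <> 0.
Proof.
move=> PS Pn0; apply: contrapT => H; apply: Pn0; apply/seteqP; split=> w /=.
  by move=> Pw; apply: contrapT => w0; apply: H; exists w.
by move=> ->; apply: subspace0.
Qed.

(** A nonzero y in a submodule has some nonzero y G_{t,t}, which is a multiple of G_{s,t}. So the
    submodule contains G_{s,t}, hence the generator G_{s,s} = G_{s,t} G_{t,s}. *)
Lemma ideal_irreducible lam (s : aseq i k lam) : (0 < k)%N ->
  irreducible_rmodule (right_ideal (k := k) (i := i) (GTL s s)) (ract k i).
Proof.
move=> k0; split; first exact: ideal_rmodule.
  move=> e0; have := G_ideal s s; rewrite e0 /= => h.
  exact: (G_diag_neq0 h).
move=> Q [QS QI Qact]; have [->|Q0] := pselect (Q = [set 0]); [by left|right].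
have [y Qy y0] := nonzero_vector QS Q0; have yI := QI _ Qy.
have [mu [t yt]] := nonzero_component (ideal_rmodule s) k0 yI y0.
apply/seteqP; split; first exact: QI.
have [lm|/eqP lm] := eqVneq lam mu; last first.
  by case: yt; rewrite /ract -(ideal_e yI) G_sandwich0.
subst mu; have [c cE] := G_sandwich s s t t y.
rewrite (ideal_e yI) in cE; have c0 : c != 0.
  by apply/eqP => c0; apply: yt; rewrite /ract cE c0 scale0r.
have Qst : Q (GTL s t).
  have -> : GTL s t = c^-1 *: (y *c GTL t t) by rewrite cE scalerA mulVf // scale1r.
  by apply: subspaceZ => //; apply: Qact => //; apply: G_col.
have Qe : Q (GTL s s) by rewrite -(G_mul s t s); apply: Qact => //; apply: G_col.
by move=> _ [X Xc <-]; apply: Qact.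
Qed.

(** A homomorphism f satisfies f(e) = f(e) e, and f(e) lies in the other ideal, so f(e) = G_{t,t}
    f(e) G_{s,s} = 0. *)
Lemma ideal_not_iso lam mu (s : aseq i k lam) (t : aseq i k mu) : lam <> mu ->
  ~ rmodule_iso (k := k) (i := i) (right_ideal (k := k) (i := i) (GTL s s)) (ract k i)
      (right_ideal (k := k) (i := i) (GTL t t)) (ract k i).
Proof.
move=> lm [f [[fI f_inj _] f_lin f_act]].
have eI := G_ideal s s; have zI := subspace0 (ideal_subspace s).
have f0 : f 0 = 0.
  by have := f_lin (-1) _ _ zI zI; rewrite scaler0 addr0 scaleN1r addNr.
have fe : f (GTL s s) = 0.
  have := f_act _ _ eI (G_col s s); rewrite /ract G_mul => ->.
  by rewrite -(ideal_e (fI _ eI)) G_sandwich0 // => e; apply: lm.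
apply: (@G_diag_neq0 _ s); apply: f_inj; rewrite ?inE //.
by rewrite fe f0.
Qed.

(** Here t is whichever sequence detects w, and s the chosen representative of the same weight. The
    vector w G_{t,s} is nonzero because G_{s,t} takes it to w G_{t,t}, and acting on it maps the
    ideal of s to P. *)
Lemma irreducible_iso_ideal (W : lmodType QA) (P : set W) act lam (s t : aseq i k lam) w :
  (0 < k)%N -> irreducible_rmodule P act -> P w -> act w (GTL t t) <> 0 ->
  rmodule_iso (k := k) (i := i) P act (right_ideal (k := k) (i := i) (GTL s s)) (ract k i).
Proof.
move=> k0 Pirr Pw wt; have [M _ _] := Pirr.
pose w' := act w (GTL t s).
have Pw' : P w' := rmod_closed M Pw (G_col t s).
have w'e : act w' (GTL s s) = w'.
  by rewrite /w' -(rmod_mul M Pw (G_col t s) (G_col s s)) G_mul.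
have w'0 : w' <> 0.
  move=> e; apply: wt.
  rewrite -(G_mul t s t) (rmod_mul M Pw (G_col t s) (G_col s t)) -/w' e.
  exact: (act0 M (G_col s t)).
apply: (schur Pirr (ideal_irreducible s k0) (g := act w')).
- by move=> a y z /ideal_col yc /ideal_col zc; exact: (rmod_linear_r M a Pw' yc zc).
- by move=> y X /ideal_col yc Xc; exact: (rmod_mul M Pw' yc Xc).
- by move=> y /ideal_col yc; exact: (rmod_closed M Pw' yc).
by exists (GTL s s); [exact: G_ideal|rewrite w'e].
Qed.

End ColoredAlgebra.

Lemma aseq_Lambda i k lam (s : aseq i k lam) : lam \in Lambda k i.
Proof.
suff [j jk ->] : exists2 j, (j.*2 <= k * i)%N & lam = (k * i - j.*2)%N.
  apply/mapP; exists j => //; rewrite mem_iota add0n ltnS leq0n /=.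
  by rewrite -[j]doubleK half_leq.
elim: s => [|{}k x {}lam s [j jk xE] a]; first by exists 0%N; rewrite ?mul1n ?subn0.
(* Admissibility makes x + i - lam even and nonnegative; half of it is the number of arcs between
   the x strands and the new i strands. *)
case/and4P: a => par h1 h2 h3; exists (j + (x + i - lam)./2)%N; rewrite mulSn; lia.
Qed.

Theorem corollary6p4 (k i : nat) (hk : (1 <= k)%N) (hi : (1 <= i)%N)
    (s : forall lam : nat, lam \in Lambda k i -> inhabited (aseq i k lam) ->
         aseq i k lam) :
  let e lam hl hT := GTL (s lam hl hT) (s lam hl hT) in
  let ideal lam hl hT := right_ideal (e lam hl hT) in
  [/\ forall lam hl hT,
        [/\ colTL k i (e lam hl hT),
            e lam hl hT *c e lam hl hT = e lam hl hT &
            ideal lam hl hT = lin_span [set GTL (s lam hl hT) t | t in setT]],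
      forall lam hl hT, irreducible_rmodule (ideal lam hl hT) (ract k i),
      forall lam hl hT mu hm hU, lam <> mu ->
        ~ rmodule_iso (ideal lam hl hT) (ract k i) (ideal mu hm hU) (ract k i) &
      forall (W : lmodType QA) (P : set W)
          (act : W -> TL (width k i) (width k i) -> W),
        irreducible_rmodule P act ->
        exists lam hl hT, rmodule_iso P act (ideal lam hl hT) (ract k i)].
Proof.
move=> e ideal; split.
- move=> lam hl hT; split; [exact: G_col|exact: G_mul|exact: ideal_span].
- by move=> lam hl hT; apply: ideal_irreducible.
- by move=> lam hl hT mu hm hU; apply: ideal_not_iso.
move=> W P act Pirr; have [M Pn0 _] := Pirr.
have [w Pw w0] := nonzero_vector (rmod_subspace M) Pn0.
have [lam [t wt]] := nonzero_component M hk Pw w0.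
(* The sequence t found in the module itself shows that lam lies in [Lambda k i] and that there are
   sequences of weight lam. *)
exists lam, (aseq_Lambda t), (inhabits t).
exact: (irreducible_iso_ideal _ hk Pirr Pw wt).
Qed.
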